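(* There exist a smooth quintic $Q$, a line $L$ and at least $9$ different conics $F_i$, $i=1,\ldots,9$, in $\mathbb{P}^2$ such that: \begin{itemize} \item $F_i\cap Q\cap L=\emptyset$ for every $i$; \item the multiplicity of intersection of $F_i$ and $Q$ is even in each of their intersection points (in particular $F_i$ is tangent to $Q$ in every intersection point); \item the multiplicity of intersection of $F_i$ and $L$ is even in each of their intersection points (in particular $F_i$ is tangent to $L$ in every intersection point); \item the intersection points of two conics $F_i$ and $F_j$, $i\neq j$, are never contained in $Q\cup L$. \end{itemize} Each of these conics cuts an odd theta characteristic of $Q$. There exist a smooth quartic $R$, a conic $B$ and at least $7$ different lines $G_i$, $i=1,\ldots,7$, in $\mathbb{P}^2$ such that: \begin{itemize} \item $G_i\cap R\cap B=\emptyset$ for every $i$; \item the multiplicity of intersection of $G_i$ and $R$ is even in each of their intersection points (in particular $G_i$ is tangent to $R$ in every intersection point); \item the multiplicity of intersection of $G_i$ and $B$ is even in each of their intersection points (in particular $G_i$ is tangent to $B$ in every intersection point); \item the intersection points of two lines $G_i$ and $G_j$, $i\neq j$, are never contained in $R\cup B$. \end{itemize} Each of these lines cuts an odd theta characteristic of $R$.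
   Context: Everything is over $\mathbb{C}$ and quintic, quartic, conic, line mean plane curves of degree $5,4,2,1$. A curve $F$ meeting a smooth plane curve $Q$ with even multiplicity at every intersection point, so that its intersection divisor on $Q$ is $2\Delta$, is said to cut an odd theta characteristic of $Q$ if $2\Delta$ is a canonical divisor of $Q$ and $h^0(Q,\mathcal{O}_Q(\Delta))$ is odd. *)

(* Defs.v *)
(* Points of P^2 are nonzero vectors of homogeneous coordinates.  Every      *)
(* notion below that involves a point depends only on the point of P^2, not  *)
(* on the chosen coordinate vector.                                          *)
From HB Require Import structures.
From mathcomp Require Import all_boot all_order all_algebra.
From mathcomp Require Import mpoly complex.
From mathcomp Require Import reals.

Set Implicit Arguments.
Unset Strict Implicit.
Unset Printing Implicit Defensive.

Import GRing.Theory.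

Local Open Scope ring_scope.

Definition ppoint (k : fieldType) : Type := {ffun 'I_3 -> k}.
Definition tpoly (k : fieldType) : Type := {mpoly k[3]}.

(* All rational functions used below are the elements of degree 0 of this    *)
(* field, i.e. fractions of homogeneous polynomials of the same degree.      *)
Definition ratfrac (k : fieldType) : Type := {fraction {mpoly k[3]}}.

Definition on_curve (k : fieldType) (f : tpoly k) (P : ppoint k) : Prop :=
  P != 0 /\ f.@[P] = 0.

Definition tdivides (k : fieldType) (q a : tpoly k) : Prop :=
  exists c : tpoly k, a = c * q.

(* Curves are reduced: without this, a doubled line would be a conic, with   *)
(* even intersection multiplicities with every other curve.                  *)
Definition plane_curve (k : fieldType) (d : nat) (f : tpoly k) : Prop :=
  [/\ f != 0, f \is d.-homog
    & forall g : tpoly k, tdivides (g ^+ 2) f -> exists c : k, g = c%:MP].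

Definition smooth (k : fieldType) (f : tpoly k) : Prop :=
  forall P : ppoint k, on_curve f P -> exists i : 'I_3, (f^`M(i)).@[P] != 0.

Definition same_curve (k : fieldType) (f g : tpoly k) : Prop :=
  exists2 c : k, c != 0 & f = c *: g.

Definition cst (k : fieldType) (c : k) : ratfrac k :=
  FracField.tofrac (c%:MP : {mpoly k[3]}).

(* For k-subspaces W of V: the k-vector space V / W has dimension n.         *)
Definition quotient_dim (k : fieldType) (V W : ratfrac k -> Prop) (n : nat) :
    Prop :=
  exists e : 'I_n -> ratfrac k,
    (forall i, V (e i)) /\
    (forall x, V x ->
       exists! c : {ffun 'I_n -> k}, W (x - \sum_(i < n) cst (c i) * e i)).

Definition is_quotient (k : fieldType) (x : ratfrac k) (a b : tpoly k) : Prop :=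
  [/\ exists2 d : nat, a \is d.-homog & b \is d.-homog,
      b != 0 & x = FracField.tofrac a / FracField.tofrac b].

(* The local ring of P^2 at P, and its ideal generated by local equations    *)
(* of the curves f = 0 and g = 0.                                            *)
Definition local_ring (k : fieldType) (P : ppoint k) (x : ratfrac k) : Prop :=
  exists a b : tpoly k, is_quotient x a b /\ b.@[P] != 0.

Definition local_ideal (k : fieldType) (f g : tpoly k) (P : ppoint k)
    (x : ratfrac k) : Prop :=
  exists u v b : tpoly k, is_quotient x (u * f + v * g) b /\ b.@[P] != 0.

(* The intersection multiplicity of f = 0 and g = 0 at P is n; it is         *)
(* infinite (no n qualifies) when P lies on a common component.              *)
Definition intersection_mult (k : fieldType) (f g : tpoly k) (P : ppoint k)
    (n : nat) : Prop :=
  quotient_dim (local_ring P) (local_ideal f g P) n.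

Definition even_intersections (k : fieldType) (f g : tpoly k) : Prop :=
  forall P : ppoint k, on_curve f P -> on_curve g P ->
    exists2 n : nat, intersection_mult f g P n & ~~ odd n.

(* The function field k(Q) of an integral curve Q : q = 0 is the residue     *)
(* field of the local ring of P^2 at the generic point of Q.  It is handled  *)
(* through representatives: ratfun q is that local ring, and vanishing q its *)
(* maximal ideal, so that k(Q) = ratfun q / vanishing q.                     *)
Definition ratfun (k : fieldType) (q : tpoly k) (x : ratfrac k) : Prop :=
  exists a b : tpoly k, is_quotient x a b /\ ~ tdivides q b.

Definition vanishing (k : fieldType) (q : tpoly k) (x : ratfrac k) : Prop :=
  exists a b : tpoly k, [/\ is_quotient x a b, ~ tdivides q b & tdivides q a].

(* Order at P of a nonzero rational function of the smooth curve q = 0.      *)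
Definition rat_order (k : fieldType) (q : tpoly k) (P : ppoint k)
    (x : ratfrac k) (n : int) : Prop :=
  exists (a b : tpoly k) (i j : nat),
    [/\ is_quotient x a b,
        ~ tdivides q a /\ ~ tdivides q b,
        intersection_mult a q P i,
        intersection_mult b q P j
      & n = i%:Z - j%:Z].

(* Divisors on q = 0 are given by their coefficients at points; values at    *)
(* points outside the curve are irrelevant.                                  *)
Definition curve_divisor (k : fieldType) : Type := ppoint k -> int.

Definition riemann_roch_space (k : fieldType) (q : tpoly k)
    (D : curve_divisor k) (x : ratfrac k) : Prop :=
  ratfun q x /\
  (vanishing q x \/
   forall P : ppoint k, on_curve q P ->
     exists2 n : int, rat_order q P x n & 0 <= n + D P).

Definition h0 (k : fieldType) (q : tpoly k) (D : curve_divisor k) (n : nat) :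
    Prop :=
  quotient_dim (riemann_roch_space q D) (vanishing q) n.

(* k-derivations of k(Q), on representatives. *)
Definition derivation (k : fieldType) (q : tpoly k)
    (delta : ratfrac k -> ratfrac k) : Prop :=
  [/\ forall x, ratfun q x -> ratfun q (delta x),
      forall x, vanishing q x -> vanishing q (delta x),
      forall c : k, vanishing q (delta (cst c)),
      forall x y, ratfun q x -> ratfun q y ->
        vanishing q (delta (x + y) - (delta x + delta y))
    & forall x y, ratfun q x -> ratfun q y ->
        vanishing q (delta (x * y) - (x * delta y + y * delta x))].

(* Equality u dv = w dt of rational differentials of Q, the module of        *)
(* differentials of k(Q) / k being the dual of its module of derivations.    *)
Definition eq_differential (k : fieldType) (q : tpoly k)
    (u v w t : ratfrac k) : Prop :=
  forall delta, derivation q delta ->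
    vanishing q (u * delta v - w * delta t).

(* D = div (u dv) for some nonzero rational differential u dv.  Its order at *)
(* P is that of w when it is written w dt with t a uniformizer at P; in      *)
(* particular u dv is nonzero as w has a finite order.                       *)
Definition canonical_divisor (k : fieldType) (q : tpoly k)
    (D : curve_divisor k) : Prop :=
  exists u v : ratfrac k,
    [/\ ratfun q u, ratfun q v
      & forall P : ppoint k, on_curve q P ->
          exists w t : ratfrac k,
            [/\ rat_order q P t 1, rat_order q P w (D P)
              & eq_differential q u v w t]].

Definition cuts_odd_theta (k : fieldType) (f q : tpoly k) : Prop :=
  exists Delta : curve_divisor k,
    [/\ forall P : ppoint k, on_curve q P ->
          exists2 n : nat, intersection_mult f q P n & n%:Z = Delta P *+ 2,
        canonical_divisor q (fun P => Delta P *+ 2)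
      & exists2 n : nat, h0 q Delta n & odd n].

(* Main.v *)
Require Import Defs.
From HB Require Import structures.
From mathcomp Require Import all_boot all_order all_algebra.
From mathcomp Require Import mpoly complex.
From mathcomp Require Import reals zify ring.
From mathcomp Require Import separable cyclotomic cyclic.
From mathcomp Require boolp.

(** The curves are the Fermat quartic [X^4 + Y^4 + Z^4] and the quintic
[8 X^5 + Y^5 + Z^5]; the tangent curves are explicit.  What needs an argument
is that they cut odd theta characteristics, and this rests on one theorem about
a smooth diagonal curve [q = a_0 X_0^d + a_1 X_1^d + a_2 X_2^d] and a curve [F]
of degree [d - 3] with a polynomial parametrization [phi]
([tangent_cuts_odd_theta]).  Suppose that [q] pulls back along [phi] to
[c * sigma^2].

- Multiplicities.  At the point of parameter [x] the curves meet with twice the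
  multiplicity of [x] as a root of [sigma] ([rc_square_mult]), so the
  intersection divisor is [2 Delta].
- [2 Delta] is canonical.  The divisor of the differential
  [(F X_0^2 / (a_2 X_2^(d-1))) d(X_1 / X_0)] is the one cut out by [F], as
  is seen from the forms that it takes in the other affine charts
  ([diagonal_canonical]).
- [h^0(Delta) = 1].  Let [f / b] have poles bounded by [Delta].  Then [f F]
  vanishes at least on [div b + Delta], so Noether's theorem
  ([diagonal_noether]) gives [f F = c b + B q] with [c] of degree [d - 3], and
  [c] vanishes on [Delta].  Hence [sigma] divides the pull-back of [c].  In the
  cases at hand the latter has smaller degree than [sigma] (at most 1 against
  2 for a line and a quartic, at most 4 against 5 for a conic and a quintic), so
  it is 0, [c] is a multiple of [F], and [f / b] is a constant.

The local algebra is elementary: at a point where a curve has a uniformizer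
[t], the quotient of the local ring of the plane by [(t^n, g)] has the powers
of [t] as a basis ([quotient_dim_chart]), so intersection multiplicities are
orders of vanishing.  For a diagonal curve the global facts have direct
proofs.  Its equation is prime because the orders of vanishing at a hyperflex
add up ([diagonal_prime]); and multiplying a form by its conjugates under
[X_1 := w X_1], [w^d = 1], yields, modulo [q], a form in [X_0] and [X_2] only, that is a
product of lines through [(0 : 1 : 0)], which reduces Noether's theorem to
polynomials in one variable.

For the quartic the seven lines are bitangents or hyperflex lines that happen to
touch one more conic.  Two of them have no common contact point, for the tangent
line of a smooth curve at a point is unique.  For the quintic the automorphisms
[(X : w Y : w^-1 Z)], [w^5 = 1], and a conjugation [sqrt 5 := - sqrt 5] turn one
conic with five double contacts into ten.  They all touch the line [X = 0], and
they share no contact point: [Y Z / X^2], which the automorphisms leave alone,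
determines the parameter of a contact point, and then its coordinates determine
the conic. *)

Set Implicit Arguments.
Unset Strict Implicit.
Unset Printing Implicit Defensive.

Import Order.TTheory GRing.Theory Num.Theory.

Local Open Scope ring_scope.

Notation frac := (@FracField.tofrac _).

(** * Forms in three variables *)

Section Forms.
Variable k : fieldType.
Implicit Types (f g h : {mpoly k[3]}) (P : ppoint k).

Lemma homog_var i : ('X_i : {mpoly k[3]}) \is 1.-homog.
Proof. by rewrite dhomogX /= mdeg1. Qed.

Lemma homog_const (c : k) : (c%:MP : {mpoly k[3]}) \is 0.-homog.
Proof. by rewrite -alg_mpolyC; apply: rpredZ; apply: dhomog1. Qed.

(** Multiplication by a form of degree [d] shifts homogeneous components by [d].
This is what turns an identity [f = a * t + b * u] into one between forms. *)
Lemma pihomogM f g d e : f \is d.-homog ->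
  pihomog [measure of mdeg] (d + e) (f * g) = f * pihomog [measure of mdeg] e g.
Proof.
move=> hf; rewrite {1}(pihomog_partitionE (mf := [measure of mdeg])
  (leqnn (msize g))) mulr_sumr raddf_sum /=.
case: (ltnP e (msize g)) => [lte|lee].
  rewrite (bigD1 (Ordinal lte)) //= big1 ?addr0.
    by apply: pihomog_dE; apply: dhomogM => //; apply: pihomogP.
  move=> i ne; apply: (pihomog_ne0 (d := d + i)).
    by rewrite eqn_add2l; apply: contraNneq ne => ei; apply/eqP/val_inj.
  by apply: dhomogM => //; apply: pihomogP.
rewrite big1 => [|i _].
  rewrite pihomogE big_seq_cond big1 ?mulr0 // => m /andP[mg /eqP me].
  by have := msize_mdeg_lt mg; rewrite me ltnNge lee.
apply: (pihomog_ne0 (d := d + i)).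
  by rewrite eqn_add2l neq_ltn (leq_trans (ltn_ord i)).
by apply: dhomogM => //; apply: pihomogP.
Qed.

Lemma pihomogM_lt f g d n : f \is d.-homog -> (n < d)%N ->
  pihomog [measure of mdeg] n (f * g) = 0.
Proof.
move=> hf lt_nd; rewrite (pihomog_partitionE (mf := [measure of mdeg])
  (leqnn (msize g))) mulr_sumr raddf_sum /= big1 // => i _.
apply: (pihomog_ne0 (d := d + i)).
  by rewrite neq_ltn (leq_trans lt_nd) ?leq_addr ?orbT.
by apply: dhomogM => //; apply: pihomogP.
Qed.

Lemma meval_homogZ f d (P P' : 'I_3 -> k) c : f \is d.-homog -> (forall i, P' i = c * P i) ->
  f.@[P'] = c ^+ d * f.@[P].
Proof.
move=> /dhomogP hf PP'; rewrite !mevalE mulr_sumr; rewrite !big_seq.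
apply: eq_bigr => m mm; rewrite mulrCA; congr (_ * _).
have <- : mdeg m = d by exact: hf.
rewrite mdegE -prodrXr -big_split /=.
by apply: eq_bigr => i _; rewrite PP' exprMn.
Qed.

Definition subst (g : 'I_3 -> {mpoly k[3]}) f : {mpoly k[3]} :=
  mmap (@mpolyC 3 k) g f.

HB.instance Definition _ (g : 'I_3 -> {mpoly k[3]}) := GRing.RMorphism.copy (subst g) (mmap (@mpolyC 3 k) g).

Lemma substC (g : 'I_3 -> {mpoly k[3]}) c : subst g c%:MP = c%:MP.
Proof. exact: mmapC. Qed.

Lemma substX (g : 'I_3 -> {mpoly k[3]}) i : subst g 'X_i = g i.
Proof. by rewrite /subst mmapX mmap1U. Qed.

Lemma mpoly_ring_ind (Q : {mpoly k[3]} -> Prop) :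
  (forall c, Q c%:MP) -> (forall i, Q 'X_i) ->
  (forall f g, Q f -> Q g -> Q (f + g)) -> (forall f g, Q f -> Q g -> Q (f * g)) ->
  forall f, Q f.
Proof.
move=> Qc QX QD QM f; rewrite [f]mpolyE.
have Q0 : Q 0 by rewrite -mpolyC0.
apply: (big_ind Q) => [//|x y|m _]; first exact: QD.
rewrite -mul_mpolyC; apply: (QM) => //; rewrite mpolyXE_id.
apply: (big_ind Q) => [|x y|i _]; [by rewrite -mpolyC1 | exact: (QM) |].
by elim: (m i) => [|n IH]; [rewrite expr0 -mpolyC1 | rewrite exprS; apply: (QM)].
Qed.

(** Substitution is a ring morphism, and modulo the ideal [J] it fixes the
variables. *)
Lemma subst_diff (J : {mpoly k[3]} -> Prop) (g : 'I_3 -> {mpoly k[3]}) :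
  J 0 -> (forall x y, J x -> J y -> J (x + y)) -> (forall a x, J x -> J (a * x)) ->
  (forall i, J ('X_i - g i)) -> forall f, J (f - subst g f).
Proof.
move=> J0 JD JM JX; elim/mpoly_ring_ind => [c|i|f h Jf Jh|f h Jf Jh].
- by rewrite (substC g) subrr.
- by rewrite (substX g).
- by rewrite rmorphD opprD addrACA; apply: JD.
- rewrite rmorphM; set f' := subst g f; set h' := subst g h.
  rewrite (_ : f * h - f' * h' = h * (f - f') + f' * (h - h')); last by ring.
  by apply: JD; apply: JM.
Qed.

Lemma subst_ray P (r f : {mpoly k[3]}) d : f \is d.-homog ->
  subst (fun i => (P i)%:MP * r) f = (f.@[P])%:MP * r ^+ d.
Proof.
move=> /dhomogP hf; rewrite /subst /mmap mevalE [in RHS]raddf_sum mulr_suml !big_seq.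
apply: eq_bigr => m mm; rewrite /= mpolyCM rmorph_prod /= -mulrA; congr (_ * _).
have <- : mdeg m = d by exact: hf.
rewrite /mmap1 mdegE -prodrXr -big_split /=.
by apply: eq_bigr => i _; rewrite exprMn rmorphXn.
Qed.

Lemma homog0_const f : f \is 0.-homog -> exists c, f = c%:MP.
Proof.
move=> /dhomogP hf; exists (f@_0%MM); apply/mpolyP => m; rewrite mcoeffC.
case: eqP => [->|ne]; first by rewrite mulr1.
rewrite mulr0; apply: memN_msupp_eq0; apply/negP => mm.
by apply: ne; apply/eqP; rewrite -mdeg_eq0; apply/eqP; apply: hf.
Qed.

Definition pull (phi : 'I_3 -> {poly k}) f : {poly k} := mmap (@polyC k) phi f.
HB.instance Definition _ phi := GRing.RMorphism.copy (pull phi) (mmap (@polyC k) phi).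

Lemma pullC phi c : pull phi c%:MP = c%:P.
Proof. exact: mmapC. Qed.

Lemma pullX phi i : pull phi 'X_i = phi i.
Proof. by rewrite /pull mmapX mmap1U. Qed.

Lemma pullZ phi c f : pull phi (c *: f) = c *: pull phi f.
Proof. by rewrite /pull mmapZ mul_polyC. Qed.

Lemma pull_horner phi f x : (pull phi f).[x] = f.@[fun i => (phi i).[x]].
Proof.
elim/mpoly_ring_ind: f => [c|i|f h IHf IHh|f h IHf IHh].
- by rewrite pullC hornerC mevalC.
- by rewrite pullX mevalXU.
- by rewrite rmorphD hornerD mevalD IHf IHh.
- by rewrite rmorphM hornerM mevalM IHf IHh.
Qed.

Lemma size_pull (phi : 'I_3 -> {poly k}) f d e : f \is d.-homog -> (forall i, size (phi i) <= e.+1)%N ->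
  (size (pull phi f) <= (d * e).+1)%N.
Proof.
move=> /dhomogP hf he; rewrite /pull /mmap big_seq.
apply: (leq_trans (size_sum _ _ _)); apply/bigmax_leqP_seq => m mm _.
rewrite mul_polyC; apply: (leq_trans (size_scale_leq _ _)).
have <- : mdeg m = d by exact: hf.
rewrite mdegE /mmap1 big_distrl /=.
elim/big_ind2: _ => [|n1 p1 n2 p2 h1 h2|i _]; first by rewrite size_poly1.
  apply: (leq_trans (size_polyMleq _ _)).
  by by move: h1 h2; case: (size p1) => [|a]; case: (size p2) => [|b] /=; lia.
apply: (leq_trans (size_poly_exp_leq _ _)); rewrite ltnS mulnC leq_mul2l.
by apply/orP; right; have := he i; lia.
Qed.

End Forms.

(** * Local rings of the plane and smooth points of curves *)

Section FieldIdentities.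
Variable F : fieldType.
Implicit Types a b c d r s t : F.

Lemma fdivD a b c d : b != 0 -> d != 0 -> (a * d + c * b) / (b * d) = a / b + c / d.
Proof. by move=> b0 d0; field; rewrite b0 d0. Qed.

Lemma fdivZ s a b : s != 0 -> (s * a) / (s * b) = a / b.
Proof. by move=> s0; rewrite -mulf_div divff // mul1r. Qed.

Lemma fdiv_step a b c s al t r : b != 0 -> s != 0 -> r != 0 ->
  a / b - c - al * r / (s * b) * (t / r) = (s * (a - c * b) - al * t) / (s * b).
Proof. by move=> b0 s0 r0; field; rewrite b0 s0 r0. Qed.

End FieldIdentities.

Section Local.
Variable k : fieldType.
Implicit Types (f g h : {mpoly k[3]}) (P : ppoint k) (x y : ratfrac k).

Definition ideal2 u v f := exists a b, f = a * u + b * v.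

(** Replace the coefficients by their components of complementary degree.  The
last clause records that there is no form of negative degree, which truncated
subtraction hides. *)
Lemma ideal2_homog_strong t u f dt du D : t \is dt.-homog -> u \is du.-homog ->
  f \is D.-homog -> ideal2 t u f ->
  exists a b, [/\ f = a * t + b * u, a \is (D - dt).-homog, b \is (D - du).-homog
                & (D < dt)%N -> a = 0].
Proof.
move=> ht hu hf [a [b fE]].
have proj (c w : {mpoly k[3]}) d : w \is d.-homog -> exists c',
    [/\ pihomog [measure of mdeg] D (c * w) = c' * w, c' \is (D - d).-homog
      & (D < d)%N -> c' = 0].
  move=> hw; case: (leqP d D) => [le_dD|lt_Dd].
    exists (pihomog [measure of mdeg] (D - d) c); split=> //; last exact: pihomogP.
    by rewrite mulrC -{1}(subnKC le_dD) pihomogM // mulrC.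
  by exists 0; split=> //; [rewrite mulrC (pihomogM_lt _ hw) // mul0r | apply: dhomog0].
have [a' [aE ha' a0]] := proj a t dt ht; have [b' [bE hb' _]] := proj b u du hu.
exists a', b'; split=> //; rewrite -aE -bE -raddfD /= -fE.
by rewrite pihomog_dE.
Qed.

Lemma ideal2_homog t u f dt du D : t \is dt.-homog -> u \is du.-homog ->
  f \is D.-homog -> ideal2 t u f ->
  exists a b, [/\ f = a * t + b * u, a \is (D - dt).-homog & b \is (D - du).-homog].
Proof.
move=> ht hu hf /(ideal2_homog_strong ht hu hf) [a [b [fE ha hb _]]].
by exists a, b.
Qed.

(** Substituting [P i * r] for ['X_i] turns [f] into [f(P) r^D], and changes
nothing modulo [t] and [u]. *)
Lemma vanishing_ideal2 P r t u f D : 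
  (forall i, ideal2 t u ('X_i - (P i)%:MP * r)) ->
  f \is D.-homog -> f.@[P] = 0 -> ideal2 t u f.
Proof.
move=> hX hf fP.
have := @subst_diff k (ideal2 t u) (fun i => (P i)%:MP * r) _ _ _ hX f.
rewrite (subst_ray _ _ hf) fP mpolyC0 mul0r subr0; apply.
- by exists 0, 0; rewrite !mul0r addr0.
- by move=> x y [a [b ->]] [a' [b' ->]]; exists (a + a'), (b + b'); ring.
- by move=> c x [a [b ->]]; exists (c * a), (c * b); ring.
Qed.

(** What makes the curve [g] smooth at [P] with uniformizer [t / r].  In
[lc_cut] the forms [t] and [u] generate the ideal of [P] and [g2] is the
derivative of [g] with respect to [u], so that [u] can be eliminated on the
curve.  The predicate [I] stands for the ideal of the branch at [P]: it is
either the set of multiples of [g] or the kernel of a parametrization, and it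
witnesses that no power of [t] vanishes on the curve. *)
Record local_chart g d P t r (I : {mpoly k[3]} -> Prop) : Prop := LocalChart {
  lc_g : g \is d.-homog;
  lc_t : t \is 1.-homog;
  lc_r : r \is 1.-homog;
  lc_rP : r.@[P] != 0;
  lc_tP : t.@[P] = 0;
  lc_gP : g.@[P] = 0;
  lc_cut : exists u g1 g2 e,
    [/\ forall D f, f \is D.-homog -> f.@[P] = 0 -> ideal2 t u f,
        g = g1 * t + g2 * u, g2 \is e.-homog & g2.@[P] != 0];
  lc_Ig : forall c, I (c * g);
  lc_cancel : forall a, I (t * a) -> I a;
  lc_IP : forall a, I a -> a.@[P] = 0 }.

(** In the local ring of the curve [g] at [P], [f] is [t^n] up to the units [s]
and [s']. *)
Definition ord_at g P t f n := exists s s' b e e',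
  [/\ s \is e.-homog /\ s.@[P] != 0, s' \is e'.-homog /\ s'.@[P] != 0
    & s * f = s' * t ^+ n + b * g].

Lemma eval_neq0 P f : f.@[P] != 0 -> f != 0.
Proof. by apply: contraNneq => ->; rewrite meval0. Qed.

Lemma frac_neq0 f : f != 0 -> frac f != 0.
Proof. by rewrite tofrac_eq0. Qed.

Lemma fracD a b c d : b != 0 -> d != 0 ->
  frac a / frac b + frac c / frac d = frac (a * d + c * b) / frac (b * d) :> ratfrac k.
Proof. by move=> b0 d0; rewrite tofracD !tofracM fdivD // frac_neq0. Qed.

Lemma fracM a b c d :
  frac a / frac b * (frac c / frac d) = frac (a * c) / frac (b * d) :> ratfrac k.
Proof. by rewrite !tofracM mulf_div. Qed.

Lemma fracZ s a b : s != 0 -> frac (s * a) / frac (s * b) = frac a / frac b :> ratfrac k.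
Proof. by move=> s0; rewrite !tofracM fdivZ // frac_neq0. Qed.

Lemma local_ring_cst P c : local_ring P (cst c).
Proof.
exists c%:MP, 1; split; last by rewrite meval1 oner_neq0.
split; [exists 0%N; [exact: homog_const | exact: dhomog1] | exact: oner_neq0 |].
by rewrite tofrac1 divr1.
Qed.

Lemma local_ringM P x y : local_ring P x -> local_ring P y -> local_ring P (x * y).
Proof.
move=> [a [b [[[d ha hb] b0 ->] bP]]] [a' [b' [[[d' ha' hb'] b0' ->] bP']]].
exists (a * a'), (b * b'); split; last by rewrite mevalM mulf_neq0.
split; [exists (d + d')%N; exact: dhomogM | exact: mulf_neq0 |].
exact: fracM.
Qed.

Lemma local_idealD f g P x y : local_ideal f g P x -> local_ideal f g P y ->
  local_ideal f g P (x + y).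
Proof.
move=> [u [v [b [[[d ha hb] b0 ->] bP]]]] [u' [v' [b' [[[d' ha' hb'] b0' ->] bP']]]].
exists (u * b' + u' * b), (v * b' + v' * b), (b * b').
split; last by rewrite mevalM mulf_neq0.
have -> : (u * b' + u' * b) * f + (v * b' + v' * b) * g =
  (u * f + v * g) * b' + (u' * f + v' * g) * b by ring.
split; [exists (d + d')%N | exact: mulf_neq0 |].
- by apply: rpredD; [|rewrite addnC]; apply: dhomogM.
- exact: dhomogM.
- exact: fracD.
Qed.

Lemma local_idealM f g P x y : local_ring P x -> local_ideal f g P y ->
  local_ideal f g P (x * y).
Proof.
move=> [a [b' [[[d' ha hb'] b0' ->] bP']]] [u [v [b [[[d hu hb] b0 ->] bP]]]].
exists (a * u), (a * v), (b' * b).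
split; last by rewrite mevalM mulf_neq0.
have -> : a * u * f + a * v * g = a * (u * f + v * g) by ring.
split; [exists (d' + d)%N; exact: dhomogM | exact: mulf_neq0 |].
exact: fracM.
Qed.

Lemma local_ideal0 f g P : local_ideal f g P 0.
Proof.
exists 0, 0, 1; split; last by rewrite meval1 oner_neq0.
rewrite !mul0r addr0; split; [exists 0%N; [exact: dhomog0|exact: dhomog1]|exact: oner_neq0|].
by rewrite tofrac0 mul0r.
Qed.

Lemma local_ideal_sub f g f' g' s e P x : s \is e.-homog -> s.@[P] != 0 ->
  ideal2 f' g' (s * f) -> ideal2 f' g' (s * g) ->
  local_ideal f g P x -> local_ideal f' g' P x.
Proof.
move=> hs sP [a [b fE]] [c [d gE]] [u [v [w [[[n hu hw] w0 ->] wP]]]].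
exists (u * a + v * c), (u * b + v * d), (s * w).
split; last by rewrite mevalM mulf_neq0.
have -> : (u * a + v * c) * f' + (u * b + v * d) * g' = s * (u * f + v * g).
  transitivity (u * (a * f' + b * g') + v * (c * f' + d * g')); first by ring.
  by rewrite -fE -gE; ring.
have s0 := eval_neq0 sP.
split; [exists (e + n)%N; exact: dhomogM | exact: mulf_neq0 |].
by rewrite fracZ.
Qed.

Lemma local_ideal_sub1 f g f' g' P x :
  ideal2 f' g' f -> ideal2 f' g' g -> local_ideal f g P x -> local_ideal f' g' P x.
Proof.
move=> hf hg; apply: (@local_ideal_sub f g f' g' 1 0 P x).
- exact: dhomog1.
- by rewrite meval1 oner_neq0.
- by rewrite mul1r.
- by rewrite mul1r.
Qed.

Lemma local_idealC f g P x : local_ideal f g P x -> local_ideal g f P x.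
Proof.
apply: local_ideal_sub1.
- by exists 0, 1; ring.
- by exists 1, 0; ring.
Qed.

Lemma quotient_dim_ext (V W W' : ratfrac k -> Prop) n :
  (forall x, W x <-> W' x) -> quotient_dim V W n -> quotient_dim V W' n.
Proof.
move=> WW' [e [Ve he]]; exists e; split=> // x /he [c [Wc cU]].
exists c; split; first exact/WW'.
by move=> c' /WW'; apply: cU.
Qed.

Lemma intersection_multC f g P n : intersection_mult f g P n -> intersection_mult g f P n.
Proof. by apply: quotient_dim_ext => x; split; apply: local_idealC. Qed.

Section Chart.
Variables (g : {mpoly k[3]}) (d : nat) (P : ppoint k) (t r : {mpoly k[3]}).
Variable I : {mpoly k[3]} -> Prop.
Hypothesis lc : local_chart g d P t r I.

Let ht := lc_t lc.
Let hr := lc_r lc.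
Let r0 := eval_neq0 (lc_rP lc).

(** [f = f1 * t + f2 * u] for any form vanishing at [P], and [g] expresses [u] by
[t] up to the unit [g2]. *)
Lemma chart_div D f : f \is D.-homog -> f.@[P] = 0 ->
  exists e s a b, [/\ s \is e.+1.-homog, s.@[P] != 0, a \is (e + D).-homog
                    & s * f = a * t + b * g].
Proof.
move=> hf fP; have [u [g1 [g2 [e [cut gE hg2 g2P]]]]] := lc_cut lc.
have [f1 [f2 fE]] := cut _ _ hf fP.
have hs : g2 * r \is e.+1.-homog by have := dhomogM hg2 (lc_r lc); rewrite addn1.
have : ideal2 t g (g2 * r * f).
  by exists (r * (g2 * f1 - f2 * g1)), (r * f2); rewrite fE gE; ring.
move=> /(ideal2_homog ht (lc_g lc) (dhomogM hs hf)) [a [b [sE ha _]]].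
exists e, (g2 * r), a, b; split=> //; first by rewrite mevalM mulf_neq0 // (lc_rP lc).
by move: ha; rewrite addSn subn1.
Qed.

(** Divide by [t] as long as the quotient vanishes at [P]. *)
Lemma ord_at_dichotomy D f N : f \is D.-homog ->
  (exists2 n, (n < N)%N & ord_at g P t f n) \/
  (exists s a b e e', [/\ s \is e.-homog /\ s.@[P] != 0, a \is e'.-homog
      & s * f = a * t ^+ N + b * g]).
Proof.
move=> hf; elim: N => [|N [[n lt_nN on]|[s [a [b [e [e' [[hs sP] ha sE]]]]]]]].
- right; exists 1, f, 0, 0%N, D; rewrite meval1 oner_neq0 expr0; split=> //.
    by split=> //; apply: dhomog1.
  by ring.
- by left; exists n => //; apply: ltnW.
- have [aP|aP] := eqVneq a.@[P] 0; last first.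
    by left; exists N => //; exists s, a, b, e, e'.
  right; have [e1 [s1 [a1 [b1 [hs1 s1P ha1 s1E]]]]] := chart_div ha aP.
  exists (s1 * s), a1, (b1 * t ^+ N + s1 * b), (e1.+1 + e)%N, (e1 + e')%N; split=> //.
    by split; [exact: dhomogM | rewrite mevalM mulf_neq0].
  rewrite -mulrA sE exprSr (_ : s1 * _ = (s1 * a) * t ^+ N + s1 * b * g); last by ring.
  by rewrite s1E; ring.
Qed.

Let tau : ratfrac k := frac t / frac r.

Lemma tau_local : local_ring P tau.
Proof.
exists t, r; split; last exact: lc_rP lc.
by split=> //; exists 1%N.
Qed.

Lemma local_ring_step x : local_ring P x ->
  exists c y, local_ring P y /\ local_ideal 0 g P (x - cst c - y * tau).
Proof.
move=> [a [b [[[n ha hb] b0 ->] bP]]].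
pose c := a.@[P] / b.@[P].
have hf : a - c%:MP * b \is n.-homog.
  by apply: rpredB => //; rewrite mul_mpolyC; apply: rpredZ.
have [|e [s [al [be [hs sP hal sE]]]]] := chart_div hf.
  by rewrite mevalB mevalM mevalC divfK // subrr.
have s0 := eval_neq0 sP.
exists c, (frac (al * r) / frac (s * b)); split.
  exists (al * r), (s * b); split; last by rewrite mevalM mulf_neq0.
  split=> //; last exact: mulf_neq0.
  exists (e.+1 + n)%N; last exact: dhomogM.
  by have := dhomogM hal hr; rewrite addn1.
exists 0, be, (s * b); split; last by rewrite mevalM mulf_neq0.
have E : 0 * 0 + be * g = s * (a - c%:MP * b) - al * t by rewrite sE; ring.
rewrite E; split; last 2 [exact: mulf_neq0].
- exists (e.+1 + n)%N; last exact: dhomogM.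
  apply: rpredB; first exact: dhomogM.
  by have := dhomogM hal ht; rewrite addn1.
- rewrite tofracB 4!tofracM tofracB tofracM.
  by apply: fdiv_step; apply: frac_neq0.
Qed.

(** Taylor expansion along the curve: subtract the value at [P], divide by the
uniformizer, and repeat. *)
Lemma local_expansion n x : local_ring P x ->
  exists c : nat -> k,
    local_ideal (t ^+ n) g P (x - \sum_(i < n) cst (c i) * tau ^+ i).
Proof.
elim: n x => [|n IH] x Ox.
  exists (fun=> 0); rewrite big_ord0 subr0; case: Ox => a [b [[[n ha hb] b0 ->] bP]].
  exists a, 0, b; split=> //.
  have -> : a * t ^+ 0 + 0 * g = a by rewrite expr0; ring.
  by split=> //; exists n.
have [c [y [/IH [c' hc'] hy]]] := local_ring_step Ox.
exists (fun i => if i is j.+1 then c' j else c).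
rewrite big_ord_recl /= expr0 mulr1.
have -> : x - (cst c + \sum_(i < n) cst (c' i) * tau ^+ i.+1) =
    (x - cst c - y * tau) + tau * (y - \sum_(i < n) cst (c' i) * tau ^+ i).
  rewrite mulrBr mulr_sumr [y * tau]mulrC -!addrA; congr (x + _).
  rewrite opprD; congr (- cst c + _); rewrite addKr; congr (- _).
  by apply: eq_bigr => i _; rewrite exprS mulrCA.
apply: local_idealD.
  apply: local_ideal_sub1 hy.
  - by exists 0, 0; ring.
  - by exists 0, 1; ring.
case: hc' => u [v [b [[[m hu hb] b0 ->] bP]]].
exists u, (v * t), (r * b); split; last by rewrite mevalM mulf_neq0 // (lc_rP lc).
have -> : u * t ^+ n.+1 + v * t * g = t * (u * t ^+ n + v * g) by rewrite exprS; ring.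
split; last 2 [exact: mulf_neq0].
- by exists (1 + m)%N; apply: dhomogM.
- exact: fracM.
Qed.

(** Clear the denominators and cancel the lowest power of [t], which is possible
modulo [I].  The remaining identity, evaluated at [P], says that the lowest
coefficient is 0. *)
Lemma local_independence n (c : nat -> k) :
  local_ideal (t ^+ n) g P (\sum_(i < n) cst (c i) * tau ^+ i) ->
  forall i, (i < n)%N -> c i = 0.
Proof.
move=> [u [v [b [[_ b0 xE] bP]]]].
(* the sum with denominators cleared by r^n *)
pose N := \sum_(i < n) (c i)%:MP * t ^+ i * r ^+ (n - i).
have NE : N * b = r ^+ n * (u * t ^+ n + v * g).
  apply/eqP; rewrite -tofrac_eq !tofracM; apply/eqP.
  have -> : frac (u * t ^+ n + v * g) = (\sum_(i < n) cst (c i) * tau ^+ i) * frac b.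
    by rewrite xE divfK // frac_neq0.
  rewrite mulrA; congr (_ * _); rewrite mulr_sumr [LHS]raddf_sum /=.
  apply: eq_bigr => i _; rewrite !tofracM !tofracXn /tau exprMn exprVn.
  have rE : frac r ^+ n = frac r ^+ i * frac r ^+ (n - i).
    by rewrite -exprD subnKC // ltnW.
  rewrite /cst rE [RHS]mulrC -!mulrA; congr (_ * (_ * _)).
  by rewrite mulKf // expf_neq0 // frac_neq0.
move=> i lt_in; apply/eqP; apply: contraT => ci.
have ex : exists i, (i < n)%N && (c i != 0) by exists i; rewrite lt_in.
case: (ex_minnP ex) => m /andP[lt_mn cm] mmin {i lt_in ci ex}.
pose N' := \sum_(i < n | (m < i)%N) (c i)%:MP * t ^+ (i - m.+1) * r ^+ (n - i).
have NE' : N = t ^+ m * ((c m)%:MP * r ^+ (n - m) + t * N').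
  rewrite /N (bigD1 (Ordinal lt_mn)) //= mulrDr; congr (_ + _); first by ring.
  rewrite mulrA -exprSr mulr_sumr [RHS]big_mkcond [LHS]big_mkcond /=.
  apply: eq_bigr => i _; case: (ltngtP m i) => [lt_mi|lt_im|im].
  - rewrite ifT; last by rewrite -val_eqE /= neq_ltn lt_mi orbT.
    have -> : t ^+ i = t ^+ m.+1 * t ^+ (i - m.+1) by rewrite -exprD subnKC.
    by ring.
  - have -> : c i = 0.
      apply/eqP; apply: contraT => ci; have := mmin i.
      by rewrite ltn_ord ci leqNgt lt_im => /(_ isT).
    by rewrite mpolyC0 !mul0r if_same.
  - by rewrite ifF //; apply/negbTE; rewrite negbK; apply/eqP/val_inj.
have Ipow j (y : {mpoly k[3]}) : I (t ^+ j * y) -> I y.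
  elim: j y => [|j IH] y; first by rewrite expr0 mul1r.
  by rewrite exprS -mulrA => /(lc_cancel lc) /IH.
pose w : {mpoly k[3]} := b * ((c m)%:MP * r ^+ (n - m) + t * N') - r ^+ n * u * t ^+ (n - m).
have : I (t ^+ m * w).
  have -> : t ^+ m * w = (r ^+ n * v) * g; last exact: lc_Ig lc _.
  have tE : t ^+ n = t ^+ m * t ^+ (n - m) by rewrite -exprD subnKC // ltnW.
  rewrite /w mulrBr mulrCA -NE' mulrC NE tE.
  by ring.
move=> /Ipow /(lc_IP lc) /eqP.
rewrite /w mevalB !mevalM mevalD !mevalM mevalC !rmorphXn /= (lc_tP lc).
rewrite -[(n - m)%N]prednK ?subn_gt0 // !exprS !mul0r mulr0 addr0 subr0.
by rewrite -exprS !mulf_eq0 expf_eq0 (negbTE bP) (negbTE cm) (negbTE (lc_rP lc)) andbF.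
Qed.

(** The powers [tau^i], [i < n], of the uniformizer form a basis: they span by
[local_expansion] and are independent by [local_independence]. *)
Lemma quotient_dim_chart n :
  quotient_dim (local_ring P) (local_ideal (t ^+ n) g P) n.
Proof.
exists (fun i => tau ^+ i); split.
  move=> i; elim: (val i) => [|j IH]; last by rewrite exprS; apply: local_ringM tau_local IH.
  by rewrite expr0 -tofrac1; have := local_ring_cst P 1; rewrite /cst mpolyC1.
move=> x Ox; have [c hc] := local_expansion n Ox.
exists [ffun i : 'I_n => c i]; split.
  by congr (local_ideal _ _ _ (_ - _)): hc; apply: eq_bigr => i _; rewrite ffunE.
move=> c' hc'; apply/ffunP => i; rewrite ffunE.
pose c1 j := c j - (if insub j is Some l then c' l else 0).
suff /(_ i (ltn_ord i)) /eqP : forall j, (j < n)%N -> c1 j = 0.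
  by rewrite /c1 valK subr_eq0 => /eqP.
apply: local_independence.
have := local_idealD hc' (local_idealM (local_ring_cst P (-1)) hc).
congr (local_ideal _ _ _ _).
rewrite /cst mpolyCN mpolyC1 tofracN tofrac1 mulN1r opprB addrC addrA subrK.
rewrite -sumrB; apply: eq_bigr => j _.
by rewrite /c1 valK mpolyCB tofracB mulrBl.
Qed.

End Chart.
End Local.

(** * Intersection multiplicities as orders of vanishing *)

Section Mult.
Variable k : fieldType.
Implicit Types (f g h : {mpoly k[3]}) (P : ppoint k) (x y : ratfrac k).

HB.instance Definition _ := GRing.RMorphism.copy (@cst k)
  (@FracField.tofrac {mpoly k[3]} \o @mpolyC 3 k).

(** A basis of [V / W] still spans [V / W'], and [n'] independent vectors do not
fit into the span of fewer than [n'].  The matrix [M] expresses the second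
family in terms of the first one; a vector in its kernel is a dependence. *)
Lemma quotient_dim_le (V W W' : ratfrac k -> Prop) n n' :
  V 0 -> W' 0 -> (forall x y, W' x -> W' y -> W' (x + y)) ->
  (forall c x, W' x -> W' (cst c * x)) -> (forall x, W x -> W' x) ->
  quotient_dim V W n -> quotient_dim V W' n' -> (n' <= n)%N.
Proof.
move=> V0 W0 WD WZ WW' [e [_ he]] [e' [Ve' he']].
have /fin_all_exists [C CP] : forall j : 'I_n', exists c : {ffun 'I_n -> k},
    W' (e' j - \sum_(i < n) cst (c i) * e i).
  by move=> j; have [c [/WW' ? _]] := he _ (Ve' j); exists c.
pose M := \matrix_(j < n', i < n) C j i.
rewrite leqNgt; apply/negP => lt_nn'.
have : kermx M != 0.
  rewrite kermx_eq0; apply/negP => /eqP rM; have := rank_leq_col M.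
  by rewrite rM leqNgt lt_nn'.
case/rowV0Pn => v /sub_kermxP vM /negP; apply; apply/eqP/rowP => j0; rewrite mxE.
have sumE : \sum_(j < n') cst (v 0 j) * e' j =
    \sum_(j < n') cst (v 0 j) * (e' j - \sum_(i < n) cst (C j i) * e i).
  apply/esym; under eq_bigr => j _ do rewrite mulrBr.
  rewrite sumrB [X in _ - X](_ : _ = 0) ?subr0 //.
  under eq_bigr => j _ do rewrite mulr_sumr.
  rewrite exchange_big big1 //= => i _.
  have /matrixP/(_ 0 i) := vM; rewrite !mxE => vMi.
  transitivity (cst (\sum_j v 0 j * M j i) * e i); last by rewrite vMi rmorph0 mul0r.
  rewrite rmorph_sum mulr_suml.
  by apply: eq_bigr => j _; rewrite mxE mulrA rmorphM.
have sW : W' (\sum_(j < n') cst (v 0 j) * e' j).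
  by rewrite sumE; apply: (big_ind W') => // j _; apply: (WZ).
have [c [_ cU]] := he' 0 V0.
have c0 : c = [ffun=> 0].
  apply: cU; rewrite big1 ?subr0 // => j _.
  by rewrite ffunE rmorph0 mul0r.
have cv : c = [ffun j => - v 0 j].
  apply: cU; congr W': sW; rewrite sub0r -sumrN; apply: eq_bigr => j _.
  by rewrite ffunE rmorphN mulNr opprK.
have := congr1 (fun c : {ffun 'I_n' -> k} => c j0) (etrans (esym c0) cv).
by rewrite !ffunE => /esym/eqP; rewrite oppr_eq0 => /eqP.
Qed.

Lemma local_ring0 P : local_ring P 0.
Proof. by rewrite -(rmorph0 (@cst k)); apply: local_ring_cst. Qed.

Lemma local_dim_le f g f' g' P n n' :
  (forall x, local_ideal f g P x -> local_ideal f' g' P x) ->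
  intersection_mult f g P n -> intersection_mult f' g' P n' -> (n' <= n)%N.
Proof.
apply: quotient_dim_le => [||x y|c x].
- exact: local_ring0.
- exact: local_ideal0.
- exact: local_idealD.
- by apply: local_idealM; apply: local_ring_cst.
Qed.

Lemma ord_at_ideal g P t f n x :
  ord_at g P t f n -> local_ideal f g P x <-> local_ideal (t ^+ n) g P x.
Proof.
move=> [s [s' [b [e [e' [[hs sP] [hs' s'P] sE]]]]]]; split.
  apply: (local_ideal_sub hs sP); first by exists s', b.
  by exists 0, s; ring.
apply: (local_ideal_sub hs' s'P); last by exists 0, s'; ring.
by exists s, (- b); rewrite sE; ring.
Qed.

(** Units do not change ideals: [(f, g) = (t^n, g)] locally. *)
Lemma intersection_mult_ord g d P t r I f n : local_chart g d P t r I ->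
  ord_at g P t f n -> intersection_mult f g P n.
Proof.
move=> lc on; apply: quotient_dim_ext (quotient_dim_chart lc n) => x.
by split=> /(ord_at_ideal x on).
Qed.

(** If [f] were divisible by [t^(n+1)] the dimension would exceed [n]; otherwise
[f] has an order, and this order is the dimension. *)
Lemma ord_intersection_mult g d P t r I f D n : local_chart g d P t r I ->
  f \is D.-homog -> intersection_mult f g P n -> ord_at g P t f n.
Proof.
move=> lc hf fn; have [[m _ om]|] := ord_at_dichotomy lc n.+1 hf.
  have fm := intersection_mult_ord lc om.
  suff -> : n = m by [].
  by apply/eqP; rewrite eqn_leq (local_dim_le _ fm fn) // (local_dim_le _ fn fm).
case=> s [a [b [e [e' [[hs sP] _ sE]]]]].
suff : (n.+1 <= n)%N by rewrite ltnn.
apply: local_dim_le fn (quotient_dim_chart lc n.+1) => x.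
by apply: (local_ideal_sub hs sP); [exists a, b | exists 0, s; ring].
Qed.

Lemma local_ring_scale (P P' : ppoint k) c x : c != 0 -> (forall i, P' i = c * P i) ->
  local_ring P x -> local_ring P' x.
Proof.
move=> c0 PP' [a [b [[[n ha hb] b0 xE] bP]]]; exists a, b; split.
  by split=> //; exists n.
by rewrite (meval_homogZ hb PP') mulf_neq0 // expf_neq0.
Qed.

Lemma local_ideal_scale f g (P P' : ppoint k) c x : c != 0 -> (forall i, P' i = c * P i) ->
  local_ideal f g P x -> local_ideal f g P' x.
Proof.
move=> c0 PP' [u [v [b [[[n ha hb] b0 xE] bP]]]]; exists u, v, b; split.
  by split=> //; exists n.
by rewrite (meval_homogZ hb PP') mulf_neq0 // expf_neq0.
Qed.

Lemma intersection_mult_scale f g (P P' : ppoint k) c n : c != 0 ->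
  (forall i, P' i = c * P i) -> intersection_mult f g P n -> intersection_mult f g P' n.
Proof.
move=> c0 PP' [e [Ve he]].
have PP : forall i, P i = c^-1 * P' i by move=> i; rewrite PP' mulKf.
exists e; split=> [i|x /(local_ring_scale (invr_neq0 c0) PP) /he [a [Wa aU]]].
  exact: local_ring_scale c0 PP' (Ve i).
exists a; split; first exact: local_ideal_scale c0 PP' Wa.
by move=> b /(local_ideal_scale (invr_neq0 c0) PP); apply: aU.
Qed.

Lemma intersection_mult_unit f g P h e n : h \is e.-homog -> h.@[P] != 0 ->
  intersection_mult f g P n -> intersection_mult (f * h) g P n.
Proof.
move=> hh hP; apply: quotient_dim_ext => x; split.
  apply: (local_ideal_sub hh hP); first by exists 1, 0; ring.
  by exists 0, h; ring.
apply: local_ideal_sub1.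
- by exists h, 0; ring.
- by exists 0, 1; ring.
Qed.

Lemma intersection_mult0 f g P e : f \is e.-homog -> f.@[P] != 0 -> intersection_mult f g P 0.
Proof.
move=> hf fP; exists (fun=> 0); split=> [[]//|x Ox].
exists [ffun=> 0]; split; last by move=> c _; apply/ffunP => -[j ltj]; have := ltj; rewrite ltn0.
rewrite big_ord0 subr0; case: Ox => a [b [[[n ha hb] b0 ->] bP]].
exists a, 0, (f * b); split; last by rewrite mevalM mulf_neq0.
have f0 := eval_neq0 fP; rewrite mul0r addr0 (mulrC a).
split; [by exists (e + n)%N; exact: dhomogM | exact: mulf_neq0 |].
by rewrite fracZ.
Qed.

End Mult.

(** * Parametrized lines and conics *)

Section RationalCurves.
Variable k : fieldType.
Implicit Types (f g h : {mpoly k[3]}) (P : ppoint k).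

Lemma homog1_lin f : f \is 1.-homog -> exists c : 'I_3 -> k, f = \sum_i (c i)%:MP * 'X_i.
Proof.
move=> /dhomogP hf; exists (fun i => f@_U_(i)); apply/mpolyP => m.
rewrite raddf_sum /=; under eq_bigr => i _ do rewrite mcoeffCM mcoeffX.
have [m1|m1] := eqVneq (mdeg m) 1%N.
  have /mdeg1P [i /eqP ->] : mdeg m == 1%N by apply/eqP.
  rewrite (bigD1 i) //= eqxx mulr1 big1 ?addr0 // => j ji.
  by rewrite eq_mnm1 (negbTE ji) mulr0.
rewrite memN_msupp_eq0; last by apply: contra m1 => mm; apply/eqP; exact: hf.
rewrite big1 // => i _; case: eqP => [im|_]; last by rewrite mulr0.
by move: m1; rewrite -im mdeg1 eqxx.
Qed.

Definition quad_arc (A B C : 'I_3 -> k) (i : 'I_3) : {poly k} :=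
  (A i)%:P + (B i)%:P * 'X + (C i)%:P * 'X^2.

Lemma pull_quad_arc A B C f : f \is 1.-homog ->
  pull (quad_arc A B C) f = (f.@[A])%:P + (f.@[B])%:P * 'X + (f.@[C])%:P * 'X^2.
Proof.
move=> /homog1_lin [c ->].
have evE (X : 'I_3 -> k) : (\sum_i (c i)%:MP * 'X_i).@[X] = \sum_i c i * X i.
  by rewrite raddf_sum; apply: eq_bigr => i _; rewrite /= mevalM mevalC mevalXU.
rewrite !evE !rmorph_sum /= !mulr_suml -!big_split /=.
apply: eq_bigr => i _; rewrite rmorphM /= pullC pullX /quad_arc.
by rewrite !polyCM; ring.
Qed.

Lemma XsubC_pow_eq (x : k) m n (a b : {poly k}) : a.[x] != 0 -> b.[x] != 0 ->
  ('X - x%:P) ^+ m * a = ('X - x%:P) ^+ n * b -> m = n.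
Proof.
wlog le_mn : m n a b / (m <= n)%N.
  move=> h ax bx E; case: (leqP m n) => [le_mn|/ltnW le_nm]; first exact: h ax bx E.
  exact/esym/(h _ _ _ _ le_nm bx ax (esym E)).
move=> ax bx; rewrite -{1}(subnKC le_mn) exprD -mulrA.
have /mulfI h : ('X - x%:P) ^+ m != 0 by rewrite expf_neq0 // polyXsubC_eq0.
move/h => aE; apply/eqP; rewrite eqn_leq le_mn -subn_eq0.
case: (n - m)%N aE => // l aE; move: ax; rewrite aE hornerM.
by rewrite horner_exp hornerXsubC subrr exprS mul0r mul0r eqxx.
Qed.

Definition arc_point (phi : 'I_3 -> {poly k}) x : ppoint k := [ffun i => (phi i).[x]].

Lemma pull_eval phi f x : (pull phi f).[x] = f.@[arc_point phi x].
Proof. by rewrite pull_horner; apply: meval_eq => i; rewrite ffunE. Qed.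

(** At the parameter [x] the arc is unramified: the uniformizer [t] of the
chart pulls back to a polynomial with a simple zero at [x]. *)
Definition arc_chart g d phi x := exists t r w,
  [/\ local_chart g d (arc_point phi x) t r (fun f => pull phi f = 0),
      pull phi t = ('X - x%:P) * w & w.[x] != 0].

(** The pull-back kills [g], sends [t] to a simple zero at [x] and local units to
polynomials that do not vanish at [x].  So it identifies the order along [g]
with the order in the parameter. *)
Lemma arc_mult g d phi x f e n rho : arc_chart g d phi x -> f \is e.-homog ->
  pull phi f = ('X - x%:P) ^+ n * rho -> rho.[x] != 0 ->
  intersection_mult f g (arc_point phi x) n.
Proof.
move=> [t [r [w [lc tE wx]]]] hf fE rx; apply: (intersection_mult_ord lc).
have g0 : pull phi g = 0 by have := lc_Ig lc 1; rewrite mul1r.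
have [[m _ om]|] := ord_at_dichotomy lc n.+1 hf.
  suff -> : n = m by [].
  case: om => s [s' [b [e1 [e2 [[_ sP] [_ s'P] /(congr1 (pull phi))]]]]].
  rewrite rmorphD !rmorphM rmorphXn /= g0 mulr0 addr0 tE fE exprMn.
  rewrite mulrCA (mulrCA (pull phi s')); apply: XsubC_pow_eq.
    by rewrite hornerM pull_eval mulf_neq0.
  by rewrite hornerM pull_eval horner_exp mulf_neq0 // expf_neq0.
case=> s [a [b [e1 [e2 [[_ sP] _ /(congr1 (pull phi))]]]]].
rewrite rmorphD !rmorphM rmorphXn /= g0 mulr0 addr0 tE fE exprMn.
rewrite mulrCA (mulrCA (pull phi a)) exprSr -mulrA.
have /mulfI h : ('X - x%:P) ^+ n != 0 by rewrite expf_neq0 // polyXsubC_eq0.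
move/h/(congr1 (fun p => p.[x])); rewrite !hornerM hornerXsubC subrr mul0r => /eqP.
by rewrite mulf_eq0 (negbTE rx) orbF pull_eval (negbTE sP).
Qed.

(** The point [v] has the parameter at infinity. *)
Record rational_curve g d phi (v : ppoint k) : Prop := RationalCurve {
  rc_homog : g \is d.-homog;
  rc_chart : forall x, arc_chart g d phi x;
  rc_points : forall P, on_curve g P ->
    (exists x c, c != 0 /\ forall i, P i = c * arc_point phi x i) \/
    (exists c, c != 0 /\ forall i, P i = c * v i) }.

(** As [f] does not vanish at [v], the point [P] has a finite parameter, whose
multiplicity as a root of [sigma ^+ 2] is even. *)
Lemma rc_square_mult g d phi v f e c sigma P : rational_curve g d phi v ->
  f \is e.-homog -> f.@[v] != 0 -> c != 0 -> sigma != 0 ->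
  pull phi f = c *: sigma ^+ 2 -> on_curve g P -> f.@[P] = 0 ->
  exists x m rho a, [/\ a != 0, forall i, P i = a * arc_point phi x i,
     sigma = ('X - x%:P) ^+ m * rho, rho.[x] != 0
     & intersection_mult f g P (m * 2)].
Proof.
move=> rc hf fv c0 s0 fE gP fP.
have [[x [a [a0 Px]]]|[a [a0 Pv]]] := rc_points rc gP; last first.
  move: fP; rewrite (meval_homogZ hf Pv) => /eqP.
  by rewrite mulf_eq0 (negbTE fv) expf_eq0 (negbTE a0) andbF.
have [m [rho rx sE]] := multiplicity_XsubC sigma x.
move: rx; rewrite s0 /= => rx.
exists x, m, rho, a; split=> //; first by rewrite mulrC.
apply: (intersection_mult_scale a0 Px); apply: (arc_mult (rho := c *: rho ^+ 2)) hf _ _.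
- exact: rc_chart rc x.
- by rewrite fE sE exprMn -exprM -scalerAr mulrC.
- by rewrite hornerZ horner_exp mulf_neq0 // expf_neq0.
Qed.

Lemma rc_even g d phi v f e c sigma : rational_curve g d phi v ->
  f \is e.-homog -> f.@[v] != 0 -> c != 0 -> sigma != 0 ->
  pull phi f = c *: sigma ^+ 2 -> even_intersections f g.
Proof.
move=> rc hf fv c0 s0 fE P [_ fP] gP.
have [x [m [rho [a [_ _ _ _ fgm]]]]] := rc_square_mult rc hf fv c0 s0 fE gP fP.
by exists (m * 2)%N => //; rewrite oddM andbF.
Qed.

Lemma even_intersectionsC f g : even_intersections f g -> even_intersections g f.
Proof.
move=> h P gP fP; have [n /intersection_multC nm on] := h P fP gP.
by exists n.
Qed.

(** A basis [N] of [k^3] together with the dual basis of linear forms [M]: the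
coordinates in which a line or a conic has its standard equation. *)
Record frame (N : 'I_3 -> ppoint k) (M : 'I_3 -> {mpoly k[3]}) : Prop := Frame {
  fr_homog : forall j, M j \is 1.-homog;
  fr_var : forall i, 'X_i = \sum_j (N j i)%:MP * M j;
  fr_dual : forall i j, (M i).@[N j] = (i == j)%:R }.

Section Frame.
Variables (N : 'I_3 -> ppoint k) (M : 'I_3 -> {mpoly k[3]}).
Hypothesis fr : frame N M.

Lemma sum_I3 (V : nmodType) (F : 'I_3 -> V) : \sum_i F i = F 0 + F 1 + F 2.
Proof.
rewrite !big_ord_recl big_ord0 addr0 addrA.
by congr (F _ + F _ + F _); apply: val_inj.
Qed.

Lemma frame_eval i P : P i = N 0 i * (M 0).@[P] + N 1 i * (M 1).@[P] + N 2 i * (M 2).@[P].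
Proof.
have := congr1 (meval P) (fr_var fr i).
by rewrite sum_I3 mevalXU !mevalD !mevalM !mevalC.
Qed.

(** The form [M 1 - x * M 0] is a uniformizer at the parameter [x], as it pulls
back to ['X - x%:P]. *)
Lemma line_rational : rational_curve (M 2) 1 (quad_arc (N 0) (N 1) (fun=> 0)) (N 1).
Proof.
set phi := quad_arc _ _ _.
have phiM j : pull phi (M j) = (j == 0)%:R%:P + (j == 1)%:R%:P * 'X.
  rewrite pull_quad_arc; last exact: fr_homog fr j.
  rewrite !(fr_dual fr) (_ : (M j).@[fun=> 0] = 0) ?mul0r ?addr0 //.
  have [c ->] := homog1_lin (fr_homog fr j); rewrite raddf_sum big1 //= => i _.
  by rewrite mevalM mevalXU mulr0.
have ptE x i : arc_point phi x i = N 0 i + N 1 i * x.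
  by rewrite ffunE /phi /quad_arc !hornerE.
have evM j x : (M j).@[arc_point phi x] = (j == 0)%:R + (j == 1)%:R * x.
  by rewrite -pull_eval phiM !hornerE.
have hM := fr_homog fr; split=> //.
- move=> x; exists (M 1 - x%:MP * M 0), (M 0), 1; split; last by rewrite hornerE oner_neq0.
    have h1 : M 1 - x%:MP * M 0 \is 1.-homog.
      by rewrite mul_mpolyC; apply: rpredB; [|apply: rpredZ].
    split=> //.
    + by rewrite evM eqxx /= mul0r addr0 oner_neq0.
    + by rewrite mevalB mevalM mevalC !evM /=; ring.
    + by rewrite evM /= mul0r addr0.
    + exists (M 2), 0, 1, 0%N; split; last by rewrite meval1 oner_neq0.
      * move=> D f; apply: (@vanishing_ideal2 _ _ (M 0)) => i.
        exists (N 1 i)%:MP, (N 2 i)%:MP; rewrite (fr_var fr) sum_I3 ptE.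
        by rewrite mpolyCD mpolyCM; ring.
      * by ring.
      * exact: dhomog1.
    + by move=> c; rewrite rmorphM /= phiM /= mul0r addr0 mulr0.
    + move=> y; rewrite rmorphM => /eqP; rewrite mulf_eq0 => /orP[/eqP|/eqP //].
      rewrite rmorphB rmorphM /= pullC !phiM /= mul0r addr0 mulr1 add0r mul1r => /eqP.
      by rewrite polyXsubC_eq0.
    + by move=> a aE; rewrite -pull_eval aE horner0.
  by rewrite rmorphB rmorphM /= pullC !phiM /=; ring.
- move=> P [P0 MP]; have [z|nz] := eqVneq (M 0).@[P] 0.
    right; exists (M 1).@[P]; split=> [|i]; last by rewrite frame_eval z MP; ring.
    apply: contraNneq P0 => z1; apply/eqP/ffunP => i.
    by rewrite frame_eval z z1 MP ffunE; ring.
  left; exists ((M 1).@[P] / (M 0).@[P]), (M 0).@[P]; split=> // i.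
  by rewrite ptE frame_eval MP; field.
Qed.

Definition frame_conic := M 1 ^+ 2 - M 0 * M 2.

(** The line [M 1 = x * M 0] joins the point of parameter [x] to the point [N 2]
at infinity, so it is transversal to the conic and gives a uniformizer. *)
Lemma conic_rational : rational_curve frame_conic 2 (quad_arc (N 0) (N 1) (N 2)) (N 2).
Proof.
set phi := quad_arc _ _ _.
have phiM j : pull phi (M j) = (j == 0)%:R%:P + (j == 1)%:R%:P * 'X + (j == 2)%:R%:P * 'X^2.
  by rewrite pull_quad_arc; [rewrite !(fr_dual fr) | exact: fr_homog fr j].
have ptE x i : arc_point phi x i = N 0 i + N 1 i * x + N 2 i * x ^+ 2.
  by rewrite ffunE /phi /quad_arc !hornerE.
have evM j x : (M j).@[arc_point phi x] = (j == 0)%:R + (j == 1)%:R * x + (j == 2)%:R * x ^+ 2.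
  by rewrite -pull_eval phiM !hornerE.
have phig : pull phi frame_conic = 0.
  by rewrite rmorphB rmorphXn rmorphM /= !phiM /=; ring.
have hM := fr_homog fr.
have hg : frame_conic \is 2.-homog.
  by apply: rpredB; [have := dhomogMn 2 (hM 1) | have := dhomogM (hM 0) (hM 2)].
split=> //.
- move=> x; exists (M 1 - x%:MP * M 0), (M 0), 1; split; last by rewrite hornerE oner_neq0.
    have h1 : M 1 - x%:MP * M 0 \is 1.-homog.
      by rewrite mul_mpolyC; apply: rpredB; [|apply: rpredZ].
    split=> //.
    + by rewrite evM /= !mul0r !addr0 oner_neq0.
    + by rewrite mevalB mevalM mevalC !evM /=; ring.
    + by rewrite -pull_eval phig horner0.
    + exists (M 2 - x%:MP * M 1), (M 1), (- M 0), 1%N; split.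
      * move=> D f; apply: (@vanishing_ideal2 _ _ (M 0)) => i.
        exists ((N 1 i)%:MP + x%:MP * (N 2 i)%:MP), (N 2 i)%:MP; rewrite (fr_var fr) sum_I3 ptE.
        by rewrite !mpolyCD !mpolyCM; ring.
      * by rewrite /frame_conic; ring.
      * by rewrite rpredN.
      * by rewrite mevalN oppr_eq0 evM /= !mul0r !addr0 oner_neq0.
    + by move=> c; rewrite rmorphM /= phig mulr0.
    + move=> y; rewrite rmorphM => /eqP; rewrite mulf_eq0 => /orP[/eqP|/eqP //].
      rewrite rmorphB rmorphM /= pullC !phiM /= => /(congr1 (fun p : {poly k} => p`_1)).
      by rewrite !coefE /= !(mul0r, mulr0, add0r, addr0, mulr1, subr0) => /eqP; rewrite oner_eq0.
    + by move=> a aE; rewrite -pull_eval aE horner0.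
  by rewrite rmorphB rmorphM /= pullC !phiM /=; ring.
- move=> P [P0]; rewrite mevalB expr2 !mevalM -expr2 => /eqP; rewrite subr_eq0 => /eqP MP.
  have [z|nz] := eqVneq (M 0).@[P] 0.
    have z1 : (M 1).@[P] = 0.
      by apply/eqP; rewrite -[_ == 0](expf_eq0 _ 2) MP z mul0r.
    right; exists (M 2).@[P]; split=> [|i]; last by rewrite frame_eval z z1; ring.
    apply: contraNneq P0 => z2; apply/eqP/ffunP => i.
    by rewrite frame_eval z z1 z2 ffunE; ring.
  left; exists ((M 1).@[P] / (M 0).@[P]), (M 0).@[P]; split=> // i.
  have M2E : (M 2).@[P] = (M 1).@[P] ^+ 2 / (M 0).@[P] by rewrite MP mulrC mulKf.
  by rewrite ptE frame_eval M2E; field.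
Qed.

End Frame.
End RationalCurves.

(** * Restriction to lines, and binary forms *)

Section Lines.
Variable k : numClosedFieldType.
Implicit Types (f g h : {mpoly k[3]}) (P : ppoint k) (x z : k).

Lemma tdivides_mull g f h : tdivides g f -> tdivides g (h * f).
Proof. by move=> [c ->]; exists (h * c); rewrite mulrA. Qed.

Lemma tdividesD g f h : tdivides g f -> tdivides g h -> tdivides g (f + h).
Proof. by move=> [c ->] [c' ->]; exists (c + c'); rewrite mulrDl. Qed.

Lemma tdividesN g f : tdivides g f -> tdivides g (- f).
Proof. by move=> [c ->]; exists (- c); rewrite mulNr. Qed.

Lemma tdividesB g f h : tdivides g f -> tdivides g h -> tdivides g (f - h).
Proof. by move=> gf gh; apply: tdividesD => //; apply: tdividesN. Qed.

Lemma tdivides0 g : tdivides g 0.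
Proof. by exists 0; rewrite mul0r. Qed.

(** The substitution [s] plays the role of restriction to the line [l = 0], with
values kept in the ring of polynomials in three variables. *)
Definition restricts (s : 'I_3 -> {mpoly k[3]}) (l : {mpoly k[3]}) :=
  l != 0 /\ subst s l = 0 /\ forall i, tdivides l ('X_i - s i).

Lemma restricts_ker s l f : restricts s l -> tdivides l (f - subst s f).
Proof.
move=> [_ [_ hs]]; apply: (subst_diff (J := tdivides l)) => //.
- exact: tdivides0.
- by move=> x y; apply: tdividesD.
- by move=> a x; apply: tdivides_mull.
Qed.

Lemma restricts_div s l f : restricts s l -> subst s f = 0 -> tdivides l f.
Proof. by move=> hs f0; rewrite -(subr0 f) -f0; apply: restricts_ker. Qed.

(** A line that is not contained in the curve [q] is not a zero divisor modulo
[q]: if [l * h = c * q], then [c] vanishes on the line, so [l] divides it. *)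
Lemma restricts_cancel s l q h : restricts s l -> subst s q != 0 ->
  tdivides q (l * h) -> tdivides q h.
Proof.
move=> hs q0 [c lhE]; have [l0 [ls _]] := hs.
have /eqP : subst s (l * h) = subst s (c * q) by rewrite lhE.
rewrite !rmorphM /= ls mul0r eq_sym mulf_eq0 (negbTE q0) orbF => /eqP.
move=> /(restricts_div hs) [c' cE]; exists c'; apply: (mulfI l0).
by rewrite lhE cE; ring.
Qed.

Lemma subst_homog (s : 'I_3 -> {mpoly k[3]}) f D : (forall i, s i \is 1.-homog) ->
  f \is D.-homog -> subst s f \is D.-homog.
Proof.
move=> hs /dhomogP hf; rewrite /subst /mmap big_seq; apply: rpred_sum => m mm.
rewrite mul_mpolyC; apply: rpredZ; have <- : mdeg m = D by exact: hf.
rewrite /mmap1 mdegE; elim/big_ind2: _ => [|f1 n1 f2 n2 h1 h2|i _].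
- exact: dhomog1.
- exact: dhomogM.
- by have := dhomogMn (m i) (hs i); rewrite mul1n.
Qed.

(** The line joining [(c.1 : 0 : c.2)] to [(0 : 1 : 0)]. *)
Definition ptline (c : k * k) : {mpoly k[3]} := c.2%:MP * 'X_0 - c.1%:MP * 'X_2.

Definition vec3 (x y z : k) : ppoint k :=
  [ffun i : 'I_3 => if i == 0 then x else if i == 1 then y else z].

Definition ptline_arc (x z : k) (i : 'I_3) : {poly k} :=
  if i == 0 then x%:P else if i == 1 then 'X else z%:P.

Lemma homog_ptline c : ptline c \is 1.-homog.
Proof.
rewrite /ptline !mul_mpolyC; apply: rpredB; apply: rpredZ; exact: homog_var.
Qed.

Lemma ptline_arc_eval f x y z : (pull (ptline_arc x z) f).[y] = f.@[vec3 x y z].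
Proof.
rewrite pull_horner; apply: meval_eq => i; rewrite /ptline_arc ffunE.
by case: ifP => _; [rewrite hornerC | case: ifP => _; rewrite ?hornerX ?hornerC].
Qed.

Lemma ptline_arc_form x z : pull (ptline_arc x z) (ptline (x, z)) = 0.
Proof.
by rewrite rmorphB !rmorphM /= !pullC !pullX /ptline_arc /= mulrC subrr.
Qed.

(** Projection onto [ptline (x, z)] when [m] takes the value 1 at [(x, _, z)]. *)
Definition proj01 (m : {mpoly k[3]}) x z (i : 'I_3) : {mpoly k[3]} :=
  if i == 0 then x%:MP * m else if i == 1 then 'X_1 else z%:MP * m.

Lemma I3_ind (Q : 'I_3 -> Prop) : Q 0 -> Q 1 -> Q 2 -> forall i, Q i.
Proof.
move=> Q0 Q1 Q2 [[|[|[|//]]] lti].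
- by rewrite (_ : Ordinal lti = 0) //; apply: val_inj.
- by rewrite (_ : Ordinal lti = 1) //; apply: val_inj.
- by rewrite (_ : Ordinal lti = 2) //; apply: val_inj.
Qed.

Lemma ptline_unit x z : (x, z) != (0, 0) -> exists al be, al * x + be * z = 1.
Proof.
have [->|x0 _] := eqVneq x 0; last by exists x^-1, 0; rewrite mulVf // mul0r addr0.
have [->|z0 _] := eqVneq z 0; first by rewrite eqxx.
by exists 0, z^-1; rewrite mulVf // mul0r add0r.
Qed.

Lemma ptline_neq0 x z : (x, z) != (0, 0) -> ptline (x, z) != 0.
Proof.
move=> /ptline_unit [al [be E]]; apply/eqP => /(congr1 (meval (vec3 be 0 (- al)))).
rewrite mevalB !mevalM !mevalC !mevalXU !ffunE /= => /eqP.
have -> : z * be - x * - al = al * x + be * z by ring.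
by rewrite E oner_eq0.
Qed.

Lemma ptline_restricts x z al be : al * x + be * z = 1 -> (x, z) != (0, 0) ->
  restricts (proj01 (al%:MP * 'X_0 + be%:MP * 'X_2) x z) (ptline (x, z)).
Proof.
move=> E xz; have EM : al%:MP * x%:MP + be%:MP * z%:MP = 1 :> {mpoly k[3]}.
  by rewrite -!mpolyCM -mpolyCD E mpolyC1.
split; first exact: ptline_neq0.
split.
  rewrite rmorphB !rmorphM /= !substC !substX /proj01 /=; ring.
elim/I3_ind; rewrite /proj01 /=.
- exists be%:MP; rewrite /ptline /= -{1}[X in X - _]mul1r -EM; ring.
- by rewrite subrr; apply: tdivides0.
- exists (- al%:MP); rewrite /ptline /= -{1}[X in X - _]mul1r -EM; ring.
Qed.

(** The form of degree [D] that restricts to [p] on a line where [m] restricts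
to 1 and ['X_1] to the parameter. *)
Definition homogenize (m : {mpoly k[3]}) D (p : {poly k}) : {mpoly k[3]} :=
  \sum_(i < D.+1) (p`_i)%:MP * 'X_1 ^+ i * m ^+ (D - i).

Lemma homogenize_homog m D p : m \is 1.-homog -> homogenize m D p \is D.-homog.
Proof.
move=> hm; apply: rpred_sum => i _; rewrite -mulrA mul_mpolyC; apply: rpredZ.
have := dhomogM (dhomogMn i (homog_var k 1)) (dhomogMn (D - i) hm).
by rewrite !mul1n subnKC // -ltnS.
Qed.

Lemma subst_proj01 m x z f D : f \is D.-homog ->
  subst (proj01 m x z) f = homogenize m D (pull (ptline_arc x z) f).
Proof.
move=> /dhomogP hf; rewrite /homogenize /subst /mmap [X in pull _ X]mpolyE.
under [RHS]eq_bigr => i _ do rewrite raddf_sum /= coef_sum raddf_sum /= !mulr_suml.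
rewrite exchange_big /= !big_seq; apply: eq_bigr => mu mm.
have mD : mdeg mu = D by exact: hf.
have m3 : (mu 0%R + mu 1%R + mu 2%R = D)%N by rewrite -mD mdegE sum_I3.
have le1 : (mu 1%R < D.+1)%N by lia.
have pE : pull (ptline_arc x z) (f@_mu *: 'X_[mu]) = (f@_mu * x ^+ mu 0 * z ^+ mu 2) *: 'X^(mu 1).
  rewrite pullZ mpolyXE_id rmorph_prod /= !big_ord_recl big_ord0 mulr1 /=.
  rewrite (_ : lift ord0 ord0 = 1); last exact: val_inj.
  rewrite (_ : lift ord0 (lift ord0 ord0) = 2); last exact: val_inj.
  rewrite !rmorphXn /= !pullX /ptline_arc /= -!mul_polyC !polyCM !rmorphXn /=; ring.
rewrite (bigD1 (Ordinal le1)) //= [X in _ + X]big1 => [|i ne].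
  rewrite addr0 pE coefZ coefXn eqxx mulr1.
  rewrite /mmap1 !big_ord_recl big_ord0 mulr1 /=.
  rewrite (_ : lift ord0 ord0 = 1); last exact: val_inj.
  rewrite (_ : lift ord0 (lift ord0 ord0) = 2); last exact: val_inj.
  rewrite (_ : (D - mu 1%R = mu 0%R + mu 2%R)%N); last by lia.
  rewrite /proj01 /= !mpolyCM !rmorphXn /= !exprMn exprD; ring.
rewrite pE coefZ coefXn (_ : (i == mu 1 :> nat) = false); last first.
  by apply/negbTE; apply: contra ne => /eqP e; apply/eqP/val_inj.
by rewrite mulr0 mpolyC0 !mul0r.
Qed.

Lemma pull_homogenize m x z D (p : {poly k}) : pull (ptline_arc x z) m = 1 -> (size p <= D.+1)%N ->
  pull (ptline_arc x z) (homogenize m D p) = p.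
Proof.
move=> mE sp; rewrite raddf_sum /=; under eq_bigr => i _.
  rewrite !rmorphM /= !rmorphXn /= mE pullC pullX expr1n mulr1 /ptline_arc /= mul_polyC.
  over.
by rewrite -poly_def; apply/polyP => i; rewrite coef_poly; case: ltnP => // /(leq_trans sp) /leq_sizeP ->.
Qed.

(** Lift the quotient of the two restrictions to a form [H]; the difference
[f - H * q] vanishes on the line, hence is a multiple of its equation. *)
Lemma ptline_lift x z q d f D : (x, z) != (0, 0) -> q \is d.-homog -> f \is D.-homog ->
  size (pull (ptline_arc x z) q) = d.+1 ->
  (pull (ptline_arc x z) q %| pull (ptline_arc x z) f)%R -> ideal2 (ptline (x, z)) q f.
Proof.
move=> xz hq hf sq /dvdpP [p fE]; have [al [be E]] := ptline_unit xz.
pose m : {mpoly k[3]} := al%:MP * 'X_0 + be%:MP * 'X_2.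
have hm : m \is 1.-homog.
  by rewrite /m !mul_mpolyC; apply: rpredD; apply: rpredZ; apply: homog_var.
have mE : pull (ptline_arc x z) m = 1.
  by rewrite rmorphD !rmorphM /= !pullC !pullX /ptline_arc /= -!polyCM -polyCD E.
have sf : (size (pull (ptline_arc x z) f) <= D.+1)%N.
  have := size_pull hf (phi := ptline_arc x z) (e := 1); rewrite muln1; apply.
  by elim/I3_ind; rewrite /ptline_arc /= ?size_polyX // (leq_trans (size_polyC_leq1 _)).
have hres := ptline_restricts E xz.
have [p0|p0] := eqVneq p 0.
  have [c ->] : tdivides (ptline (x, z)) f.
    apply: (restricts_div hres); rewrite (subst_proj01 _ _ _ hf) fE p0 mul0r.
    by rewrite /homogenize big1 // => i _; rewrite coef0 mpolyC0 !mul0r.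
  by exists c, 0; ring.
have q0 : pull (ptline_arc x z) q != 0 by rewrite -size_poly_eq0 sq.
have sp : (size p + d <= D.+1)%N.
  by move: sf; rewrite fE size_mul // sq addnS.
have p1 : (0 < size p)%N by rewrite size_poly_gt0.
have le_dD : (d <= D)%N by rewrite -ltnS (leq_trans _ sp) // -{1}[d]add0n ltn_add2r.
pose H := homogenize m (D - d) p.
have hH : H \is (D - d).-homog by exact: homogenize_homog.
have hD : f - H * q \is D.-homog.
  by apply: rpredB => //; have := dhomogM hH hq; rewrite subnK.
have [c cE] : tdivides (ptline (x, z)) (f - H * q).
  apply: (restricts_div hres); rewrite (subst_proj01 _ _ _ hD).
  rewrite rmorphB rmorphM /= pull_homogenize //; last first.
    by rewrite -subSn // leq_subRL 1?addnC // (leq_trans le_dD).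
  by rewrite fE subrr /homogenize big1 // => i _; rewrite coef0 mpolyC0 !mul0r.
by exists c, H; rewrite -cE subrK.
Qed.

Definition drop1 (i : 'I_3) : {mpoly k[3]} := if i == 1 then 0 else 'X_i.

(** Forms in ['X_0] and ['X_2] only. *)
Definition binary f := subst drop1 f = f.

Lemma drop1_homog i : drop1 i \is 1.-homog.
Proof. by rewrite /drop1; case: ifP => _; [apply: dhomog0 | apply: homog_var]. Qed.

Lemma drop1K f : binary (subst drop1 f).
Proof.
rewrite /binary; elim/mpoly_ring_ind: f => [c|i|f h IHf IHh|f h IHf IHh].
- by rewrite !substC.
- by rewrite substX /drop1; case: ifP => i1; rewrite ?rmorph0 // substX /drop1 i1.
- by rewrite !rmorphD /= IHf IHh.
- by rewrite !rmorphM /= IHf IHh.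
Qed.

Lemma binary_ptline_arc f x z : binary f -> pull (ptline_arc x z) f = (f.@[vec3 x 0 z])%:P.
Proof.
move=> bf; rewrite -{1}bf; elim/mpoly_ring_ind: {bf}f => [c|i|f h IHf IHh|f h IHf IHh].
- by rewrite substC pullC mevalC.
- rewrite substX mevalXU ffunE /drop1; elim/I3_ind: i; rewrite /= ?rmorph0 // pullX //.
- by rewrite !rmorphD /= IHf IHh ?rmorphD.
- by rewrite !rmorphM /= IHf IHh ?rmorphM.
Qed.

(** A non-constant dehomogenization has a root.  If both were constant, their
common value [c] would satisfy [c = 2^(D+1) c] by homogeneity. *)
Lemma binary_root f D : f \is D.+1.-homog -> exists x z, (x, z) != (0, 0) /\ f.@[vec3 x 0 z] = 0.
Proof.
move=> hf.
pose p := pull (fun i : 'I_3 => if i == 0 then 'X else if i == 1 then 0 else 1) f.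
pose h := pull (fun i : 'I_3 => if i == 0 then 1 else if i == 1 then 0 else 'X) f.
have pE x : p.[x] = f.@[vec3 x 0 1].
  rewrite pull_horner; apply: meval_eq => i; rewrite ffunE.
  by case: ifP => _; [rewrite hornerX | case: ifP => _; rewrite ?horner0 ?hornerE].
have hE z : h.[z] = f.@[vec3 1 0 z].
  rewrite pull_horner; apply: meval_eq => i; rewrite ffunE.
  by case: ifP => _; [rewrite hornerE | case: ifP => _; rewrite ?horner0 ?hornerX].
have [sp|/closed_rootP [x /rootP px]] := boolP (size p == 1); last first.
  by exists x, 1; split; [rewrite xpair_eqE oner_eq0 andbF | rewrite -pE].
have [sh|/closed_rootP [z /rootP hz]] := boolP (size h == 1); last first.
  by exists 1, z; split; [rewrite xpair_eqE oner_eq0 | rewrite -hE].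
case/size_poly1P: sp => c c0 pc; case/size_poly1P: sh => c' c'0 hc.
have h1 : c' = c.
  by have := hE 1; have := pE 1; rewrite pc hc !hornerC => -> ->.
have : f.@[vec3 2 0 1] = 2 ^+ D.+1 * f.@[vec3 1 0 2^-1].
  apply: meval_homogZ hf _ => i; rewrite !ffunE.
  by case: ifP => _; [rewrite mulr1 | case: ifP => _; rewrite ?mulr0 // mulfV // pnatr_eq0].
rewrite -pE -hE pc hc !hornerC h1 -{1}[c]mul1r => /(mulIf c0) /eqP.
by rewrite -natrX -[1]/(1%:R) eqr_nat expnS; case: (2 ^ D)%N (expn_gt0 2 D) => // n _; rewrite mulnS.
Qed.

Lemma ptline_div f D x z : f \is D.-homog -> (x, z) != (0, 0) ->
  pull (ptline_arc x z) f = 0 -> tdivides (ptline (x, z)) f.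
Proof.
move=> hf xz f0; have [al [be E]] := ptline_unit xz.
apply: (restricts_div (ptline_restricts E xz)); rewrite (subst_proj01 _ _ _ hf) f0.
by rewrite /homogenize big1 // => i _; rewrite coef0 mpolyC0 !mul0r.
Qed.

Lemma binary_ptline c : binary (ptline c).
Proof. by rewrite /binary rmorphB !rmorphM /= !substC !substX. Qed.

(** A root of the form is a line through [(0 : 1 : 0)] that divides it. *)
Lemma binary_split f D : f \is D.-homog -> binary f -> f != 0 ->
  exists c (s : seq (k * k)), [/\ c != 0, all (fun c => c != (0, 0)) s
    & f = c%:MP * \prod_(c <- s) ptline c].
Proof.
elim: D f => [|D IH] f hf bf f0.
  have [c fE] := homog0_const hf; exists c, [::]; rewrite big_nil mulr1; split=> //.
  by apply: contra f0 => /eqP c0; rewrite fE c0 mpolyC0.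
have [x [z [xz fxz]]] := binary_root hf.
have [c0 cE] : tdivides (ptline (x, z)) f.
  by apply: (ptline_div hf xz); rewrite binary_ptline_arc // fxz.
have /(ideal2_homog (homog_ptline (x, z)) (dhomog0 _ _ 0%N) hf) [h [b0 [fE hh _]]] :
  ideal2 (ptline (x, z)) 0 f by exists c0, 0; rewrite cE; ring.
move: fE; rewrite mulr0 addr0 => fE; rewrite subSS subn0 in hh.
have fE' : f = subst drop1 h * ptline (x, z).
  by rewrite -bf {1}fE rmorphM /= binary_ptline.
have h0 : subst drop1 h != 0 by apply: contraNneq f0 => h0; rewrite fE' h0 mul0r.
have [c [s [cn0 sn0 hE]]] := IH _ (subst_homog drop1_homog hh) (drop1K h) h0.
exists c, ((x, z) :: s); split=> //; first by rewrite /= xz.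
by rewrite big_cons fE' hE; ring.
Qed.

End Lines.

(** * Diagonal curves are irreducible *)

Section Diagonal.
Variable k : numClosedFieldType.
Variables (a : 'I_3 -> k) (d : nat).
Hypothesis a0 : forall i, a i != 0.
Hypothesis d1 : (1 < d)%N.
Implicit Types (f g h : {mpoly k[3]}) (P : ppoint k) (x z : k).

Definition diagonal : {mpoly k[3]} := \sum_i (a i)%:MP * 'X_i ^+ d.
Let q := diagonal.
Let d0 : (0 < d)%N := ltnW d1.

Lemma diagonal_homog : q \is d.-homog.
Proof.
apply: rpred_sum => i _; rewrite mul_mpolyC; apply: rpredZ.
by have := dhomogMn d (homog_var k i); rewrite mul1n.
Qed.

Lemma diagonal_eval (P : 'I_3 -> k) : q.@[P] = \sum_i a i * P i ^+ d.
Proof.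
rewrite raddf_sum; apply: eq_bigr => i _ /=.
by rewrite mevalM mevalC rmorphXn /= mevalXU.
Qed.

Lemma diagonal_subst s : subst s q = \sum_i (a i)%:MP * s i ^+ d.
Proof.
rewrite rmorph_sum; apply: eq_bigr => i _ /=.
by rewrite rmorphM /= substC rmorphXn /= substX.
Qed.

Lemma diagonal_pull phi : pull phi q = \sum_i (a i)%:P * phi i ^+ d.
Proof.
rewrite rmorph_sum; apply: eq_bigr => i _ /=.
by rewrite rmorphM /= pullC rmorphXn /= pullX.
Qed.

Lemma diagonal_mderiv i : q^`M(i) = (a i *+ d)%:MP * 'X_i ^+ d.-1.
Proof.
have derX j n : ('X_j ^+ n : {mpoly k[3]})^`M(i) = (j == i)%:R *: ('X_j ^+ n.-1 *+ n).
  elim: n => [|n IH]; first by rewrite expr0 mulr0n scaler0 -mpolyC1 mderivC.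
  rewrite exprS mderivM IH /= mderivX mnm1E; case: eqP => [->|_]; last first.
    by rewrite !scale0r mul0r mulr0 addr0.
  rewrite !scale1r (_ : (U_(i) - U_(i))%MM = 0%MM); last first.
    by apply/mnmP => l; rewrite mnmBE subnn mnm0E.
  rewrite mpolyX0 mul1r mulrnAr; case: n {IH} => [|n]; first by rewrite mulr0n addr0.
  by rewrite -exprS [RHS]mulrS.
rewrite /q /diagonal (raddf_sum (mderiv i)) /= (bigD1 i) //= big1 => [|j ji].
  by rewrite addr0 mderiv_mulC derX eqxx scale1r mulrnAr -mulrnAl raddfMn.
by rewrite mderiv_mulC derX (negbTE ji) scale0r mulr0.
Qed.

Lemma diagonal_deriv i P : (q^`M(i)).@[P] = a i * (P i ^+ d.-1 *+ d).
Proof. by rewrite diagonal_mderiv mevalM mevalC rmorphXn /= mevalXU mulrnAl mulrnAr. Qed.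

Lemma diagonal_smooth : smooth q.
Proof.
move=> P [P0 _]; have [i Pi] : exists i, P i != 0.
  apply/existsP; apply: contraT; rewrite negb_exists => /forallP h.
  by case/eqP: P0; apply/ffunP => i; rewrite ffunE; apply/eqP; have := h i; rewrite negbK.
exists i; rewrite diagonal_deriv mulf_neq0 // -mulr_natr mulf_neq0 ?expf_neq0 //.
by rewrite pnatr_eq0 -lt0n.
Qed.

Lemma restricts_diagonal s l i (P : 'I_3 -> k) : restricts s l ->
  \sum_j a j * (s j).@[P] ^+ d = a i -> subst s q != 0.
Proof.
move=> _ E; apply/eqP => /(congr1 (meval P)); rewrite diagonal_subst raddf_sum /=.
under eq_bigr => j _ do rewrite mevalM mevalC rmorphXn /=.
by rewrite E meval0 => /eqP; rewrite (negbTE (a0 i)).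
Qed.

Lemma diagonal_cancel_ptline c h : c != (0, 0) -> tdivides q (ptline c * h) -> tdivides q h.
Proof.
case: c => x z xz; have [al [be E]] := ptline_unit xz.
have hr := ptline_restricts E xz; apply: (restricts_cancel hr).
apply: (restricts_diagonal (i := 1) (P := vec3 0 1 0) hr).
rewrite sum_I3 /proj01 /= !mevalM !mevalD !mevalM !mevalC !mevalXU !ffunE /=.
by rewrite !(mulr0, addr0) !expr0n !eqn0Ngt d0 /= !mulr0 add0r addr0 expr1n mulr1.
Qed.

Lemma X1_restricts : restricts (@drop1 k) 'X_1.
Proof.
split; first by rewrite -msize_poly_eq0 msizeX.
split; first by rewrite substX.
elim/I3_ind; rewrite /drop1 /= ?subrr; try exact: tdivides0.
by exists 1; rewrite subr0 mul1r.
Qed.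

Lemma diagonal_cancel_X1 h : tdivides q ('X_1 * h) -> tdivides q h.
Proof.
apply: (restricts_cancel X1_restricts).
apply: (restricts_diagonal (i := 0) (P := vec3 1 0 0) X1_restricts).
rewrite sum_I3 /drop1 /= !mevalXU meval0 !ffunE /=.
by rewrite !expr0n !eqn0Ngt d0 /= !mulr0 !addr0 expr1n mulr1.
Qed.

Lemma diagonal_not_unit c : ~ tdivides q c%:MP \/ c = 0.
Proof.
have [->|c0] := eqVneq c 0; first by right.
left=> -[h /(congr1 (meval (0 : ppoint k)))].
rewrite mevalC mevalM diagonal_eval sum_I3 !ffunE expr0n eqn0Ngt d0 /= !mulr0 !addr0 mulr0.
by move/eqP; rewrite (negbTE c0).
Qed.

Lemma diagonal_cancel_prod (s : seq (k * k)) h : all (fun c => c != (0, 0)) s ->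
  tdivides q ((\prod_(c <- s) ptline c) * h) -> tdivides q h.
Proof.
elim: s => [|c s IH] /=; first by rewrite big_nil mul1r.
by case/andP=> c0 s0; rewrite big_cons -mulrA => /(diagonal_cancel_ptline c0) /(IH s0).
Qed.

Lemma diagonal_cancel_binary f D h : f \is D.-homog -> binary f -> f != 0 ->
  tdivides q (f * h) -> tdivides q h.
Proof.
move=> hf bf f0; have [c [s [c0 s0 ->]]] := binary_split hf bf f0.
rewrite -mulrA => -[w wE]; apply: (diagonal_cancel_prod s0).
exists ((c^-1)%:MP * w); rewrite -[RHS]mulrA -wE !mulrA -mpolyCM mulVf // mpolyC1 mul1r.
by [].
Qed.

Lemma diagonal_ptline_arc x z : pull (ptline_arc x z) q = (a 1)%:P * 'X^d + (a 0 * x ^+ d + a 2 * z ^+ d)%:P.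
Proof.
rewrite diagonal_pull sum_I3 /ptline_arc /= -!rmorphXn /= -!polyCM polyCD; ring.
Qed.

Lemma size_diagonal_ptline_arc x z : size (pull (ptline_arc x z) q) = d.+1.
Proof.
rewrite diagonal_ptline_arc size_polyDl; first by rewrite mul_polyC size_scale // size_polyXn.
by rewrite mul_polyC size_scale // size_polyXn (leq_ltn_trans (size_polyC_leq1 _)).
Qed.

(** The line [l0] meets the curve only at the hyperflex [P0 = (x0 : 0 : 1)],
because [q = l0 * e + a_1 X_1^d] with [e] a unit at [P0].  Hence ['X_1] is a
uniformizer at [P0] and [l0] has order [d] there. *)
Section Prime.
Variable x0 : k.
Hypothesis x0E : a 0 * x0 ^+ d + a 2 = 0.
Let l0 := ptline (x0, 1).
Let P0 := vec3 x0 0 1.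
Let u : {mpoly k[3]} := (a 0)%:MP * 'X_0 ^+ d + (a 2)%:MP * 'X_2 ^+ d.
Let e : {mpoly k[3]} := (a 0)%:MP * \sum_(i < d) 'X_0 ^+ (d.-1 - i) * (x0%:MP * 'X_2) ^+ i.

Lemma x0_neq0 : x0 != 0.
Proof.
apply: contraTneq (a0 2) => x00; move: x0E.
by rewrite x00 expr0n eqn0Ngt d0 mulr0 add0r => ->; rewrite eqxx.
Qed.

Let xz : (x0, 1) != (0, 0) :> k * k.
Proof. by rewrite xpair_eqE oner_eq0 andbF. Qed.

Let uE : u = l0 * e.
Proof.
have a2E : a 2 = - (a 0 * x0 ^+ d) by apply/eqP; rewrite -addr_eq0 addrC x0E.
rewrite /u /e /l0 /ptline /= mpolyC1 mul1r mulrCA -subrXX exprMn a2E.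
by rewrite mpolyCN mpolyCM rmorphXn /=; ring.
Qed.

Let qE : q = u + (a 1)%:MP * 'X_1 ^+ d.
Proof. by rewrite /q /diagonal sum_I3 /u; ring. Qed.

Let he : e \is d.-1.-homog.
Proof.
rewrite /e mul_mpolyC; apply: rpredZ; apply: rpred_sum => i _.
have h : x0%:MP * 'X_2 \is [in k[3], 1.-homog] by rewrite mul_mpolyC; apply/rpredZ/homog_var.
have := dhomogM (dhomogMn (d.-1 - i) (homog_var k 0)) (dhomogMn i h).
by rewrite !mul1n subnK // -ltnS prednK.
Qed.

Let be : binary e.
Proof.
rewrite /binary /e rmorphM /= substC rmorph_sum /=; congr (_ * _); apply: eq_bigr => i _.
by rewrite rmorphM /= !rmorphXn /= rmorphM /= substC !substX.
Qed.

Let eP : e.@[P0] != 0.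
Proof.
rewrite mevalM mevalC mulf_neq0 // raddf_sum (eq_bigr (fun=> x0 ^+ d.-1)) => [|i _] /=.
  rewrite sumr_const card_ord -mulr_natr mulf_neq0 ?expf_neq0 ?x0_neq0 //.
  by rewrite pnatr_eq0 -lt0n.
rewrite mevalM !rmorphXn /= mevalM mevalC !mevalXU !ffunE /= mulr1 -exprD subnK //.
by rewrite -ltnS prednK.
Qed.

Let e0 : e != 0. Proof. exact: eval_neq0 eP. Qed.

(** The ideal of [P0] is generated by ['X_1] and [l0], and modulo [q] the product
[e * l0] is a multiple of ['X_1]. *)
Lemma hyperflex_step f D : f \is D.-homog -> f.@[P0] = 0 ->
  exists f1 D1, f1 \is D1.-homog /\ tdivides q (e * f - 'X_1 * f1).
Proof.
move=> hf fP.
have [|A [B fE]] := vanishing_ideal2 (P := P0) (r := 'X_2) (t := 'X_1) (u := l0) _ hf fP.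
  elim/I3_ind; rewrite !ffunE /=.
  - by exists 0, 1; rewrite /l0 /ptline /=; rewrite mpolyC1; ring.
  - by exists 1, 0; rewrite mpolyC0; ring.
  - by exists 0, 0; rewrite mpolyC1; ring.
have : ideal2 'X_1 q (e * f).
  exists (e * A - (a 1)%:MP * B * 'X_1 ^+ d.-1), B.
  rewrite fE qE uE -[in 'X_1 ^+ d](prednK d0) exprS; ring.
move=> /(ideal2_homog (homog_var k 1) diagonal_homog (dhomogM he hf)) [f1 [B' [E hf1 _]]].
by exists f1, (d.-1 + D - 1)%N; split=> //; exists B'; rewrite E; ring.
Qed.

(** The order of [f] at [P0] is at least [n]. *)
Definition div_order f n := exists N f' D', f' \is D'.-homog /\
  tdivides q (e ^+ N * f - 'X_1 ^+ n * f').

Lemma div_order_le f m n : (m <= n)%N -> div_order f n -> div_order f m.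
Proof.
move=> le_mn [N [f' [D' [hf' h]]]].
have := dhomogM (dhomogMn (n - m) (homog_var k 1)) hf' => hf''.
exists N, ('X_1 ^+ (n - m) * f'), (1 * (n - m) + D')%N; split=> //.
by rewrite mulrA -exprD subnKC.
Qed.

(** At each of the [n] steps one of the factors vanishes at [P0], and a factor
['X_1] is extracted from it. *)
Lemma div_order_split n f g D E : f \is D.-homog -> g \is E.-homog -> tdivides q (f * g) ->
  exists i j, [/\ (i + j = n)%N, div_order f i & div_order g j].
Proof.
elim: n f g D E => [|n IH] f g D E hf hg fg.
  by exists 0%N, 0%N; split=> //; [exists 0%N, f, D | exists 0%N, g, E];
     rewrite !expr0 !mul1r subrr; split=> //; apply: tdivides0.
have half f' g' D' E' : f' \is D'.-homog -> g' \is E'.-homog -> tdivides q (f' * g') ->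
    f'.@[P0] = 0 -> exists i j, [/\ (i + j = n.+1)%N, div_order f' i & div_order g' j].
  move=> hf' hg' fg' fP.
  have [f1 [D1 [hf1 fE]]] := hyperflex_step hf' fP.
  have : tdivides q (f1 * g').
    apply: diagonal_cancel_X1; rewrite mulrA.
    have -> : 'X_1 * f1 * g' = e * (f' * g') - g' * (e * f' - 'X_1 * f1) by ring.
    by apply: tdividesB; apply: tdivides_mull.
  move=> /(IH _ _ _ _ hf1 hg') [i [j [ij [N [f2 [D2 [hf2 f2E]]]] oj]]].
  exists i.+1, j; split=> //; first by rewrite addSn ij.
  exists N.+1, f2, D2; split=> //.
  have -> : e ^+ N.+1 * f' - 'X_1 ^+ i.+1 * f2 =
    e ^+ N * (e * f' - 'X_1 * f1) + 'X_1 * (e ^+ N * f1 - 'X_1 ^+ i * f2).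
    by rewrite !exprS; ring.
  by apply: tdividesD; apply: tdivides_mull.
have /eqP : (f * g).@[P0] = 0.
  case: fg => c ->; rewrite mevalM diagonal_eval sum_I3 !ffunE /= expr0n eqn0Ngt d0.
  by rewrite mulr0 addr0 expr1n mulr1 x0E mulr0.
rewrite mevalM mulf_eq0 => /orP[]/eqP fP; first exact: half hf hg fg fP.
have [|i [j [ij oi oj]]] := half _ _ _ _ hg hf _ fP; first by rewrite mulrC.
by exists j, i; split=> //; rewrite addnC.
Qed.

(** On [l0] the form [f] is divisible by [q], so [f = f1 * l0 + B * q] where [f1]
has smaller degree and one zero along [l0] less.  The degree is exhausted before
the zeros are. *)
Lemma line_order_vanish M f D : f \is D.-homog -> (D < M)%N ->
  (exists N g, tdivides q (e ^+ N * f - l0 ^+ M * g)) -> tdivides q f.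
Proof.
elim: M f D => // M IH f D hf lt_DM [N [g [c cE]]].
have arc_l0 : pull (ptline_arc x0 1) l0 = 0 by exact: ptline_arc_form.
have arc_e : pull (ptline_arc x0 1) e = (e.@[P0])%:P by exact: binary_ptline_arc be.
have qf : (pull (ptline_arc x0 1) q %| pull (ptline_arc x0 1) f)%R.
  have /(congr1 (pull (ptline_arc x0 1))) := cE.
  rewrite rmorphB !rmorphM !rmorphXn /= arc_l0 arc_e exprS mul0r mul0r subr0 => E.
  rewrite -(@dvdpZr _ ((e.@[P0]) ^+ N)) ?expf_neq0 // -mul_polyC rmorphXn /= E.
  exact: dvdp_mull (dvdpp _).
have /(ideal2_homog (homog_ptline _) diagonal_homog hf) [f1 [B [fE hf1 _]]] :=
  ptline_lift xz diagonal_homog hf (size_diagonal_ptline_arc _ _) qf.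
case: D => [|D] in hf hf1 lt_DM *.
  have [c0 f0] := homog0_const hf; move: qf; rewrite f0 pullC => qf.
  have [->|cn0] := eqVneq c0 0; first by rewrite mpolyC0; apply: tdivides0.
  have := dvdp_leq _ qf; rewrite polyC_eq0 cn0 size_diagonal_ptline_arc size_polyC cn0 => /(_ isT).
  by rewrite ltnS leqn0 eqn0Ngt d0.
rewrite subSS subn0 in hf1.
rewrite fE; apply: tdividesD; last by exists B.
rewrite mulrC; apply: tdivides_mull; apply: IH hf1 _ _ => //.
exists N, g; apply: (diagonal_cancel_ptline xz).
have -> : ptline (x0, 1) * (e ^+ N * f1 - l0 ^+ M * g) =
  (e ^+ N * f - l0 ^+ M.+1 * g) - (e ^+ N * B) * q.
  by rewrite fE exprS /l0; ring.
by apply: tdividesB; [exists c | exists (e ^+ N * B)].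
Qed.

(** Modulo [q], [X_1^d] is a constant times [l0 * e]. *)
Lemma div_order_vanish f D : f \is D.-homog -> div_order f (d * D.+1) -> tdivides q f.
Proof.
move=> hf [N [f' [D' [hf' h]]]]; apply: (line_order_vanish hf (leqnn D.+1)).
pose c := (- ((a 1)^-1))%:MP : {mpoly k[3]}.
have qX : tdivides q ('X_1 ^+ d - c * (l0 * e)).
  have E1 : ((a 1)^-1)%:MP * (a 1)%:MP = 1 :> {mpoly k[3]}.
    by rewrite -mpolyCM mulVf // mpolyC1.
  by exists (((a 1)^-1)%:MP); rewrite qE uE /c mpolyCN mulrDr [X in _ = _ + X]mulrA E1; ring.
have qX' n : tdivides q (('X_1 ^+ d) ^+ n - (c * (l0 * e)) ^+ n).
  by rewrite subrXX mulrC; apply: tdivides_mull.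
exists N, (c ^+ D.+1 * e ^+ D.+1 * f').
have -> : e ^+ N * f - l0 ^+ D.+1 * (c ^+ D.+1 * e ^+ D.+1 * f') =
  (e ^+ N * f - 'X_1 ^+ (d * D.+1) * f') +
  f' * (('X_1 ^+ d) ^+ D.+1 - (c * (l0 * e)) ^+ D.+1).
  by rewrite exprM !exprMn; ring.
by apply: tdividesD => //; apply: tdivides_mull.
Qed.

(** The product has every order at [P0], so one of the factors has an order that
is too large for its degree. *)
Lemma diagonal_prime_aux f g D E : f \is D.-homog -> g \is E.-homog ->
  tdivides q (f * g) -> tdivides q f \/ tdivides q g.
Proof.
move=> hf hg fg; pose n := (d * D.+1 + d * E.+1)%N.
have [i [j [ij oi oj]]] := div_order_split n hf hg fg.
case: (leqP (d * D.+1) i) => [le_i|lt_i].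
  by left; apply: div_order_vanish hf (div_order_le le_i oi).
right; apply: div_order_vanish hg (div_order_le _ oj).
by move: ij lt_i; rewrite /n; lia.
Qed.

End Prime.

Lemma diagonal_prime f g D E : f \is D.-homog -> g \is E.-homog ->
  tdivides q (f * g) -> tdivides q f \/ tdivides q g.
Proof.
have [x0 x0E] := @solve_monicpoly k d (fun i => if i == 0%N then - (a 2 / a 0) else 0) d0.
apply: (@diagonal_prime_aux x0).
rewrite x0E; case: d d0 => // n _; rewrite big_ord_recl /= big1 ?addr0 => [|i _].
  by rewrite expr0 mulr1 mulrN mulrCA divff // mulr1 addNr.
by rewrite mul0r.
Qed.

Lemma diagonal_neq0 : q != 0.
Proof.
apply/eqP => q0; have := diagonal_eval (vec3 1 0 0); rewrite q0 meval0 sum_I3 !ffunE /=.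
rewrite expr0n eqn0Ngt d0 /= !mulr0 !addr0 expr1n mulr1 => /esym/eqP.
by rewrite (negbTE (a0 0)).
Qed.

End Diagonal.

(** * Noether's theorem on diagonal curves *)

Section Noether.
Variable k : numClosedFieldType.
Variables (a : 'I_3 -> k) (d : nat).
Hypothesis a0 : forall i, a i != 0.
Hypothesis d1 : (1 < d)%N.
Implicit Types (f g h : {mpoly k[3]}) (P : ppoint k) (x z : k).

Let q := diagonal a d.
Let d0 : (0 < d)%N := ltnW d1.
Let hq : q \is d.-homog := diagonal_homog a d.

Lemma I3_cases (i j l m : 'I_3) : uniq [:: i; j; l] -> m = i \/ m = j \/ m = l.
Proof.
move=> u3; have : ~~ uniq [:: m; i; j; l].
  apply/negP => /card_uniqP; have := max_card (mem [:: m; i; j; l]).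
  by rewrite card_ord => /[swap] ->.
by rewrite cons_uniq u3 andbT negbK !inE => /or3P[]/eqP; auto.
Qed.

Lemma I3_sum (V : nmodType) (F : 'I_3 -> V) i j l : uniq [:: i; j; l] ->
  \sum_m F m = F i + F j + F l.
Proof.
move=> u3; have := u3; rewrite /= !inE negb_or => /and3P[/andP[ij il] jl _].
rewrite (bigD1 i) //= (bigD1 j) 1?eq_sym //= (bigD1 l) /=; last by rewrite !(eq_sym l) il jl.
rewrite big1 ?addr0 ?addrA // => m /andP[/andP[mi mj] ml].
by case: (I3_cases m u3) => [e|[e|e]]; rewrite e eqxx in mi mj ml.
Qed.

Lemma diagonal_two_nonzero P : on_curve q P ->
  exists i j l, [/\ uniq [:: i; j; l], P i != 0 & P j != 0].
Proof.
move=> [P0 qP]; rewrite diagonal_eval in qP.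
have [i Pi] : exists i, P i != 0.
  apply/existsP; apply: contraT; rewrite negb_exists => /forallP h.
  by case/eqP: P0; apply/ffunP => i; rewrite ffunE; apply/eqP; have := h i; rewrite negbK.
have [j [l u3]] : exists j l, uniq [:: i; j; l].
  elim/I3_ind: i {Pi}; [exists 1, 2 | exists 0, 2 | exists 0, 1]; by [].
have [Pj|Pj] := eqVneq (P j) 0; last by exists i, j, l.
have [Pl|Pl] := eqVneq (P l) 0; last first.
  exists i, l, j; split=> //; move: u3; rewrite /= !inE !negb_or andbT => /andP[/andP[ij il] jl].
  by rewrite il ij eq_sym jl.
move: qP; rewrite (I3_sum _ u3) Pj Pl expr0n eqn0Ngt d0 !mulr0 !addr0 => /eqP.
by rewrite mulf_eq0 (negbTE (a0 i)) expf_eq0 (negbTE Pi) andbF.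
Qed.

(** The line joining [P] to a vertex of the coordinate triangle. *)
Definition cross P j l : {mpoly k[3]} := (P j)%:MP * 'X_l - (P l)%:MP * 'X_j.

Lemma cross_homog P j l : cross P j l \is 1.-homog.
Proof. by rewrite /cross !mul_mpolyC; apply: rpredB; apply: rpredZ; apply: homog_var. Qed.

Lemma cross_eval P j l : (cross P j l).@[P] = 0.
Proof. by rewrite mevalB !mevalM !mevalC !mevalXU mulrC subrr. Qed.

(** As [P i] is not 0, neither is the partial derivative of [q] with respect to
['X_i] at [P]; so [cross P j i] can be eliminated and [cross P j l] is a
uniformizer.  The factor [S m] is the quotient of [X_m^d - (P_m r)^d] by
[X_m - P_m r]. *)
Lemma diagonal_chart P i j l : on_curve q P -> uniq [:: i; j; l] -> P i != 0 -> P j != 0 ->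
  local_chart q d P (cross P j l) (((P j)^-1)%:MP * 'X_j) (tdivides q).
Proof.
move=> [P0 qP] u3 Pi Pj; set r := _%:MP * 'X_j.
have := u3; rewrite /= !inE negb_or andbT => /andP[/andP[ij il] jl].
have hr : r \is 1.-homog by rewrite /r mul_mpolyC; apply/rpredZ/homog_var.
have rP : r.@[P] = 1 by rewrite mevalM mevalC mevalXU mulVf.
have Xj : 'X_j = (P j)%:MP * r.
  by rewrite /r mulrA -mpolyCM mulfV // mpolyC1 mul1r.
have Xm m : 'X_m - (P m)%:MP * r = ((P j)^-1)%:MP * cross P j m.
  have E1 : ((P j)^-1)%:MP * (P j)%:MP = 1 :> {mpoly k[3]} by rewrite -mpolyCM mulVf // mpolyC1.
  by rewrite /cross /r mulrBr [X in _ = X - _]mulrA E1; ring.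
pose S m : {mpoly k[3]} := \sum_(n < d) 'X_m ^+ (d.-1 - n) * ((P m)%:MP * r) ^+ n.
have XS m : 'X_m ^+ d - ((P m)%:MP * r) ^+ d = ((P j)^-1)%:MP * cross P j m * S m.
  by rewrite subrXX Xm.
have hS m : S m \is d.-1.-homog.
  apply: rpred_sum => n _.
  have h : (P m)%:MP * r \is 1.-homog by rewrite mul_mpolyC; apply: rpredZ.
  have := dhomogM (dhomogMn (d.-1 - n) (homog_var k m)) (dhomogMn n h).
  by rewrite !mul1n subnK // -ltnS prednK.
have SP m : (S m).@[P] = P m ^+ d.-1 *+ d.
  rewrite raddf_sum (eq_bigr (fun=> P m ^+ d.-1)) => [|n _] /=.
    by rewrite sumr_const card_ord.
  rewrite mevalM !rmorphXn /= mevalM mevalC mevalXU rP mulr1 -exprD subnK //.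
  by rewrite -ltnS prednK.
have qE : q = (((P j)^-1 * a l)%:MP * S l) * cross P j l + (((P j)^-1 * a i)%:MP * S i) * cross P j i.
  have q0 : \sum_m (a m)%:MP * ((P m)%:MP * r) ^+ d = 0 :> {mpoly k[3]}.
    transitivity ((\sum_m a m * P m ^+ d)%:MP * r ^+ d); last first.
      by rewrite -diagonal_eval qP mpolyC0 mul0r.
    rewrite rmorph_sum mulr_suml; apply: eq_bigr => m _ /=.
    by rewrite mpolyCM rmorphXn /= exprMn; ring.
  rewrite -[q]subr0 -q0 /q /diagonal -sumrB (I3_sum _ u3) -!mulrBr !XS.
  rewrite (_ : cross P j j = 0) ?mulr0 ?mul0r ?mulr0 ?addr0; last by rewrite /cross subrr.
  by rewrite !mpolyCM; ring.
split.
- exact: diagonal_homog.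
- exact: cross_homog.
- exact: hr.
- by rewrite rP oner_neq0.
- exact: cross_eval.
- exact: qP.
- exists (cross P j i), (((P j)^-1 * a l)%:MP * S l), (((P j)^-1 * a i)%:MP * S i), d.-1; split.
  + move=> D f; apply: (@vanishing_ideal2 _ P r) => m; rewrite Xm.
    case: (I3_cases m u3) => [->|[->|->]].
    * by exists 0, ((P j)^-1)%:MP; ring.
    * by exists 0, 0; rewrite /cross subrr; ring.
    * by exists ((P j)^-1)%:MP, 0; ring.
  + exact: qE.
  + by rewrite mul_mpolyC; apply/rpredZ/hS.
  + rewrite mevalM mevalC SP !mulf_neq0 ?invr_neq0 // -mulr_natr mulf_neq0 ?expf_neq0 //.
    by rewrite pnatr_eq0 -lt0n.
- by move=> c; exists c.
- pose s m := if m == l then (P l)%:MP * r else 'X_m.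
  have hs : restricts s (cross P j l).
    split.
      apply/eqP => /(congr1 (mcoeff U_(l)%MM)).
      rewrite mcoeffB !mcoeffCM !mcoeffXU eqxx (negbTE jl) mulr0 subr0 mulr1 mcoeff0 => /eqP.
      by rewrite (negbTE Pj).
    split.
      rewrite /cross rmorphB !rmorphM /= !substC !substX /s eqxx (negbTE jl) Xj; ring.
    move=> m; rewrite /s; case: eqP => [->|_]; last by rewrite subrr; apply: tdivides0.
    by rewrite Xm; exists ((P j)^-1)%:MP.
  move=> y; apply: (restricts_cancel hs).
  pose e : ppoint k := [ffun m => (m == i)%:R].
  apply: (restricts_diagonal a0 (i := i) (P := e) hs).
  rewrite (I3_sum _ u3) /s (negbTE il) (negbTE jl) eqxx /r !mevalM !mevalC !mevalXU !ffunE.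
  rewrite eqxx (eq_sym j) (negbTE ij) !mulr0 !expr0n !eqn0Ngt d0 /=.
  by rewrite !mulr0 !addr0 expr1n mulr1.
- by move=> y [c ->]; rewrite mevalM qP mulr0.
Qed.

Section Norm.
Variable w : k.
Hypothesis w_prim : d.-primitive_root w.

Definition rot1 n (i : 'I_3) : {mpoly k[3]} := if i == 1 then (w ^+ n)%:MP * 'X_1 else 'X_i.
Local Notation rot n := (subst (rot1 n)).

Lemma rot_homog n f D : f \is D.-homog -> rot n f \is D.-homog.
Proof.
apply: subst_homog => i; rewrite /rot1; case: ifP => _; last exact: homog_var.
by rewrite mul_mpolyC; apply/rpredZ/homog_var.
Qed.

Lemma rot_comp m n f : rot m (rot n f) = rot (m + n) f.
Proof.
elim/mpoly_ring_ind: f => [c|i|f h IHf IHh|f h IHf IHh].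
- by rewrite !substC.
- rewrite !substX /rot1; case: ifP => i1; last by rewrite substX /rot1 i1.
  by rewrite rmorphM /= substC substX /rot1 eqxx exprD mpolyCM; ring.
- by rewrite !rmorphD /= IHf IHh.
- by rewrite !rmorphM /= IHf IHh.
Qed.

Lemma rotd f : rot d f = f.
Proof.
elim/mpoly_ring_ind: f => [c|i|f h IHf IHh|f h IHf IHh].
- by rewrite !substC.
- rewrite !substX /rot1; case: eqP => [->|//].
  by rewrite (prim_expr_order w_prim) mpolyC1 mul1r.
- by rewrite !rmorphD /= IHf IHh.
- by rewrite !rmorphM /= IHf IHh.
Qed.

Lemma rot_diagonal n : rot n q = q.
Proof.
rewrite /q diagonal_subst sum_I3 /diagonal sum_I3 /rot1 /= exprMn -rmorphXn /=.
by rewrite -exprM mulnC exprM (prim_expr_order w_prim) expr1n mpolyC1 mul1r.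
Qed.

Lemma rot_dvd n f : (n <= d)%N -> tdivides q (rot n f) -> tdivides q f.
Proof.
move=> le_nd [c /(congr1 (subst (rot1 (d - n))))].
by rewrite rot_comp subnK // rotd rmorphM /= rot_diagonal => ->; exists (rot (d - n) c).
Qed.

Lemma rot_coef f m : (rot 1 f)@_m = w ^+ m 1 * f@_m.
Proof.
have E (r : seq 'X_{1..3}) (c : 'X_{1..3} -> k) :
    (rot 1 (\sum_(m' <- r) c m' *: 'X_[m']))@_m =
    w ^+ m 1 * (\sum_(m' <- r) c m' *: 'X_[m'])@_m; last first.
  by have := E (msupp f) (fun m' => f@_m'); rewrite -mpolyE.
rewrite rmorph_sum !linear_sum /= mulr_sumr; apply: eq_bigr => m' _.
rewrite -mul_mpolyC rmorphM /= substC !mcoeffCM.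
have -> : rot 1 'X_[m'] = (w ^+ m' 1)%:MP * 'X_[m'].
  rewrite /subst mmapX /mmap1 mpolyXE_id !big_ord_recl big_ord0 mulr1.
  rewrite (_ : lift ord0 ord0 = 1); last exact: val_inj.
  rewrite (_ : lift ord0 (lift ord0 ord0) = 2); last exact: val_inj.
  by rewrite /rot1 /= expr1 exprMn -rmorphXn /=; ring.
by rewrite mcoeffCM mcoeffX; case: eqP => [->|_]; rewrite ?mulr0 //; ring.
Qed.

(** Invariance leaves only powers of [X_1^d], which modulo [q] is a binary
form. *)
Lemma rot_invariant_binary f D : f \is D.-homog -> rot 1 f = f ->
  exists n, [/\ n \is D.-homog, binary n & tdivides q (f - n)].
Proof.
move=> hf fix_f.
pose W : {mpoly k[3]} := (- ((a 1)^-1))%:MP * ((a 0)%:MP * 'X_0 ^+ d + (a 2)%:MP * 'X_2 ^+ d).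
have E1 : ((a 1)^-1)%:MP * (a 1)%:MP = 1 :> {mpoly k[3]}.
  by rewrite -mpolyCM mulVf // mpolyC1.
have qW : tdivides q ('X_1 ^+ d - W).
  exists ((a 1)^-1)%:MP; rewrite /W mpolyCN /q /diagonal sum_I3 !mulrDr.
  by rewrite [X in _ = _ + X + _]mulrA E1; ring.
have hX i : ('X_i ^+ d : {mpoly k[3]}) \is d.-homog.
  by have := dhomogMn d (homog_var k i); rewrite mul1n.
have hW : W \is d.-homog.
  by rewrite /W !mul_mpolyC; apply: rpredZ; apply: rpredD; apply: rpredZ.
have bW : binary W.
  by rewrite /binary !(rmorphM, rmorphD) /= !substC !rmorphXn /= !substX.
pose n := \sum_(m <- msupp f) f@_m *: ('X_0 ^+ m 0 * W ^+ (m 1 %/ d) * 'X_2 ^+ m 2).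
have dm m : m \in msupp f -> (d %| m 1%R)%N.
  rewrite mcoeff_msupp => fm; rewrite (prim_order_dvd w_prim); apply/eqP.
  by apply: (mulIf fm); rewrite mul1r -rot_coef fix_f.
exists n; split.
- rewrite /n big_seq; apply: rpred_sum => m mm; apply: rpredZ.
  have mD : mdeg m = D by move/dhomogP: hf; apply.
  have := dhomogM (dhomogM (dhomogMn (m 0) (homog_var k 0)) (dhomogMn (m 1 %/ d) hW))
    (dhomogMn (m 2) (homog_var k 2)).
  by rewrite !mul1n [(d * _)%N]mulnC divnK ?dm // -mD mdegE sum_I3.
- rewrite /binary /n rmorph_sum; apply: eq_bigr => m _ /=.
  by rewrite -!mul_mpolyC !rmorphM /= substC !rmorphXn /= bW !substX.
- rewrite [f in f - n]mpolyE /n -sumrB big_seq.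
  apply: (big_ind (tdivides q)); [exact: tdivides0 | exact: tdividesD |] => m mm.
  rewrite -scalerBr -mul_mpolyC; apply: tdivides_mull.
  rewrite mpolyXE_id !big_ord_recl big_ord0 mulr1.
  rewrite (_ : lift ord0 ord0 = 1); last exact: val_inj.
  rewrite (_ : lift ord0 (lift ord0 ord0) = 2); last exact: val_inj.
  rewrite (_ : ord0 = 0); last exact: val_inj.
  have -> : 'X_1 ^+ m 1 = ('X_1 ^+ d) ^+ (m 1 %/ d) :> {mpoly k[3]}.
    by rewrite -exprM mulnC divnK ?dm.
  set p := (m 1%R %/ d)%N.
  have -> : 'X_0 ^+ m 0 * (('X_1 ^+ d) ^+ p * 'X_2 ^+ m 2) - 'X_0 ^+ m 0 * W ^+ p * 'X_2 ^+ m 2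
     = 'X_0 ^+ m 0 * 'X_2 ^+ m 2 * (('X_1 ^+ d) ^+ p - W ^+ p) :> {mpoly k[3]} by ring.
  by apply: tdivides_mull; rewrite subrXX mulrC; apply: tdivides_mull.
Qed.

Lemma prod_homog n (F : nat -> {mpoly k[3]}) D : (forall i, F i \is D.-homog) ->
  \prod_(i < n) F i \is (D * n).-homog.
Proof.
move=> hF; elim: n => [|n IH]; first by rewrite big_ord0 muln0; apply: dhomog1.
by rewrite big_ord_recr mulnS addnC; apply: dhomogM.
Qed.

(** The form [n] is the product of the conjugates of [b], and [b'] is the product
of all but [b].  It does not vanish on the curve because [q] is prime. *)
Lemma diagonal_norm b E : b \is E.-homog -> ~ tdivides q b ->
  exists n b' E', [/\ n \is (E' + E).-homog, binary n, n != 0, b' \is E'.-homog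
    & tdivides q (b' * b - n)].
Proof.
move=> hb qb; pose N := \prod_(i < d) rot i b.
have hN : N \is (E * d).-homog by apply: (@prod_homog d (fun i => rot i b) E) => i; apply: rot_homog.
have N1 : rot 1 N = N.
  rewrite /N rmorph_prod; under eq_bigr => i _ do rewrite /= rot_comp add1n.
  have := rotd b; case: d d0 => // p _ pb.
  rewrite [LHS]big_ord_recr [RHS]big_ord_recl /= pb mulrC; congr (_ * _).
  elim/mpoly_ring_ind: (b) => [c|i|f h IHf IHh|f h IHf IHh].
  - by rewrite !substC.
  - by rewrite !substX /rot1; case: eqP => [->|//]; rewrite expr0 mpolyC1 mul1r.
  - by rewrite !rmorphD /= {1}IHf {1}IHh.
  - by rewrite !rmorphM /= {1}IHf {1}IHh.
have qN : ~ tdivides q N.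
  suff : forall n, (n <= d)%N -> ~ tdivides q (\prod_(i < n) rot i b) by apply.
  elim=> [_|n IH lt_nd].
    rewrite big_ord0 -mpolyC1; case: (diagonal_not_unit a d1 1) => // /eqP.
    by rewrite oner_eq0.
  rewrite big_ord_recr /= => h.
  have hprod : \prod_(i < n) rot i b \is (E * n).-homog.
    by apply: (@prod_homog n (fun i => rot i b)) => i; apply: rot_homog.
  case: (diagonal_prime a0 d1 hprod (rot_homog n hb) h); first exact: IH (ltnW lt_nd).
  by move/(rot_dvd (ltnW lt_nd)).
have [n [hn bn nN]] := rot_invariant_binary hN N1.
exists n, (\prod_(i < d.-1) rot i.+1 b), (E * d.-1)%N; split=> //.
- by rewrite addnC -mulnS prednK.
- by apply: contra_not_neq qN => n0; rewrite -(subr0 N) -n0.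
- by apply: (@prod_homog d.-1 (fun i => rot i.+1 b) E) => i; apply: rot_homog.
- have {2}-> : b = rot 0 b.
    elim/mpoly_ring_ind: (b) => [c|i|f h IHf IHh|f h IHf IHh].
    + by rewrite !substC.
    + by rewrite !substX /rot1; case: eqP => [->|//]; rewrite expr0 mpolyC1 mul1r.
    + by rewrite !rmorphD /= -IHf -IHh.
    + by rewrite !rmorphM /= -IHf -IHh.
  move: nN; rewrite /N; case: d d0 => // p _ /=.
  by rewrite big_ord_recl mulrC.
Qed.

(** [f] lies in the ideal of [b] and [q] locally at [P]. *)
Definition locally_in b P f := exists s al be, s.@[P] != 0 /\ s * f = al * b + be * q.

(** Otherwise [Q] divided by its greatest common divisor with [f] has a root, and
the hypothesis fails there. *)
Lemma univ_local_dvd (Q f : {poly k}) : Q != 0 ->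
  (forall y, root Q y -> exists s be, s.[y] != 0 /\ s * f = be * Q) -> (Q %| f)%R.
Proof.
move=> Q0 h; pose g := gcdp Q f.
have g0 : g != 0 by rewrite gcdp_eq0 (negbTE Q0).
have /dvdpP [Q1 Q1E] : (g %| Q)%R by exact: dvdp_gcdl.
have /dvdpP [f1 f1E] : (g %| f)%R by exact: dvdp_gcdr.
have cop : coprimep Q1 f1.
  have := coprimep_div_gcd (p := Q) (q := f) ; rewrite Q0 /= => /(_ isT).
  by rewrite -/g {1}Q1E {1}f1E !mulpK.
have [Q1c|/closed_rootP [y Q1y]] := boolP (size Q1 == 1).
  rewrite f1E Q1E dvdp_mul2r //; case/size_poly1P: Q1c => c c0 ->.
  apply/dvdpP; exists ((c^-1)%:P * f1).
  by rewrite mulrAC -polyCM mulVf // mul1r.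
have Qy : root Q y by rewrite Q1E rootM Q1y.
have [s [be [sy sE]]] := h y Qy.
have : s * f1 = be * Q1.
  by apply: (mulIf g0); rewrite -mulrA -f1E sE Q1E mulrA.
move=> /(congr1 (fun p : {poly k} => p.[y])); rewrite !hornerM (rootP Q1y) mulr0 => /eqP.
rewrite mulf_eq0 (negbTE sy) /= => f1y.
by have := coprimep_root cop Q1y; rewrite f1y.
Qed.

(** On the line this is a statement about polynomials in one variable. *)
Lemma diagonal_local_line c f D : c != (0, 0) -> f \is D.-homog ->
  (forall P, on_curve q P -> locally_in (ptline c) P f) -> ideal2 (ptline c) q f.
Proof.
case: c => x z xz hf loc.
apply: (ptline_lift xz hq hf (size_diagonal_ptline_arc a0 d1 x z)).
apply: univ_local_dvd => [|y qy].
  by rewrite -size_poly_eq0 size_diagonal_ptline_arc.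
have P0 : vec3 x y z != 0.
  apply: contra xz => /eqP/ffunP E; have := E 0; have := E 2; rewrite !ffunE /= => -> ->.
  by rewrite eqxx.
have [|s [al [be [sP sE]]]] := loc (vec3 x y z).
  by split=> //; rewrite -ptline_arc_eval; apply/rootP.
exists (pull (ptline_arc x z) s), (pull (ptline_arc x z) be); rewrite ptline_arc_eval; split=> //.
by rewrite -!rmorphM /= sE rmorphD !rmorphM /= ptline_arc_form mulr0 add0r.
Qed.

(** The lines are divided out one at a time; they are not zero divisors modulo
[q], so the local condition passes to the quotient. *)
Lemma diagonal_local_lines (s : seq (k * k)) f D : all (fun c => c != (0, 0)) s ->
  f \is D.-homog ->
  (forall P, on_curve q P -> locally_in (\prod_(c <- s) ptline c) P f) ->
  ideal2 (\prod_(c <- s) ptline c) q f.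
Proof.
elim: s f D => [|c s IH] f D /=.
  by move=> _ _ _; rewrite big_nil; exists f, 0; ring.
case/andP=> c0 s0 hf loc; rewrite big_cons; set p := \prod_(c <- s) ptline c.
have /(ideal2_homog (homog_ptline c) hq hf) [f1 [f2 [fE hf1 _]]] :
    ideal2 (ptline c) q f.
  apply: (diagonal_local_line c0 hf) => P /loc [t [al [be [tP tE]]]].
  by exists t, (al * p), be; split=> //; rewrite tE big_cons -/p; ring.
have [|A [B f1E]] := IH _ _ s0 hf1.
  move=> P /loc [t [al [be [tP]]]]; rewrite big_cons -/p => tE.
  have [be' be'E] : tdivides q (t * f1 - al * p).
    apply: (diagonal_cancel_ptline a0 d1 c0); exists (be - t * f2).
    have -> : ptline c * (t * f1 - al * p) = t * f - t * f2 * q - al * (ptline c * p).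
      by rewrite fE; ring.
    by rewrite tE -/q; ring.
  by exists t, al, be'; split=> //; rewrite -be'E -/p; ring.
exists A, (B * ptline c + f2); rewrite fE f1E -/p; ring.
Qed.

(** Max Noether's theorem.  Multiplying by [b'] replaces [b] by its norm
[n = b' * b], a product of lines, for which [b' * f = A * n] modulo [q].  Then
[b' * (f - A * b)] vanishes on the curve, and [b'] does not. *)
Theorem diagonal_noether b f D E : b \is E.-homog -> ~ tdivides q b -> f \is D.-homog ->
  (forall P, on_curve q P -> locally_in b P f) -> ideal2 b q f.
Proof.
move=> hb qb hf loc.
have [n [b' [E' [hn bn n0 hb' [w' w'E]]]]] := diagonal_norm hb qb.
have nE : n = b' * b - w' * q by rewrite -w'E; ring.
have [c [s [c0 s0 nS]]] := binary_split hn bn n0.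
have : ideal2 n q (b' * f).
  have [|A [B bfE]] := diagonal_local_lines s0 (dhomogM hb' hf).
    move=> P /loc [t [al [be [tP tE]]]].
    exists t, (al * c%:MP), (be * b' + al * w'); split=> //.
    rewrite mulrCA tE -mulrA -nS nE; ring.
  exists (A * (c^-1)%:MP), B; rewrite bfE nS mulrA -(mulrA A) -mpolyCM mulVf // mpolyC1 mulr1.
  by [].
move=> /(ideal2_homog_strong hn hq (dhomogM hb' hf)) [A [B [bfE hA _ A0]]].
rewrite subnDl in hA; rewrite ltn_add2l in A0.
have qb' : ~ tdivides q b'.
  move=> [c' b'E]; have [] : tdivides q 1 -> False.
    by case: (diagonal_not_unit a d1 1) => [|/eqP]; [rewrite mpolyC1 | rewrite oner_eq0].
  apply: (diagonal_cancel_binary a0 d1 hn bn n0); rewrite mulr1 nE b'E.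
  by exists (c' * b - w'); rewrite -/q; ring.
have hAb : A * b \is D.-homog.
  case: (leqP E D) => [le_ED|/A0 ->]; last by rewrite mul0r; apply: dhomog0.
  by have := dhomogM hA hb; rewrite subnK.
have [|//|[c' c'E]] := diagonal_prime a0 d1 hb' (rpredB hf hAb).
  by exists (B - A * w'); rewrite -/q mulrBr bfE nE; ring.
by exists A, c'; rewrite -/q -[c' * q]c'E; ring.
Qed.

End Norm.
End Noether.

(** * The function field of a diagonal curve and its derivations *)

Lemma power_rule_step (E : comPzRingType) (u v w x X N : E) :
  u - (x * v + x * X * w) + x * (v - N * X * w) = u - (1 + N) * (x * X) * w.
Proof. ring. Qed.

Section FunctionField.
Variable k : numClosedFieldType.
Variables (a : 'I_3 -> k) (d : nat).
Hypothesis a0 : forall i, a i != 0.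
Hypothesis d1 : (1 < d)%N.
Implicit Types (f g h : {mpoly k[3]}) (P : ppoint k) (x y : ratfrac k).

Let q := diagonal a d.
Let d0 : (0 < d)%N := ltnW d1.
Let hq : q \is d.-homog := diagonal_homog a d.

Lemma diagonal_deg f D : f \is D.-homog -> (D < d)%N -> tdivides q f -> f = 0.
Proof.
move=> hf lt_Dd [c fE].
have [|A [B [E _ _ /(_ lt_Dd) A0]]] := ideal2_homog_strong hq (dhomog0 _ _ 0%N) hf.
  by exists c, 0; rewrite fE; ring.
by rewrite E A0; ring.
Qed.

Lemma diagonal_not_div f D : f \is D.-homog -> (D < d)%N -> f != 0 -> ~ tdivides q f.
Proof. by move=> hf lt_Dd /eqP f0 /(diagonal_deg hf lt_Dd). Qed.

(** Primality tests forms only; an arbitrary polynomial [h] is treated by its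
homogeneous components. *)
Lemma diagonal_cancel f D h : f \is D.-homog -> ~ tdivides q f ->
  tdivides q (f * h) -> tdivides q h.
Proof.
move=> hf qf [c cE].
rewrite (pihomog_partitionE (mf := [measure of mdeg]) (leqnn (msize h))).
apply: (big_ind (tdivides q)); [exact: tdivides0 | exact: tdividesD | move=> i _].
have [|//|//] := diagonal_prime a0 d1 hf (pihomogP [measure of mdeg] i h).
rewrite -(pihomogM _ _ hf) cE mulrC.
case: (leqP d (D + i)) => [le_d|lt_d]; last by rewrite (pihomogM_lt _ hq) //; apply: tdivides0.
by rewrite -(subnKC le_d) pihomogM //; exists (pihomog [measure of mdeg] (D + i - d) c); rewrite mulrC.
Qed.

Lemma diagonal_not_divM f g D E : f \is D.-homog -> g \is E.-homog ->
  ~ tdivides q f -> ~ tdivides q g -> ~ tdivides q (f * g).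
Proof. by move=> hf hg qf qg /(diagonal_prime a0 d1 hf hg) []. Qed.

Lemma not_div_neq0 f : ~ tdivides q f -> f != 0.
Proof. by apply: contra_not_neq => ->; apply: tdivides0. Qed.

Lemma ratfun_frac f g D : f \is D.-homog -> g \is D.-homog -> ~ tdivides q g ->
  ratfun q (frac f / frac g).
Proof.
move=> hf hg qg; exists f, g; split=> //; split=> //; first by exists D.
exact: not_div_neq0.
Qed.

Lemma ratfunD x y : ratfun q x -> ratfun q y -> ratfun q (x + y).
Proof.
move=> [f [g [[[D hf hg] g0 ->] qg]]] [f' [g' [[[D' hf' hg'] g0' ->] qg']]].
rewrite fracD //; apply: (@ratfun_frac _ _ (D + D')).
- by apply: rpredD; [|rewrite addnC]; apply: dhomogM.
- exact: dhomogM.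
- exact: diagonal_not_divM hg hg' qg qg'.
Qed.

Lemma ratfunM x y : ratfun q x -> ratfun q y -> ratfun q (x * y).
Proof.
move=> [f [g [[[D hf hg] g0 ->] qg]]] [f' [g' [[[D' hf' hg'] g0' ->] qg']]].
rewrite fracM; apply: (@ratfun_frac _ _ (D + D')); try exact: dhomogM.
exact: diagonal_not_divM hg hg' qg qg'.
Qed.

Lemma not_div1 : ~ tdivides q 1.
Proof.
by case: (diagonal_not_unit a d1 1) => [|/eqP]; [rewrite mpolyC1 | rewrite oner_eq0].
Qed.

Lemma ratfun_cst c : ratfun q (cst c).
Proof.
have := ratfun_frac (homog_const c) (dhomog1 _ _) not_div1.
by rewrite tofrac1 divr1.
Qed.

Lemma ratfunX x n : ratfun q x -> ratfun q (x ^+ n).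
Proof.
move=> rx; elim: n => [|n IH]; last by rewrite exprS; apply: ratfunM.
by rewrite expr0 -(rmorph1 (@cst k)); apply: ratfun_cst.
Qed.

Lemma vanishing_frac f g D : f \is D.-homog -> g \is D.-homog -> ~ tdivides q g ->
  tdivides q f -> vanishing q (frac f / frac g).
Proof.
move=> hf hg qg qf; exists f, g; split=> //; split=> //; first by exists D.
exact: not_div_neq0.
Qed.

Lemma vanishing0 : vanishing q 0.
Proof.
have := vanishing_frac (dhomog0 _ _ 0%N) (dhomog1 _ _) not_div1 (tdivides0 _).
by rewrite tofrac0 mul0r.
Qed.

Lemma vanishingD x y : vanishing q x -> vanishing q y -> vanishing q (x + y).
Proof.
move=> [f [g [[[D hf hg] g0 ->] qg qf]]] [f' [g' [[[D' hf' hg'] g0' ->] qg' qf']]].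
rewrite fracD //; apply: (@vanishing_frac _ _ (D + D')).
- by apply: rpredD; [|rewrite addnC]; apply: dhomogM.
- exact: dhomogM.
- exact: diagonal_not_divM hg hg' qg qg'.
- by apply: tdividesD; rewrite mulrC; apply: tdivides_mull.
Qed.

Lemma vanishingM x y : ratfun q x -> vanishing q y -> vanishing q (x * y).
Proof.
move=> [f [g [[[D hf hg] g0 ->] qg]]] [f' [g' [[[D' hf' hg'] g0' ->] qg' qf']]].
rewrite fracM; apply: (@vanishing_frac _ _ (D + D')); try exact: dhomogM.
  exact: diagonal_not_divM hg hg' qg qg'.
exact: tdivides_mull.
Qed.

Lemma vanishingN x : vanishing q x -> vanishing q (- x).
Proof.
by move=> vx; rewrite -mulN1r -(rmorph1 (@cst k)) -rmorphN; apply: vanishingM (ratfun_cst _) vx.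
Qed.

Lemma vanishingB x y : vanishing q x -> vanishing q y -> vanishing q (x - y).
Proof. by move=> vx vy; apply: vanishingD => //; apply: vanishingN. Qed.

Lemma vanishing_cst c : vanishing q (cst c) -> c = 0.
Proof.
move=> [f [g [[[D hf hg] g0 E] qg [h fE]]]]; apply/eqP; apply: contra_notT qg => c0.
have /eqP : frac (c%:MP * g) = frac f.
  by rewrite tofracM -[frac c%:MP]/(cst c) E divfK // frac_neq0.
rewrite tofrac_eq fE => /eqP gE; exists ((c^-1)%:MP * h).
by rewrite -mulrA -gE mulrA -mpolyCM mulVf // mpolyC1 mul1r.
Qed.

Section Derivation.
Variable delta : ratfrac k -> ratfrac k.
Hypothesis der : derivation q delta.

Let dR x : ratfun q x -> ratfun q (delta x). Proof. by case: der => + _ _ _ _; apply. Qed.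
Let dV x : vanishing q x -> vanishing q (delta x). Proof. by case: der => _ + _ _ _; apply. Qed.
Let dC c : vanishing q (delta (cst c)). Proof. by case: der => _ _ + _ _; apply. Qed.
Let dD x y : ratfun q x -> ratfun q y -> vanishing q (delta (x + y) - (delta x + delta y)).
Proof. by case: der => _ _ _ + _; apply. Qed.
Let dM x y : ratfun q x -> ratfun q y ->
  vanishing q (delta (x * y) - (x * delta y + y * delta x)).
Proof. by case: der => _ _ _ _; apply. Qed.

Lemma derivation_shift x c : ratfun q x -> vanishing q (delta (x + cst c) - delta x).
Proof.
move=> rx; have := vanishingD (dD rx (ratfun_cst c)) (dC c).
by rewrite opprD addrA subrK.
Qed.

Lemma derivation_scale x c : ratfun q x -> vanishing q (delta (cst c * x) - cst c * delta x).
Proof.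
move=> rx; have := vanishingD (dM (ratfun_cst c) rx) (vanishingM rx (dC c)).
by rewrite opprD addrA subrK.
Qed.

Lemma derivation_power x n : ratfun q x ->
  vanishing q (delta (x ^+ n.+1) - (n.+1)%:R * x ^+ n * delta x).
Proof.
move=> rx; elim: n => [|n IH].
  by rewrite expr1 expr0 !mul1r subrr; apply: vanishing0.
have := vanishingD (dM rx (ratfunX n.+1 rx)) (vanishingM rx IH).
rewrite -[x * x ^+ n.+1]exprS; set u := delta (x ^+ n.+2); set v := delta (x ^+ n.+1).
by rewrite [X in X * delta x]exprS power_rule_step -exprS [1 + _]addrC natr1.
Qed.

End Derivation.
End FunctionField.

(** The ratios below occur in computations with differentials, with [E] the field
of fractions of polynomials, [u], [v], [t] values of a derivation and
[X], [Y], [Z] coordinates.  [differential_change] passes from [dy] to [dz] by the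
relation [a1 * y^(d-1) dy + a2 * z^(d-1) dz = 0], [differential_invert] passes
from [dy] to [d(1/y)]. *)
(** * Adjoint curves cut out canonical divisors *)

Section DifferentialIdentities.
Variable E : fieldType.

Lemma dehomogenize_sum (c0 c1 c2 X Y Z : E) : X != 0 ->
  (c0 * X + c1 * Y + c2 * Z) / X = c1 * (Y / X) + c2 * (Z / X) + c0.
Proof. by move=> X0; field. Qed.

Lemma relation_scale (N A Y u B Z v : E) : N != 0 ->
  N^-1 * (A * (N * Y * u) + B * (N * Z * v)) = A * Y * u + B * Z * v.
Proof. by move=> N0; field. Qed.

Lemma differential_change (G X' a1 a2 Y Z u v : E) : X' != 0 -> Y != 0 -> Z != 0 ->
  a1 != 0 -> a2 != 0 ->
  G / (a2 * Z) * u - G / (- a1 * Y) * v =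
  (G * X') / (a1 * a2 * (Y * Z)) * (a1 * (Y / X') * u + a2 * (Z / X') * v).
Proof. by move=> X0 Y0 Z0 a10 a20; field; rewrite ?oppr_eq0 X0 Y0 Z0 a10 a20. Qed.

Lemma differential_invert (f A X Y u v t w : E) : X != 0 -> Y != 0 -> A != 0 ->
  w = f * Y ^+ 2 / (- A) ->
  f * X ^+ 2 / A * u - w * t =
  - w * (t - v) - w * (X / Y) * ((Y / X) * v + (X / Y) * u).
Proof. by move=> X0 Y0 A0 ->; field; rewrite ?oppr_eq0 X0 Y0 A0. Qed.

Lemma shifted_ratio (c x e y : E) : c != 0 -> y != 0 ->
  (c * x - e * y) / (c * y) = x / y + - (e / c).
Proof. by move=> c0 y0; field; rewrite c0 y0. Qed.

Lemma coefficient_split (G X' a1 a2 Y Z : E) : Y != 0 -> Z != 0 -> a1 != 0 -> a2 != 0 ->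
  (G * X') / (a1 * a2 * (Y * Z)) = G / (a1 * Y) * (X' / Z) * a2^-1.
Proof. by move=> Y0 Z0 a10 a20; field; rewrite Y0 Z0 a10 a20. Qed.

End DifferentialIdentities.

Section Theta.
Variable k : numClosedFieldType.
Variables (a : 'I_3 -> k) (d : nat).
Hypothesis a0 : forall i, a i != 0.
Hypothesis d2 : (2 < d)%N.
Implicit Types (f g h : {mpoly k[3]}) (P : ppoint k) (x y : ratfrac k).

Let q := diagonal a d.
Let d1 : (1 < d)%N := ltnW d2.
Let d0 : (0 < d)%N := ltnW d1.
Let hq : q \is d.-homog := diagonal_homog a d.

Lemma fracXn (f : {mpoly k[3]}) n : frac (f ^+ n) = frac f ^+ n :> ratfrac k.
Proof. exact: tofracXn. Qed.

Lemma var_neq0 i : 'X_i != 0 :> {mpoly k[3]}.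
Proof. by rewrite -msize_poly_eq0 msizeX. Qed.

Lemma frac_var_neq0 i : frac 'X_i != 0 :> ratfrac k.
Proof. by rewrite frac_neq0 // var_neq0. Qed.

Lemma homog_varX i n : 'X_i ^+ n \is [in k[3], n.-homog].
Proof. by have := dhomogMn n (homog_var k i); rewrite mul1n. Qed.

Lemma varX_not_div i n : (n < d)%N -> ~ tdivides q ('X_i ^+ n).
Proof.
move=> lt_nd; apply: (diagonal_not_div (homog_varX i n) lt_nd).
by rewrite expf_neq0 ?var_neq0.
Qed.

Lemma var_not_div i : ~ tdivides q 'X_i.
Proof. by have := @varX_not_div i 1 d1; rewrite expr1. Qed.

Lemma rat_order_frac P f g D i j : f \is D.-homog -> g \is D.-homog ->
  ~ tdivides q f -> ~ tdivides q g ->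
  intersection_mult f q P i -> intersection_mult g q P j ->
  rat_order q P (frac f / frac g) (i%:Z - j%:Z).
Proof.
move=> hf hg qf qg fi gj; exists f, g, i, j; split=> //.
by split=> //; [exists D | exact: not_div_neq0 qg].
Qed.

Lemma vanishing_congr x y : vanishing q (x - y) -> vanishing q x -> vanishing q y.
Proof.
by move=> h vx; have := vanishingB a0 d1 vx h; rewrite opprB addrCA subrr addr0.
Qed.

(** Apply [delta] to [a_0 + a_1 y^d + a_2 z^d = 0] and divide by [d]. *)
Lemma differential_relation delta : derivation q delta ->
  let y := frac 'X_1 / frac 'X_0 in let z := frac 'X_2 / frac 'X_0 in
  vanishing q (cst (a 1) * y ^+ d.-1 * delta y + cst (a 2) * z ^+ d.-1 * delta z).
Proof.
move=> der y z; have [dR dV dC dD dM] := der.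
have ry : ratfun q y by apply: ratfun_frac (homog_var k 1) (homog_var k 0) (@var_not_div 0).
have rz : ratfun q z by apply: ratfun_frac (homog_var k 2) (homog_var k 0) (@var_not_div 0).
have rc c : ratfun q (cst c) := ratfun_cst a d1 c.
pose A := cst (a 1) * y ^+ d; pose B := cst (a 2) * z ^+ d.
have rA : ratfun q A by apply: ratfunM => //; apply: ratfunX.
have rB : ratfun q B by apply: ratfunM => //; apply: ratfunX.
have vs : vanishing q (A + B + cst (a 0)).
  have -> : A + B + cst (a 0) = frac q / frac ('X_0 ^+ d).
    rewrite /q /diagonal sum_I3 !tofracD !tofracM !fracXn /A /B !expr_div_n.
    by rewrite dehomogenize_sum // expf_neq0 // frac_var_neq0.
  have X0d : ~ tdivides q ('X_0 ^+ d).
    have : ~ tdivides q ('X_0 ^+ d.-1 * 'X_0).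
      apply: (diagonal_not_divM a0 d1 (homog_varX 0 d.-1) (homog_var k 0)).
        by apply: varX_not_div; rewrite prednK.
      exact: var_not_div.
    by rewrite -exprSr prednK.
  by apply: (vanishing_frac hq (homog_varX 0 d)) => //; exists 1; rewrite mul1r.
have vAB : vanishing q (delta A + delta B).
  apply: vanishing_congr (dD _ _ rA rB) _.
  by apply: vanishing_congr (derivation_shift a0 d1 der (a 0) (ratfunD a0 d1 rA rB)) (dV _ vs).
have step c x : ratfun q x ->
    vanishing q (delta (cst c * x ^+ d) - cst c * (d%:R * x ^+ d.-1 * delta x)).
  move=> rx; have := derivation_power a0 d1 der d.-1 rx; rewrite prednK // => h.
  have := vanishingD a0 d1 (derivation_scale a0 d1 der c (ratfunX a0 d1 d rx)) (vanishingM a0 d1 (rc c) h).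
  by rewrite mulrBr addrA subrK.
have : vanishing q (cst (a 1) * (d%:R * y ^+ d.-1 * delta y) +
                    cst (a 2) * (d%:R * z ^+ d.-1 * delta z)).
  apply: vanishing_congr vAB.
  have := vanishingD a0 d1 (step (a 1) y ry) (step (a 2) z rz).
  by rewrite addrACA -opprD.
move=> /(vanishingM a0 d1 (rc (d%:R^-1))).
rewrite fmorphV rmorph_nat relation_scale // -(rmorph_nat (@cst k)) fmorph_eq0.
by rewrite pnatr_eq0 -lt0n.
Qed.

Lemma cross_fracE P j l : P j != 0 ->
  frac (cross P j l) / frac ((P j)%:MP * 'X_j) = frac 'X_l / frac 'X_j + cst (- (P l / P j)).
Proof.
move=> Pj; have Pj' : cst (P j) != 0 by rewrite fmorph_eq0.
rewrite (rmorphN (@cst k)) (rmorphM (@cst k)) (fmorphV (@cst k)) /cross tofracB !tofracM.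
by apply: shifted_ratio; rewrite ?frac_var_neq0.
Qed.

(** The function is the uniformizer of [diagonal_chart], written in affine
coordinates. *)
Lemma cross_order P i j l : on_curve q P -> uniq [:: i; j; l] -> P i != 0 -> P j != 0 ->
  rat_order q P (frac 'X_l / frac 'X_j + cst (- (P l / P j))) 1.
Proof.
move=> qP u3 Pi Pj; rewrite -cross_fracE // -[1]/(1%:Z - 0%:Z).
have lc := diagonal_chart a0 d1 qP u3 Pi Pj.
have h1 : (P j)%:MP * 'X_j \is [in k[3], 1.-homog].
  by rewrite mul_mpolyC; apply/rpredZ/homog_var.
have h1P : ((P j)%:MP * 'X_j).@[P] != 0.
  by rewrite mevalM mevalC mevalXU mulf_neq0.
apply: (rat_order_frac (cross_homog P j l) h1).
- apply: (diagonal_not_div (cross_homog P j l) d1).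
  apply/eqP => /(congr1 (mcoeff U_(l)%MM)).
  move: u3; rewrite /= !inE negb_or andbT => /andP[/andP[_ _] jl].
  rewrite mcoeffB !mcoeffCM !mcoeffXU eqxx (negbTE jl) mulr0 subr0 mulr1 mcoeff0 => /eqP.
  by rewrite (negbTE Pj).
- by apply: (diagonal_not_div h1 d1); apply: eval_neq0 h1P.
- apply: (intersection_mult_ord lc); exists 1, 1, 0, 0%N, 0%N.
  rewrite meval1 oner_neq0 !dhomog1; split=> //.
  by rewrite !mul1r mul0r addr0.
- exact: intersection_mult0 h1 h1P.
Qed.

Section Canonical.
Variable F : {mpoly k[3]}.
Variable n : ppoint k -> nat.
Hypothesis hF : F \is (d - 3).-homog.
Hypothesis F0 : F != 0.
Hypothesis nE : forall P, on_curve q P -> intersection_mult F q P (n P).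

Lemma tangent_form_not_div : ~ tdivides q F.
Proof. by apply: (diagonal_not_div hF _ F0); rewrite ltn_subrL d0. Qed.

Let den (c : k) i : {mpoly k[3]} := c%:MP * 'X_i ^+ d.-1.

Lemma den_homog c i : den c i \is d.-1.-homog.
Proof. by rewrite /den mul_mpolyC; apply/rpredZ/homog_varX. Qed.

Lemma den_not_div c i : c != 0 -> ~ tdivides q (den c i).
Proof.
move=> c0; apply: (diagonal_not_div (den_homog c i)); first by rewrite prednK.
by rewrite mulf_neq0 ?expf_neq0 ?var_neq0 // mpolyC_eq0.
Qed.

Lemma num_homog j : F * 'X_j ^+ 2 \is d.-1.-homog.
Proof.
have := dhomogM hF (homog_varX j 2); congr (_ \is _.-homog); lia.
Qed.

Lemma diff_order P i j c : on_curve q P -> c != 0 -> P i != 0 -> P j != 0 ->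
  rat_order q P (frac (F * 'X_j ^+ 2) / frac (den c i)) (n P).
Proof.
move=> qP c0 Pi Pj; have -> : (n P : int) = (n P)%:Z - 0%:Z by rewrite subr0.
apply: (rat_order_frac (num_homog j) (den_homog c i)).
- apply: (diagonal_not_divM a0 d1 hF (homog_varX j 2) tangent_form_not_div).
  exact: varX_not_div.
- exact: den_not_div.
- apply: (intersection_mult_unit (homog_varX j 2)); last exact: nE.
  by rewrite rmorphXn /= mevalXU expf_neq0.
- apply: (intersection_mult0 _ (den_homog c i)).
  by rewrite mevalM mevalC rmorphXn /= mevalXU mulf_neq0 ?expf_neq0.
Qed.

(** The differential [(F X_0^2 / (a_2 X_2^(d-1))) d(X_1/X_0)] also equals
[(F X_0^2 / (- a_1 X_1^(d-1))) d(X_2/X_0)] and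
[(F X_1^2 / (- a_2 X_2^(d-1))) d(X_0/X_1)].  At every point of the curve at
least two coordinates are nonzero, and then one of the three expressions has the
order of [F] as the order of its coefficient and the differential of a
uniformizer as its second factor. *)
Lemma diagonal_canonical : canonical_divisor q (fun P => (n P)%:Z).
Proof.
have rden j c i : c != 0 -> ratfun q (frac (F * 'X_j ^+ 2) / frac (den c i)).
  by move=> c0; apply: (ratfun_frac (num_homog j) (den_homog c i)); apply: den_not_div.
have rX l j : ratfun q (frac 'X_l / frac 'X_j).
  exact: ratfun_frac (homog_var k l) (homog_var k j) (@var_not_div j).
have frac_den c i : frac (den c i) = cst c * frac 'X_i ^+ d.-1 :> ratfrac k.
  by rewrite /den tofracM fracXn.
have Xd i : frac 'X_i ^+ d.-1 != 0 :> ratfrac k by rewrite expf_neq0 // frac_var_neq0.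
have cst0 i : cst (a i) != 0 by rewrite fmorph_eq0.
exists (frac (F * 'X_0 ^+ 2) / frac (den (a 2) 2)), (frac 'X_1 / frac 'X_0); split=> //.
  exact: rden.
move=> P qP; have [P0|P0] := eqVneq (P 0) 0; last first.
  have [P2|P2] := eqVneq (P 2) 0; last first.
    exists (frac (F * 'X_0 ^+ 2) / frac (den (a 2) 2)),
      (frac 'X_1 / frac 'X_0 + cst (- (P 1 / P 0))); split.
    - exact: (@cross_order P 2 0 1).
    - exact: diff_order.
    - move=> delta der; rewrite -mulrBr; apply: (vanishingM a0 d1); first exact: rden.
      have := vanishingN a0 d1 (derivation_shift a0 d1 der (- (P 1 / P 0)) (rX 1 0)).
      by rewrite opprB.
  have P1 : P 1 != 0.
    apply: contraTneq P0 => P1; have [_] := qP; rewrite diagonal_eval sum_I3 P1 P2.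
    rewrite expr0n eqn0Ngt d0 /= !mulr0 !addr0 => /eqP.
    by rewrite mulf_eq0 (negbTE (a0 0)) expf_eq0 d0 /= negbK.
  exists (frac (F * 'X_0 ^+ 2) / frac (den (- a 1) 1)),
      (frac 'X_2 / frac 'X_0 + cst (- (P 2 / P 0))); split.
  - exact: (@cross_order P 1 0 2).
  - by apply: diff_order; rewrite ?oppr_eq0.
  - move=> delta der; set w := _ / frac (den (- a 1) 1).
    have rw : ratfun q w by apply: rden; rewrite oppr_eq0.
    have := vanishingM a0 d1 rw (vanishingN a0 d1 (derivation_shift a0 d1 der (- (P 2 / P 0)) (rX 2 0))).
    rewrite opprB mulrBr; set t := _ + cst _ => vt.
    suff h : vanishing q (frac (F * 'X_0 ^+ 2) / frac (den (a 2) 2) * delta (frac 'X_1 / frac 'X_0)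
       - w * delta (frac 'X_2 / frac 'X_0)).
      by have := vanishingD a0 d1 h vt; rewrite addrA subrK.
    rewrite /w !frac_den (rmorphN (@cst k)).
    rewrite (@differential_change _ _ _ _ _ _ _ _ _ (Xd 0) (Xd 1) (Xd 2) (cst0 1) (cst0 2)).
    rewrite -!expr_div_n; apply: (vanishingM a0 d1); last exact: differential_relation.
    rewrite coefficient_split // -fmorphV -expr_div_n -frac_den.
    apply: (ratfunM a0 d1); last exact: ratfun_cst.
    by apply: (ratfunM a0 d1); [exact: rden | apply: ratfunX].
have [P1 P2] : P 1 != 0 /\ P 2 != 0.
  have [Pn0] := qP; rewrite diagonal_eval sum_I3 P0 expr0n eqn0Ngt d0 mulr0 add0r => E.
  have P12 : (P 1 == 0) = (P 2 == 0).
    apply/eqP/eqP => z; move: E; rewrite z expr0n eqn0Ngt d0 mulr0 ?add0r ?addr0 => /eqP;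
    by rewrite mulf_eq0 (negbTE (a0 _)) expf_eq0 d0 /= => /eqP.
  rewrite P12; suff -> : P 2 != 0 by [].
  apply: contra Pn0 => z; apply/eqP/ffunP; elim/I3_ind; rewrite ffunE //; apply/eqP => //.
  by rewrite P12.
exists (frac (F * 'X_1 ^+ 2) / frac (den (- a 2) 2)),
    (frac 'X_0 / frac 'X_1 + cst (- (P 0 / P 1))); split.
- exact: (@cross_order P 2 1 0).
- by apply: diff_order; rewrite ?oppr_eq0.
- move=> delta der; set w := _ / frac (den (- a 2) 2).
  have rw : ratfun q w by apply: rden; rewrite oppr_eq0.
  have r01 := rX 0 1; have r10 := rX 1 0.
  have vt := derivation_shift a0 d1 der (- (P 0 / P 1)) r01.
  have [_ _ dC _ dM] := der.
  have v1 : vanishing q (frac 'X_1 / frac 'X_0 * delta (frac 'X_0 / frac 'X_1) +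
                         frac 'X_0 / frac 'X_1 * delta (frac 'X_1 / frac 'X_0)).
    apply: vanishing_congr (dM _ _ r10 r01) _.
    rewrite mulf_div [X in X / _]mulrC divff ?mulf_neq0 ?frac_var_neq0 //.
    by rewrite -(rmorph1 (@cst k)); apply: dC.
  have wE : w = frac F * frac 'X_1 ^+ 2 / - (cst (a 2) * frac 'X_2 ^+ d.-1).
    by rewrite /w frac_den (rmorphN (@cst k)) mulNr tofracM fracXn.
  rewrite frac_den [frac (F * _)]tofracM fracXn.
  rewrite (@differential_invert _ _ _ _ _ _ (delta (frac 'X_0 / frac 'X_1)) _ _ _ _ _ wE)
    ?frac_var_neq0 ?mulf_neq0 //.
  apply: (vanishingB a0 d1).
    by rewrite mulNr; apply: (vanishingN a0 d1); apply: (vanishingM a0 d1).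
  by apply: (vanishingM a0 d1) => //; apply: (ratfunM a0 d1).
Qed.

End Canonical.
End Theta.

(** * Tangent rational curves cut odd theta characteristics *)

Lemma int_order_le (i j m : nat) : (0 <= i%:Z - j%:Z + m%:Z)%R -> (j <= i + m)%N.
Proof. lia. Qed.

Lemma order_split (i j m : nat) : (j <= i + m)%N -> (i + m * 2 = i + m - j + m + j)%N.
Proof. lia. Qed.

Lemma double_inj (m n : nat) : (m * 2 = n * 2)%N -> m = n.
Proof. lia. Qed.

Lemma natz_double (n : nat) : (n * 2)%:Z = n%:Z *+ 2.
Proof. by rewrite -mulr_natr; lia. Qed.

Lemma frac_cross_mul (E : fieldType) (x y z t : E) : y != 0 -> t != 0 -> x / y = z / t -> x * t = z * y.
Proof. by move=> y0 t0 /eqP; rewrite eqr_div // => /eqP. Qed.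

Section OddTheta.
Variable k : numClosedFieldType.
Variables (a : 'I_3 -> k) (d : nat).
Hypothesis a0 : forall i, a i != 0.
Hypothesis d2 : (2 < d)%N.
Variable w : k.
Hypothesis w_prim : d.-primitive_root w.
Implicit Types (f g h : {mpoly k[3]}) (P : ppoint k) (x y : ratfrac k).

Let q := diagonal a d.
Let d1 : (1 < d)%N := ltnW d2.
Let d0 : (0 < d)%N := ltnW d1.
Let hq : q \is d.-homog := diagonal_homog a d.

Variables (F : {mpoly k[3]}) (phi : 'I_3 -> {poly k}) (v : ppoint k).
Variables (c0 : k) (sigma : {poly k}).
Hypothesis rcF : rational_curve F (d - 3) phi v.
Hypothesis F0 : F != 0.
Hypothesis qv : q.@[v] != 0.
Hypothesis c0n : c0 != 0.
Hypothesis sigma0 : sigma != 0.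
Hypothesis qE : pull phi q = c0 *: sigma ^+ 2.
Hypothesis sizeF : forall h, h \is (d - 3).-homog -> (size (pull phi h) < size sigma)%N.
Hypothesis uniqF : forall h, h \is (d - 3).-homog -> pull phi h = 0 -> exists c, h = c%:MP * F.

Let hF := rc_homog rcF.
Let qF : ~ tdivides q F := tangent_form_not_div d2 hF F0.

Lemma tangent_mult P : on_curve q P -> exists m, intersection_mult F q P (m * 2).
Proof.
move=> [P0 qP]; have [FP|FP] := eqVneq F.@[P] 0.
  have [x [m [rho [b [_ _ _ _ h]]]]] := rc_square_mult rcF hq qv c0n sigma0 qE (conj P0 FP) qP.
  by exists m; apply: intersection_multC.
by exists 0%N; apply: intersection_mult0 hF FP.
Qed.

Lemma intersection_mult_uniq f g P m n :
  intersection_mult f g P m -> intersection_mult f g P n -> m = n.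
Proof.
move=> fm fn; apply/eqP; rewrite eqn_leq.
by rewrite (local_dim_le _ fn fm) // (local_dim_le _ fm fn).
Qed.

Section Delta.
Variable m : ppoint k -> nat.
Hypothesis mE : forall P, on_curve q P -> intersection_mult F q P (m P * 2).

Let Delta P : int := (m P)%:Z.

(** At [P] the order of [f / b] is at least [- m P] and that of [F] is [2 * m P];
so [f * F / b] has order at least [m P]. *)
Lemma riemann_roch_local f b D P : f \is D.-homog -> b \is D.-homog ->
  ~ tdivides q b -> on_curve q P ->
  (exists2 n : int, rat_order q P (frac f / frac b) n & 0 <= n + Delta P) ->
  exists s t e, [/\ s.@[P] != 0, t.@[P] = 0 & tdivides q (s * (f * F) - b * (e * t ^+ m P))].
Proof.
move=> hf hb qb qP [n [f' [b' [i [j [[[D' hf' hb'] b'0 E] [qf' qb'] fi bj ->]]]]] le0].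
have [i0 [j0 [l0 [u3 Pi Pj]]]] := diagonal_two_nonzero a0 d1 qP.
have lc := diagonal_chart a0 d1 qP u3 Pi Pj.
set t := cross P j0 l0 in lc.
have [s1 [s1' [be1 [e1 [e1' [[_ s1P] _ E1]]]]]] := ord_intersection_mult lc hf' fi.
have [s2 [s2' [be2 [e2 [e2' [_ [_ s2P] E2]]]]]] := ord_intersection_mult lc hb' bj.
have [s3 [s3' [be3 [e3 [e3' [[_ s3P] _ E3]]]]]] := ord_intersection_mult lc hF (mE qP).
have b0 := not_div_neq0 qb.
have fb : f * b' = f' * b.
  apply/eqP; rewrite -tofrac_eq !tofracM; apply/eqP.
  by apply: (frac_cross_mul _ _ E); rewrite frac_neq0.
have le_j : (j <= i + m P)%N by exact: int_order_le le0.
exists (s2' * s1 * s3), t, (s1' * s3' * s2 * t ^+ (i + m P - j)); split.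
- by rewrite !mevalM !mulf_neq0.
- exact: lc_tP lc.
- apply: (diagonal_cancel a0 d1 hb' qb').
  have tE : t ^+ i * t ^+ (m P * 2) = t ^+ (i + m P - j) * t ^+ m P * t ^+ j.
    by rewrite -!exprD; congr (_ ^+ _); apply: order_split.
  exists (b * (s2' * (be1 * (s3 * F) + s1' * t ^+ i * be3)
     - s1' * s3' * t ^+ (i + m P - j) * t ^+ m P * be2)).
  have -> : b' * (s2' * s1 * s3 * (f * F) - b * (s1' * s3' * s2 * t ^+ (i + m P - j) * t ^+ m P))
    = b * (s2' * (s1 * f') * (s3 * F) - s1' * s3' * t ^+ (i + m P - j) * t ^+ m P * (s2 * b')).
    transitivity (s2' * s1 * s3 * (f * b') * F
      - b * b' * (s1' * s3' * s2 * t ^+ (i + m P - j) * t ^+ m P)); first by ring.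
    by rewrite fb; ring.
  rewrite E1 E2 -/q; transitivity (b * (s2' * (s1' * s3' * (t ^+ i * t ^+ (m P * 2)) +
    (s1' * t ^+ i) * (s3 * F - s3' * t ^+ (m P * 2)) + be1 * q * (s3 * F))
     - s1' * s3' * t ^+ (i + m P - j) * t ^+ m P * (s2' * t ^+ j + be2 * q))); first by ring.
  by rewrite tE E3 -/q; ring.
Qed.

(** The core of the theorem: by Noether's theorem [f * F = c * b] modulo [q], and
[c] vanishes at the contact points to the orders prescribed by [Delta].  So
[sigma] divides the pull-back of [c], which has smaller degree. *)
Lemma riemann_roch_const f b D : f \is D.-homog -> b \is D.-homog ->
  ~ tdivides q b ->
  (forall P, on_curve q P ->
     exists2 n : int, rat_order q P (frac f / frac b) n & 0 <= n + Delta P) ->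
  exists c, tdivides q (f - c%:MP * b).
Proof.
move=> hf hb qb rr.
have loc P qP := riemann_roch_local hf hb qb qP (rr P qP).
have : ideal2 b q (f * F).
  apply: (diagonal_noether a0 d1 w_prim hb qb (dhomogM hf hF)) => P qP.
  have [s [t [e [sP _ [be E]]]]] := loc P qP.
  exists s, (e * t ^+ m P), be; split=> //; rewrite -/q -E; ring.
move=> /(ideal2_homog hb hq (dhomogM hf hF)) [c [B [cE hc _]]].
rewrite addnC addnK in hc.
have pc : pull phi c = 0.
  apply/eqP; apply: contraT => pc0.
  (* a nonzero multiple of sigma is too large *)
  suff /dvdp_leq : (sigma %| pull phi c)%R by move/(_ pc0); rewrite leqNgt sizeF.
  apply: univ_local_dvd => // y sy.
  pose P := arc_point phi y.
  have P0 : P != 0.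
    have [t [r [u [lc _ _]]]] := rc_chart rcF y.
    apply: contraNneq (lc_rP lc) => Pz.
    have [c' ->] := homog1_lin (lc_r lc); rewrite -/P Pz raddf_sum big1 //= => i _.
    by rewrite mevalM mevalXU ffunE mulr0.
  have qP : on_curve q P.
    split=> //; rewrite -pull_eval qE hornerZ horner_exp (rootP sy).
    by rewrite expr0n mulr0.
  have [mu [rho ry sE]] := multiplicity_XsubC sigma y.
  rewrite sigma0 /= in ry.
  have mmu : m P = mu.
    have h : intersection_mult q F P (mu * 2).
      apply: (arc_mult (rho := c0 *: rho ^+ 2)) hq _ _; first exact: rc_chart rcF y.
        by rewrite qE sE exprMn -exprM -scalerAr mulrC.
      by rewrite hornerZ horner_exp mulf_neq0 // expf_neq0.
    exact/double_inj/(intersection_mult_uniq (mE qP) (intersection_multC h)).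
  have [s [t [e [sP tP h]]]] := loc P qP.
  have [be scE] : tdivides q (s * c - e * t ^+ m P).
    apply: (diagonal_cancel a0 d1 hb qb).
    have -> : b * (s * c - e * t ^+ m P) = (s * (f * F) - b * (e * t ^+ m P)) - (s * B) * q.
      by rewrite cE; ring.
    by apply: tdividesB => //; exists (s * B).
  have /factor_theorem [t' tE] : root (pull phi t) y by apply/rootP; rewrite pull_eval.
  exists (pull phi s * rho), (pull phi e * t' ^+ mu + pull phi be * (c0 *: (rho * sigma))).
  split; first by rewrite hornerM pull_eval mulf_neq0.
  have /(congr1 (pull phi)) : s * c = e * t ^+ m P + be * q by rewrite -scE; ring.
  rewrite rmorphD !rmorphM rmorphXn /= qE tE mmu => E.
  rewrite mulrAC E exprMn -!mul_polyC.
  transitivity (pull phi e * t' ^+ mu * (rho * ('X - y%:P) ^+ mu) +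
    pull phi be * (c0%:P * (rho * sigma)) * sigma); first by ring.
  by rewrite -sE; ring.
have [la laE] := uniqF hc pc.
exists la; apply: (diagonal_cancel a0 d1 hF qF); exists B.
by rewrite mulrBr mulrC cE laE -/q; ring.
Qed.

Lemma h0_one : h0 q Delta 1.
Proof.
have n1 : ~ tdivides q 1 := not_div1 d1.
exists (fun=> 1); split=> [_|x [[f [b [[[D hf hb] b0 ->] qb]]] rr]].
  split; first by rewrite -(rmorph1 (@cst k)); apply: ratfun_cst.
  right=> P qP; exists 0 => //.
  have m1 : intersection_mult 1 q P 0.
    by apply: (intersection_mult0 _ (dhomog1 _ _)); rewrite meval1 oner_neq0.
  have := rat_order_frac (dhomog1 _ _) (dhomog1 _ _) n1 n1 m1 m1.
  by rewrite subrr tofrac1 divr1.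
have [c cE] : exists c, vanishing q (frac f / frac b - cst c).
  case: rr => [vx|rr]; first by exists 0; rewrite rmorph0 subr0.
  have [c qc] := riemann_roch_const hf hb qb rr; exists c.
  have -> : frac f / frac b - cst c = frac (f - c%:MP * b) / frac b.
    by rewrite tofracB tofracM mulrBl mulfK // frac_neq0.
  have hfc : f - c%:MP * b \is D.-homog.
    by apply: rpredB => //; rewrite mul_mpolyC; apply: rpredZ.
  exact: vanishing_frac hfc hb qb qc.
exists [ffun=> c]; split; first by rewrite big_ord1 ffunE mulr1.
move=> c'; rewrite big_ord1 mulr1 => c'E; apply/ffunP => i; rewrite (ord1 i) ffunE.
have := vanishingB a0 d1 c'E cE; rewrite opprB addrC addrA subrK -rmorphB.
by move=> /(vanishing_cst (c := _)) /eqP; rewrite subr_eq0 => /eqP.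
Qed.

End Delta.

(** The contact orders are chosen pointwise to form the divisor [Delta]. *)
Theorem tangent_cuts_odd_theta : cuts_odd_theta F q.
Proof.
have [m mE] : exists m : ppoint k -> nat, forall P, on_curve q P -> intersection_mult F q P (m P * 2).
  have : forall P, exists n, on_curve q P -> intersection_mult F q P (n * 2).
    move=> P; have [/tangent_mult [n h]|nP] := boolp.pselect (on_curve q P).
      by exists n.
    by exists 0%N.
  by case/boolp.choice => m; exists m.
exists (fun P => (m P)%:Z); split.
- move=> P qP; exists (m P * 2)%N; first exact: mE.
  exact: natz_double.
- have := diagonal_canonical a0 d2 hF F0 mE; congr canonical_divisor.
  by apply: boolp.funext => P; apply: natz_double.
- by exists 1%N => //; apply: h0_one.
Qed.

End OddTheta.

(** * Reduced curves and frames *)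

Section Reducedness.
Variable k : numClosedFieldType.
Implicit Types (f g h : {mpoly k[3]}) (P : ppoint k).

Lemma tdivides_trans g f h : tdivides g f -> tdivides f h -> tdivides g h.
Proof. by move=> [c ->] [c' ->]; exists (c' * c); rewrite mulrA. Qed.

Lemma tdivides_sum g (F : 'I_3 -> {mpoly k[3]}) :
  (forall i, tdivides g (F i)) -> tdivides g (\sum_i F i).
Proof.
by move=> gF; elim/big_ind: _ => // [|x y]; [exact: tdivides0 | exact: tdividesD].
Qed.

Lemma square_divides_deriv g f i : tdivides (g ^+ 2) f -> tdivides g (f^`M(i)).
Proof.
move=> [c ->]; exists (c^`M(i) * g + c * g^`M(i) *+ 2).
by rewrite expr2 !mderivM; ring.
Qed.

Lemma divides1_const g : tdivides g 1 -> exists c, g = c%:MP.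
Proof.
by move=> [h /esym/mpoly_intro_unit/andP[/eqP gE _]]; exists (g@_0%MM).
Qed.

(** Write [c X_i^(m+1) = h * g].  Either [h] vanishes on the line [X_i = 0] and a
factor can be cancelled, or [g] does, and then [X_i] divides a power of
[X_j]. *)
Lemma divides_powers_const g (i j : 'I_3) c c' m m' : i != j -> c != 0 -> c' != 0 ->
  tdivides g (c%:MP * 'X_i ^+ m) -> tdivides g (c'%:MP * 'X_j ^+ m') ->
  exists e, g = e%:MP.
Proof.
move=> ij c0 c'0 + gj; elim: m => [|m IH] gi.
  apply: divides1_const; apply: tdivides_trans gi _.
  by exists (c^-1)%:MP; rewrite expr0 mulr1 -mpolyCM mulVf.
pose s (l : 'I_3) : {mpoly k[3]} := if l == i then 0 else 'X_l.
have hs : restricts s 'X_i.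
  split; first by apply/eqP => /(congr1 (meval (fun=> 1))) /eqP; rewrite mevalXU meval0 oner_eq0.
  split; first by rewrite substX /s eqxx.
  by move=> l; rewrite /s; case: eqP => [->|_]; [exists 1; ring | rewrite subrr; apply: tdivides0].
case: gi => h hE; have : subst s h * subst s g = 0.
  by rewrite -rmorphM -hE rmorphM rmorphXn /= substX /s eqxx exprS mul0r mulr0.
move/eqP; rewrite mulf_eq0 => /orP[/eqP/(restricts_div hs) [h' h'E]|/eqP/(restricts_div hs) [g' gE]].
  apply: IH; exists h'; apply: (mulfI (hs.1)).
  have -> : 'X_i * (h' * g) = h * g by rewrite h'E; ring.
  by rewrite -hE exprS; ring.
case: gj => h' /(congr1 (meval (fun l => (l == j)%:R))) /eqP.
rewrite gE !mevalM rmorphXn /= !mevalXU mevalC (negbTE ij) eqxx expr1n !mulr0 mulr1.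
by rewrite (negbTE c'0).
Qed.

(** A double factor divides all partial derivatives. *)
Lemma reduced_curve d f : f != 0 -> f \is d.-homog ->
  (forall g, (forall i, tdivides g (f^`M(i))) -> exists c, g = c%:MP) -> plane_curve d f.
Proof.
by move=> f0 hf h; split=> // g gf; apply: h => i; apply: square_divides_deriv.
Qed.

Lemma diagonal_plane_curve (a : 'I_3 -> k) d : (forall i, a i != 0) -> (1 < d)%N ->
  plane_curve d (diagonal a d).
Proof.
move=> a0 d1; apply: reduced_curve; first exact: diagonal_neq0.
  exact: diagonal_homog.
have aN i : a i *+ d != 0 by rewrite -mulr_natr mulf_neq0 // pnatr_eq0 -lt0n ltnW.
move=> g gq; apply: (@divides_powers_const g 0 1 (a 0 *+ d) (a 1 *+ d) d.-1 d.-1) => //.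
  by rewrite -diagonal_mderiv.
by rewrite -diagonal_mderiv.
Qed.

Definition linear_form (c : 'I_3 -> k) : {mpoly k[3]} := \sum_i (c i)%:MP * 'X_i.

Lemma linear_form_homog c : linear_form c \is 1.-homog.
Proof.
by apply: rpred_sum => i _; rewrite mul_mpolyC; apply: rpredZ; apply: homog_var.
Qed.

Lemma linear_form_eval c (P : 'I_3 -> k) : (linear_form c).@[P] = \sum_i c i * P i.
Proof. by rewrite raddf_sum; apply: eq_bigr => i _; rewrite /= mevalM mevalC mevalXU. Qed.

Lemma linear_form_deriv c i : (linear_form c)^`M(i) = (c i)%:MP.
Proof.
rewrite raddf_sum /= (bigD1 i) //= big1 => [|j ji].
  rewrite addr0 mderiv_mulC mderivX mnm1E eqxx scale1r.
  by rewrite (_ : (U_(i) - U_(i))%MM = 0%MM) ?mpolyX0 ?mulr1 //; apply/mnmP => l; rewrite mnmBE subnn mnm0E.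
by rewrite mderiv_mulC mderivX mnm1E (negbTE ji) scale0r mulr0.
Qed.

(** One-sided inverses of square matrices are two-sided. *)
Lemma dual_frame (c : 'I_3 -> 'I_3 -> k) (N : 'I_3 -> ppoint k) :
  (forall i j, \sum_l c i l * N j l = (i == j)%:R) -> frame N (fun j => linear_form (c j)).
Proof.
move=> dual; split=> [j|i|i j]; [exact: linear_form_homog| |by rewrite linear_form_eval].
pose A := \matrix_(i, j) c i j; pose B := \matrix_(i, j) N j i.
have /mulmx1C BA : A *m B = 1%:M.
  by apply/matrixP => i' j'; rewrite !mxE -dual; apply: eq_bigr => l _; rewrite !mxE.
have BAE l : \sum_j N j i * c j l = (i == l)%:R.
  by have /matrixP/(_ i l) := BA; rewrite !mxE => <-; apply: eq_bigr => j _; rewrite !mxE.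
transitivity (\sum_j \sum_l (N j i * c j l)%:MP * 'X_l : {mpoly k[3]}); last first.
  by apply: eq_bigr => j _; rewrite mulr_sumr; apply: eq_bigr => l _; rewrite mpolyCM mulrA.
rewrite exchange_big /= (bigD1 i) //= -mulr_suml -raddf_sum /= BAE eqxx mul1r big1 ?addr0 // => l li.
by rewrite -mulr_suml -raddf_sum /= BAE eq_sym (negbTE li) mul0r.
Qed.

Lemma linear_form_polar c P : \sum_i (P i)%:MP * (linear_form c)^`M(i) = ((linear_form c).@[P])%:MP.
Proof.
rewrite linear_form_eval raddf_sum; apply: eq_bigr => i _.
by rewrite linear_form_deriv -mpolyCM mulrC.
Qed.

Section FrameCurves.
Variables (c : 'I_3 -> 'I_3 -> k) (N : 'I_3 -> ppoint k).
Let M j := linear_form (c j).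
Hypothesis fr : frame N M.

Lemma frame_polar j l : \sum_i (N l i)%:MP * (M j)^`M(i) = (j == l)%:R%:MP.
Proof. by rewrite linear_form_polar (fr_dual fr). Qed.

Lemma line_plane_curve : plane_curve 1 (M 2).
Proof.
apply: reduced_curve; last 2 first.
- exact: linear_form_homog.
- move=> g gM; apply: divides1_const.
  have := frame_polar 2 2; rewrite eqxx mpolyC1 => <-.
  by apply: tdivides_sum => i; apply: tdivides_mull.
apply/eqP => M0; have := fr_dual fr 2 2; rewrite M0 meval0 eqxx => /esym/eqP.
by rewrite oner_eq0.
Qed.

(** The derivatives of the conic in the directions [N l] are the forms [M j] up
to constants, and these generate all linear forms. *)
Lemma frame_conic_plane_curve : plane_curve 2 (frame_conic M).
Proof.
have hM := fr_homog fr.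
apply: reduced_curve.
- apply/eqP => F0; have := congr1 (meval (N 1)) F0.
  rewrite /frame_conic mevalB rmorphXn mevalM /= !(fr_dual fr) eqxx /= meval0 mulr0 subr0 expr1n.
  by move/eqP; rewrite oner_eq0.
- by apply: rpredB; [have := dhomogMn 2 (hM 1) | have := dhomogM (hM 0) (hM 2)].
move=> g gF.
have polarF l : \sum_i (N l i)%:MP * (frame_conic M)^`M(i) =
    (1 == l)%:R%:MP * M 1 *+ 2 - ((0 == l)%:R%:MP * M 2 + (2 == l)%:R%:MP * M 0).
  rewrite -!frame_polar !mulr_suml -sumrMnl -big_split -sumrB /=.
  apply: eq_bigr => i _; rewrite /frame_conic expr2 mderivB !mderivM; ring.
have gN l : tdivides g (\sum_i (N l i)%:MP * (frame_conic M)^`M(i)).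
  by apply: tdivides_sum => i; apply: tdivides_mull.
have gM : forall j, tdivides g (M j).
  elim/I3_ind.
  - have := gN 2; rewrite polarF /= mpolyC0 mpolyC1.
    by move=> /tdividesN; congr tdivides; ring.
  - have := gN 1; rewrite polarF /= mpolyC0 mpolyC1 => /(tdivides_mull (2^-1)%:MP).
    congr tdivides; set m := M 1.
    rewrite (_ : _ - _ = 2%:MP * m); last by rewrite (rmorph_nat (@mpolyC 3 k)); ring.
    by rewrite mulrA -mpolyCM mulVf ?pnatr_eq0 // mpolyC1 mul1r.
  - have := gN 0; rewrite polarF /= mpolyC0 mpolyC1.
    by move=> /tdividesN; congr tdivides; ring.
have gX i : tdivides g 'X_i.
  by rewrite (fr_var fr); apply: tdivides_sum => j; apply: tdivides_mull.
apply: (@divides_powers_const g 0 1 1 1 1 1); rewrite ?oner_eq0 ?mpolyC1 ?mul1r ?expr1 //.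
Qed.

End FrameCurves.
End Reducedness.

Section FrameForms.
Variable k : numClosedFieldType.
Implicit Types (f g h : {mpoly k[3]}) (P : ppoint k).

(** The polynomial [X^n - 1] is separable, so it has [n] roots. *)
Lemma prim_root_exists n : (0 < n)%N -> exists z : k, n.-primitive_root z.
Proof.
move=> n0; have [r rE] := closed_field_poly_normal ('X^n - 1 : {poly k}).
rewrite (monicP (monicXnsubC 1 n0)) scale1r in rE.
have r1 : all n.-unity_root r by apply/allP => z; rewrite -root_prod_XsubC -rE.
have ur : uniq r by rewrite -separable_prod_XsubC -rE separable_Xn_sub_1 // pnatr_eq0 -lt0n.
have sr : (n <= size r)%N by rewrite -ltnS -(size_prod_XsubC r id) -rE size_XnsubC.
by have /hasP [z _ zn] := has_prim_root n0 r1 ur sr; exists z.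
Qed.

Variables (N : 'I_3 -> ppoint k) (M : 'I_3 -> {mpoly k[3]}).
Hypothesis fr : frame N M.

Lemma frame_expand h : h \is 1.-homog -> h = \sum_j (h.@[N j])%:MP * M j.
Proof.
move=> /homog1_lin [c ->].
transitivity (\sum_i \sum_j (c i * N j i)%:MP * M j).
  apply: eq_bigr => i _; rewrite (fr_var fr) mulr_sumr; apply: eq_bigr => j _.
  by rewrite mpolyCM mulrA.
rewrite exchange_big; apply: eq_bigr => j _; rewrite -mulr_suml; congr (_ * _).
rewrite -raddf_sum /=; congr (_ %:MP); rewrite raddf_sum; apply: eq_bigr => i _ /=.
by rewrite mevalM mevalC mevalXU.
Qed.

Lemma line_unique h : h \is 1.-homog -> pull (quad_arc (N 0) (N 1) (fun=> 0)) h = 0 ->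
  exists c, h = c%:MP * M 2.
Proof.
move=> hh; rewrite (pull_quad_arc _ _ _ hh) => E; exists h.@[N 2].
have e0 : h.@[N 0] = 0.
  have := congr1 (fun p : {poly k} => p`_0) E.
  by rewrite !coefE /= !(mulr0, mul0r, addr0).
have e1 : h.@[N 1] = 0.
  have := congr1 (fun p : {poly k} => p`_1) E.
  by rewrite !coefE /= !(mulr0, mul0r, addr0, add0r, mulr1).
by rewrite [LHS](frame_expand hh) sum_I3 e0 e1 mpolyC0 !mul0r !add0r.
Qed.

(** Since [h] vanishes at [N 0], it is [f1 * M 1 + f2 * M 2] with linear forms
[f1] and [f2], and the coefficients of its pull-back determine these up to one
constant. *)
Lemma conic_unique h : h \is 2.-homog -> pull (quad_arc (N 0) (N 1) (N 2)) h = 0 ->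
  exists c, h = c%:MP * frame_conic M.
Proof.
move=> hh E; have hM := fr_homog fr.
have h0 : h.@[N 0] = 0.
  have := congr1 (fun p => p.[0]) E; rewrite pull_eval horner0 => <-.
  by apply: meval_eq => i; rewrite ffunE /quad_arc !hornerE /= !mulr0 addr0.
have /(ideal2_homog (hM 1) (hM 2) hh) [f1 [f2 [hE hf1 hf2]]] : ideal2 (M 1) (M 2) h.
  apply: (@vanishing_ideal2 k (N 0) (M 0) (M 1) (M 2) h 2 _ hh h0) => i.
  by exists (N 1 i)%:MP, (N 2 i)%:MP; rewrite (fr_var fr) sum_I3; ring.
have phiM j : pull (quad_arc (N 0) (N 1) (N 2)) (M j) = (j == 0)%:R%:P + (j == 1)%:R%:P * 'X + (j == 2)%:R%:P * 'X^2.
  by rewrite pull_quad_arc // !(fr_dual fr).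
have fE f : f \is 1.-homog -> exists a b c, f = a%:MP * M 0 + b%:MP * M 1 + c%:MP * M 2.
  by move=> hf; rewrite (frame_expand hf) sum_I3; do 3 eexists.
have [a [b [c f1E]]] := fE _ hf1; have [a' [b' [c' f2E]]] := fE _ hf2.
move: E; rewrite hE f1E f2E !(rmorphD, rmorphM) /= !pullC !phiM /= => E.
have cE : a%:P * 'X + (b + a')%:P * 'X^2 + (c + b')%:P * 'X^3 + c'%:P * 'X^4 = 0.
  by rewrite -E; ring.
have coefE0 n : (a%:P * 'X + (b + a')%:P * 'X^2 + (c + b')%:P * 'X^3 + c'%:P * 'X^4)`_n = 0.
  by rewrite cE coef0.
have := coefE0 1%N; have := coefE0 2; have := coefE0 3; have := coefE0 4.
rewrite !coefE /= !(mulr0, mulr1, addr0, add0r) => c'0 /eqP; rewrite addr_eq0 => /eqP cb.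
move=> /eqP; rewrite addr_eq0 => /eqP ba a0.
exists b; rewrite a0 c'0 cb (_ : a' = - b) ?mpolyCN ?mpolyC0; first by rewrite /frame_conic; ring.
by rewrite ba opprK.
Qed.

(** The gradient of [f] at a point of tangency is proportional to the equation of
the tangent line.  Write [f = f1 * t + f2 * M 2] with [t] vanishing at [P]; the
restriction of [f] to the line has a double zero at [P], so [f1] vanishes
there. *)
Lemma line_contact_gradient f e c sigma P : f \is e.-homog -> f.@[N 1] != 0 ->
  pull (quad_arc (N 0) (N 1) (fun=> 0)) f = c *: sigma ^+ 2 ->
  on_curve (M 2) P -> f.@[P] = 0 -> c != 0 ->
  exists l, forall i, (f^`M(i)).@[P] = l * ((M 2)^`M(i)).@[P].
Proof.
set phi := quad_arc _ _ _ => hf fN pE [P0 M2P] fP c0.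
have hM := fr_homog fr.
have p0 : (M 0).@[P] != 0.
  apply: contraTneq fN => p0; rewrite negbK.
  have PE i : P i = (M 1).@[P] * N 1 i by rewrite (frame_eval fr) p0 M2P; ring.
  move: fP; rewrite (meval_homogZ hf PE) => /eqP; rewrite mulf_eq0 => /orP[|//].
  rewrite expf_eq0 => /andP[_ /eqP p1]; case/eqP: P0; apply/ffunP => i.
  by rewrite PE p1 mul0r ffunE.
set x := (M 1).@[P] / (M 0).@[P]; pose t := M 1 - x%:MP * M 0.
have /(vanishing_ideal2 (t := t) (u := M 2)) h : forall i, ideal2 t (M 2) ('X_i - (P i)%:MP * ((M 0).@[P]^-1%:MP * M 0)).
  move=> i; exists (N 1 i)%:MP, (N 2 i)%:MP; rewrite (fr_var fr) sum_I3 {1}(frame_eval fr i P) M2P.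
  rewrite mulrA -mpolyCM (_ : _ * _^-1 = N 0 i + N 1 i * x); last by rewrite /x; field.
  by rewrite /t mpolyCD mpolyCM; ring.
have ht : t \is 1.-homog by rewrite /t mul_mpolyC; apply: rpredB; [|apply: rpredZ].
have [f1 [f2 [fE hf1 _]]] := ideal2_homog ht (hM 2) hf (h _ _ hf fP).
have tP : t.@[P] = 0 by rewrite mevalB mevalM mevalC /x divfK // subrr.
have phiM j : pull phi (M j) = (j == 0)%:R%:P + (j == 1)%:R%:P * 'X.
  rewrite pull_quad_arc; last exact: fr_homog fr j.
  rewrite !(fr_dual fr) (_ : (M j).@[fun=> 0] = 0) ?mul0r ?addr0 //.
  have [d ->] := homog1_lin (fr_homog fr j); rewrite raddf_sum big1 //= => i _.
  by rewrite mevalM mevalXU mulr0.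
have f1x : (pull phi f1).[x] = 0.
  have tE : pull phi t = 'X - x%:P.
    by rewrite rmorphB rmorphM /= pullC !phiM /=; ring.
  have M2E : pull phi (M 2) = 0 by rewrite phiM /=; ring.
  move: pE; rewrite fE rmorphD !rmorphM /= tE M2E mulr0 addr0 => pE.
  have /factor_theorem [s sE] : root sigma x.
    have := congr1 (fun p => p.[x]) pE; rewrite hornerM hornerXsubC subrr mulr0 hornerZ horner_exp.
    by move/esym/eqP; rewrite mulf_eq0 (negbTE c0) expf_eq0.
  have : pull phi f1 = c *: (s ^+ 2 * ('X - x%:P)).
    have /mulIf : 'X - x%:P != 0 by rewrite polyXsubC_eq0.
    by apply; rewrite pE sE -!mul_polyC; ring.
  by move=> ->; rewrite hornerZ hornerM hornerXsubC subrr !mulr0.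
have PE i : P i = (M 0).@[P] * arc_point phi x i.
  rewrite (frame_eval fr) M2P ffunE /phi /quad_arc !(hornerD, hornerM, hornerC, hornerX, hornerXn) /x; field; exact: p0.
have f1P : f1.@[P] = 0 by rewrite (meval_homogZ hf1 PE) -pull_eval f1x mulr0.
exists f2.@[P] => i; rewrite fE mderivD !mderivM !mevalD !mevalM tP f1P M2P.
by rewrite mulr0 mul0r !add0r mulr0 add0r.
Qed.
End FrameForms.

(** * The quartic and its seven lines *)

Section Quartic.
Variable k : numClosedFieldType.
Implicit Types (f g h : {mpoly k[3]}) (P : ppoint k).

Definition triple (T : Type) (x y z : T) (i : 'I_3) : T :=
  if i == 0 then x else if i == 1 then y else z.

Lemma mderivXi i j : ('X_j : {mpoly k[3]})^`M(i) = (j == i)%:R%:MP.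
Proof.
rewrite mderivX mnm1E; case: eqP => [->|_]; last by rewrite scale0r mpolyC0.
by rewrite scale1r (_ : (U_(i) - U_(i))%MM = 0%MM) ?mpolyX0 ?mpolyC1 //; apply/mnmP => l; rewrite mnmBE subnn mnm0E.
Qed.

Variable u : k.
Hypothesis u4 : u ^+ 4 = -1.

Definition quartic : {mpoly k[3]} := diagonal (fun=> 1) 4.

(** With [u] a primitive eighth root of unity this conic touches each of the lines
[x X + y Y + Z] with [x^4 = 1] and [y = x^3], with [x^2 = u^2] and [y = 0], and
with [x = 0] and [y = u^3]. *)
Definition bitangent_conic : {mpoly k[3]} :=
  (- 4 * u ^+ 2)%:MP * 'X_0 ^+ 2 + 4%:MP * ('X_0 * 'X_1)
  + (4 * u ^+ 2)%:MP * 'X_1 ^+ 2 + 3%:MP * 'X_2 ^+ 2.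
Let r := quartic.
Let b := bitangent_conic.

Lemma bitangent_conic_homog : b \is 2.-homog.
Proof.
have hX i : ('X_i ^+ 2 : {mpoly k[3]}) \is 2.-homog by have := dhomogMn 2 (homog_var k i).
have h01 : ('X_0 * 'X_1 : {mpoly k[3]}) \is 2.-homog by exact: dhomogM (homog_var _ _) (homog_var _ _).
have hZ (c : k) f : f \is 2.-homog -> c *: f \is 2.-homog by apply: rpredZ.
by rewrite /b /bitangent_conic !mul_mpolyC; rewrite !rpredD ?hZ.
Qed.

Lemma bitangent_conic_eval (P : 'I_3 -> k) :
  b.@[P] = - 4 * u ^+ 2 * P 0 ^+ 2 + 4 * (P 0 * P 1) + 4 * u ^+ 2 * P 1 ^+ 2 + 3 * P 2 ^+ 2.
Proof. by rewrite /b /bitangent_conic !expr2 !(mevalD, mevalM, mevalC, mevalXU); ring. Qed.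

Lemma bitangent_conic_pull (phi : 'I_3 -> {poly k}) :
  pull phi b = (- 4 * u ^+ 2)%:P * phi 0 ^+ 2 + 4%:P * (phi 0 * phi 1)
    + (4 * u ^+ 2)%:P * phi 1 ^+ 2 + 3%:P * phi 2 ^+ 2.
Proof.
by rewrite /b /bitangent_conic !(rmorphD, rmorphM, rmorphXn) /= !(pullC, pullX); ring.
Qed.

Lemma bitangent_conic_derivs :
  b^`M(0) = (- 8 * u ^+ 2)%:MP * 'X_0 + 4%:MP * 'X_1 /\
  b^`M(1) = 4%:MP * 'X_0 + (8 * u ^+ 2)%:MP * 'X_1 /\
  b^`M(2) = 6%:MP * 'X_2.
Proof.
rewrite /b /bitangent_conic !expr2 !mderivD !mderiv_mulC !mderivM !mderivXi /= !mpolyC0 !mpolyC1.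
by split; [|split]; ring.
Qed.

Lemma bitangent_conic_plane_curve : plane_curve 2 b.
Proof.
have [dX [dY dZ]] := bitangent_conic_derivs.
have u4' : (u%:MP : {mpoly k[3]}) ^+ 4 = -1 by rewrite -rmorphXn /= u4 rmorphN /= mpolyC1.
apply: reduced_curve; last 2 first; first exact: bitangent_conic_homog.
- move=> g gb; apply: (@divides_powers_const _ g 0 1 12 12 1 1); rewrite ?pnatr_eq0 //.
    rewrite (_ : _ * _ = (2 * u ^+ 2)%:MP * b^`M(0) - b^`M(1)).
      by apply: tdividesB => //; apply: tdivides_mull.
    by rewrite dX dY; ring: u4'.
  rewrite (_ : _ * _ = - (b^`M(0) + (2 * u ^+ 2)%:MP * b^`M(1))).
    by apply: tdividesN; apply: tdividesD => //; apply: tdivides_mull.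
  by rewrite dX dY; ring: u4'.
apply/eqP => b0; have := congr1 (meval (vec3 0 0 1)) b0.
rewrite bitangent_conic_eval !ffunE /= meval0.
rewrite !(expr0n, mulr0, mul0r, add0r, expr1n, mulr1) => /eqP.
by rewrite pnatr_eq0.
Qed.

Lemma bitangent_conic_smooth : smooth b.
Proof.
move=> P [P0 _]; have [dX [dY dZ]] := bitangent_conic_derivs.
apply: boolp.contrapT => h.
have E i : (b^`M(i)).@[P] = 0.
  by apply/eqP/negPn/negP => bi; apply: h; exists i.
have E0 := E 0; have E1 := E 1; have E2 := E 2.
rewrite dX dY dZ !(mevalD, mevalM, mevalC, mevalXU) in E0 E1 E2.
case/eqP: P0; have n0 (n : nat) (x : k) : n.+1%:R * x = 0 -> x = 0.
  by move/eqP; rewrite mulf_eq0 pnatr_eq0 => /eqP.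
apply/ffunP; elim/I3_ind; rewrite ffunE.
- apply: (n0 11); transitivity (2 * u ^+ 2 * 0 - 0 : k); last by ring.
  by rewrite -{1}E0 -E1; ring: u4.
- apply: (n0 11); transitivity (- (0 + 2 * u ^+ 2 * 0) : k); last by ring.
  by rewrite -{1}E0 -E1; ring: u4.
- exact: (n0 5).
Qed.

Lemma size_monic_quad (a c : k) : size ('X^2 + a%:P * 'X + c%:P) = 3.
Proof.
rewrite -addrA size_polyDl size_polyXn //.
apply: (leq_ltn_trans (size_polyD _ _)); rewrite gtn_max !ltnS.
rewrite (leq_trans (size_polyMleq _ _)) /= ?(leq_trans (size_polyC_leq1 _)) //.
by rewrite size_polyX addn2 /= ltnS size_polyC_leq1.
Qed.

Lemma affine_neq0 (c : k) : 2%:P * 'X + c%:P != 0.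
Proof.
apply/eqP => /(congr1 (fun p : {poly k} => p`_1)) /eqP; rewrite !coefE /= mulr1 addr0.
by rewrite pnatr_eq0.
Qed.

(** A parametrized line [c] on which the quartic and the conic restrict to
constants times squares of [sr] and [sb], and on which these have no common
root. *)
Record contact_line (c : 'I_3 -> k) N m (ar : k) sr (ab : k) sb : Prop := ContactLine {
  cl_frame : frame N (fun j => linear_form (m j));
  cl_form : m 2 = c;
  cl_r : pull (quad_arc (N 0) (N 1) (fun=> 0)) r = ar *: sr ^+ 2;
  cl_b : pull (quad_arc (N 0) (N 1) (fun=> 0)) b = ab *: sb ^+ 2;
  cl_ar : ar != 0;
  cl_ab : ab != 0;
  cl_sr : size sr = 3;
  cl_sb : sb != 0;
  cl_rN : r.@[N 1] != 0;
  cl_bN : b.@[N 1] != 0;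
  cl_disj : forall x, sr.[x] = 0 -> sb.[x] != 0 }.

Definition line_coefs (x y : k) := triple x y 1.

(** On this line the quartic restricts to [(1 + t)^4 + t^4 + 1], which is
[2 (t^2 + t + 1)^2]. *)
Lemma bitangent_line x : x ^+ 4 = 1 -> exists N m ar sr ab sb, contact_line (line_coefs x (x ^+ 3)) N m ar sr ab sb.
Proof.
move=> x4; have x0 : x != 0.
  by apply/eqP => x0; move/eqP: x4; rewrite x0 expr0n eq_sym oner_eq0.
pose N := triple (vec3 (- x ^+ 3) 0 1) (vec3 (- x ^+ 3) x 0) (vec3 (x ^+ 3) 0 0).
have x4' : x%:P ^+ 4 = 1 by rewrite -rmorphXn /= x4.
exists N, (triple (triple 0 0 1) (triple 0 (x ^+ 3) 0) (line_coefs x (x ^+ 3))).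
exists 2, ('X^2 + 1%:P * 'X + 1%:P), (-1), (2%:P * 'X + (1 + 2 * u ^+ 2 * x ^+ 2)%:P).
split => //.
- apply: dual_frame; elim/I3_ind; elim/I3_ind; rewrite sum_I3 /N /line_coefs /triple /vec3 !ffunE /=; ring: x4.
- rewrite diagonal_pull sum_I3 /quad_arc /N /line_coefs /triple /vec3 !ffunE /=.
  by rewrite -mul_polyC; ring: x4'.
- have u4' : u%:P ^+ 4 = -1 by rewrite -rmorphXn /= u4 polyCN.
  rewrite bitangent_conic_pull /quad_arc /N /line_coefs /triple /vec3 !ffunE /= -mul_polyC.
  by ring: x4' u4'.
- by rewrite pnatr_eq0.
- by rewrite oppr_eq0 oner_eq0.
- by rewrite size_monic_quad.
- exact: affine_neq0.
- rewrite diagonal_eval sum_I3 /N /triple /vec3 !ffunE /= (_ : _ + _ = 2) ?pnatr_eq0 //.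
  by ring: x4.
- rewrite bitangent_conic_eval /N /triple /vec3 !ffunE /= (_ : _ + _ = -4) ?oppr_eq0 ?pnatr_eq0 //.
  by ring: x4 u4.
- move=> t; rewrite !(hornerD, hornerM, hornerX, hornerXn, hornerC) => t1; apply/eqP => t2.
  have /eqP : (-1 : k) = 0.
    transitivity (4 * 0 - 0 * (2 * t + (1 - 2 * u ^+ 2 * x ^+ 2)) : k); last by ring.
    by rewrite -{1}t1 -t2; ring: x4 u4.
  by rewrite oppr_eq0 oner_eq0.
Qed.

(** As [x^4 = -1], the quartic restricts to [t^4]. *)
Lemma hyperflex_line_XZ x : x ^+ 2 = u ^+ 2 -> exists N m ar sr ab sb, contact_line (line_coefs x 0) N m ar sr ab sb.
Proof.
move=> x2; have u4' : u%:P ^+ 4 = -1 by rewrite -rmorphXn /= u4 polyCN.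
have x2' : x%:P ^+ 2 = u%:P ^+ 2 by rewrite -!rmorphXn /= x2.
have u0 : u != 0.
  by apply/eqP => u0; move/eqP: u4; rewrite u0 expr0n eq_sym oppr_eq0 oner_eq0.
have x4 : x ^+ 4 = -1 by rewrite (exprM x 2 2) x2 -exprM.
pose N := triple (vec3 (x ^+ 3) 0 1) (vec3 0 1 0) (vec3 (- x ^+ 3) 0 0).
exists N, (triple (triple 0 0 1) (triple 0 1 0) (line_coefs x 0)).
exists 1, ('X^2 + 0%:P * 'X + 0%:P), (u ^+ 2), (2%:P * 'X + x%:P).
split => //.
- apply: dual_frame; elim/I3_ind; elim/I3_ind; rewrite sum_I3 /N /line_coefs /triple /vec3 !ffunE /=; ring: x4.
- rewrite diagonal_pull sum_I3 /quad_arc /N /line_coefs /triple /vec3 !ffunE /=.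
  by rewrite -mul_polyC; ring: x2' u4'.
- rewrite bitangent_conic_pull /quad_arc /N /line_coefs /triple /vec3 !ffunE /= -mul_polyC.
  by ring: x2' u4'.
- by rewrite oner_eq0.
- by rewrite expf_neq0.
- by rewrite size_monic_quad.
- exact: affine_neq0.
- rewrite diagonal_eval sum_I3 /N /triple /vec3 !ffunE /= (_ : _ + _ = 1) ?oner_eq0 //.
  by ring.
- rewrite bitangent_conic_eval /N /triple /vec3 !ffunE /= (_ : _ + _ = 4 * u ^+ 2); last by ring.
  by rewrite mulf_neq0 ?expf_neq0 ?pnatr_eq0.
- move=> t; rewrite !hornerE => /eqP; rewrite expf_eq0 /= => /eqP ->.
  rewrite mulr0 add0r; apply/eqP => x0; move/eqP: x4.
  by rewrite x0 expr0n eq_sym oppr_eq0 oner_eq0.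
Qed.

Lemma hyperflex_line_YZ : exists N m ar sr ab sb, contact_line (line_coefs 0 (u ^+ 3)) N m ar sr ab sb.
Proof.
have u4' : u%:P ^+ 4 = -1 by rewrite -rmorphXn /= u4 polyCN.
have u0 : u != 0.
  by apply/eqP => u0; move/eqP: u4; rewrite u0 expr0n eq_sym oppr_eq0 oner_eq0.
pose N := triple (vec3 0 u 1) (vec3 1 0 0) (vec3 0 (- u) 0).
exists N, (triple (triple 0 0 1) (triple 1 0 0) (line_coefs 0 (u ^+ 3))).
exists 1, ('X^2 + 0%:P * 'X + 0%:P), (- u ^+ 2), (2%:P * 'X + (u ^+ 3)%:P).
split => //.
- apply: dual_frame; elim/I3_ind; elim/I3_ind; rewrite sum_I3 /N /line_coefs /triple /vec3 !ffunE /=; ring: u4.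
- rewrite diagonal_pull sum_I3 /quad_arc /N /line_coefs /triple /vec3 !ffunE /=.
  by rewrite -mul_polyC; ring: u4'.
- rewrite bitangent_conic_pull /quad_arc /N /line_coefs /triple /vec3 !ffunE /= -mul_polyC.
  by ring: u4'.
- by rewrite oner_eq0.
- by rewrite oppr_eq0 expf_neq0.
- by rewrite size_monic_quad.
- exact: affine_neq0.
- rewrite diagonal_eval sum_I3 /N /triple /vec3 !ffunE /= (_ : _ + _ = 1) ?oner_eq0 //.
  by ring.
- rewrite bitangent_conic_eval /N /triple /vec3 !ffunE /= (_ : _ + _ = - 4 * u ^+ 2); last by ring.
  by rewrite mulf_neq0 ?expf_neq0 ?oppr_eq0 ?pnatr_eq0.
- move=> t; rewrite !hornerE => /eqP; rewrite expf_eq0 /= => /eqP ->.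
  by rewrite mulr0 add0r expf_neq0.
Qed.
End Quartic.

Section QuarticExample.
Variable k : numClosedFieldType.
Implicit Types (f g h : {mpoly k[3]}) (P : ppoint k).

Lemma rc_param g d phi v f e P : rational_curve g d phi v -> f \is e.-homog ->
  f.@[v] != 0 -> on_curve g P -> f.@[P] = 0 ->
  exists x a, [/\ a != 0, forall i, P i = a * arc_point phi x i &
    forall h D, h \is D.-homog -> h.@[P] = 0 -> (pull phi h).[x] = 0].
Proof.
move=> rc hf fv gP fP.
have [[x [a [a0 Px]]]|[a [a0 Pv]]] := rc_points rc gP; last first.
  move: fP; rewrite (meval_homogZ hf Pv) => /eqP.
  by rewrite mulf_eq0 (negbTE fv) expf_eq0 (negbTE a0) andbF.
exists x, a; split=> // h D hh; rewrite (meval_homogZ hh Px) pull_eval => /eqP.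
by rewrite mulf_eq0 expf_eq0 (negbTE a0) andbF => /eqP.
Qed.

Variables (u : k) (c : 'I_3 -> k) (N : 'I_3 -> ppoint k) (m : 'I_3 -> 'I_3 -> k).
Variables (ar ab : k) (sr sb : {poly k}).
Hypothesis cl : contact_line u c N m ar sr ab sb.
Let r : {mpoly k[3]} := quartic k.
Let b := bitangent_conic u.
Let G := linear_form c.

Let rcG : rational_curve G 1 (quad_arc (N 0) (N 1) (fun=> 0)) (N 1).
Proof. by rewrite /G -(cl_form cl); exact: line_rational (cl_frame cl). Qed.

Let hr : r \is 4.-homog. Proof. exact: diagonal_homog. Qed.
Let hb : b \is 2.-homog. Proof. exact: bitangent_conic_homog. Qed.

Lemma contact_line_curve : plane_curve 1 G.
Proof. by rewrite /G -(cl_form cl); exact: line_plane_curve (cl_frame cl). Qed.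

Let sr0 : sr != 0.
Proof. by rewrite -size_poly_eq0 (cl_sr cl). Qed.

Lemma contact_line_even_r : even_intersections G r.
Proof.
apply: even_intersectionsC.
exact: rc_even rcG hr (cl_rN cl) (cl_ar cl) sr0 (cl_r cl).
Qed.

Lemma contact_line_even_b : even_intersections G b.
Proof.
apply: even_intersectionsC.
exact: rc_even rcG hb (cl_bN cl) (cl_ab cl) (cl_sb cl) (cl_b cl).
Qed.

Lemma contact_line_disjoint P : ~ (on_curve G P /\ on_curve r P /\ on_curve b P).
Proof.
move=> [GP [[_ rP] [_ bP]]].
have [x [a [_ _ h]]] := rc_param rcG hr (cl_rN cl) GP rP.
have := h _ _ hr rP; rewrite (cl_r cl) hornerZ horner_exp => /eqP.
rewrite mulf_eq0 (negbTE (cl_ar cl)) expf_eq0 /= => /eqP /(cl_disj cl) /negP; apply.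
have := h _ _ hb bP; rewrite (cl_b cl) hornerZ horner_exp => /eqP.
by rewrite mulf_eq0 (negbTE (cl_ab cl)) expf_eq0.
Qed.

Lemma contact_line_theta (w : k) : 4.-primitive_root w -> cuts_odd_theta G r.
Proof.
move=> w4; apply: (tangent_cuts_odd_theta _ _ w4 rcG _ (cl_rN cl) (cl_ar cl) sr0 (cl_r cl)) => //.
- by move=> _; apply: oner_neq0.
- by case: contact_line_curve.
- move=> h hh; rewrite (cl_sr cl) ltnS.
  apply: (leq_trans (size_pull (e := 1) hh _)) => // i.
  rewrite /quad_arc polyC0 mul0r addr0; apply: (leq_trans (size_polyD _ _)).
  rewrite geq_max (leq_trans (size_polyC_leq1 _)) //=.
  rewrite (leq_trans (size_polyMleq _ _)) // size_polyX addn2 /=.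
  by rewrite ltnS size_polyC_leq1.
- move=> h hh h0; have [e E] := line_unique (cl_frame cl) hh h0.
  by exists e; rewrite E (cl_form cl).
Qed.

Lemma contact_line_gradient f P : f = r \/ f = b -> on_curve G P -> f.@[P] = 0 ->
  exists l, forall i, (f^`M(i)).@[P] = l * c i.
Proof.
have fE i : ((linear_form (m 2))^`M(i)).@[P] = c i.
  by rewrite linear_form_deriv mevalC (cl_form cl).
rewrite /G -(cl_form cl) => -[] -> GP fP.
  have [l lE] := line_contact_gradient (cl_frame cl) hr (cl_rN cl) (cl_r cl) GP fP (cl_ar cl).
  by exists l => i; rewrite lE fE (cl_form cl).
have [l lE] := line_contact_gradient (cl_frame cl) hb (cl_bN cl) (cl_b cl) GP fP (cl_ab cl).
by exists l => i; rewrite lE fE (cl_form cl).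
Qed.

End QuarticExample.

Section QuarticFamily.
Variable k : numClosedFieldType.

(** At a common contact point both lines are the tangent line of the same smooth
curve, and the last coefficient normalizes their equations. *)
Lemma contact_lines_apart (u : k) c c' N m ar sr ab sb N' m' ar' sr' ab' sb' P :
  u ^+ 4 = -1 ->
  contact_line u c N m ar sr ab sb -> contact_line u c' N' m' ar' sr' ab' sb' ->
  c 2 = 1 -> c' 2 = 1 ->
  on_curve (linear_form c) P -> on_curve (linear_form c') P ->
  on_curve (quartic k) P \/ on_curve (bitangent_conic u) P -> c =1 c'.
Proof.
move=> u4 cl cl' c2 c'2 cP c'P fP.
have [f [fE fP' sf]] : exists f, [/\ f = quartic k \/ f = bitangent_conic u, on_curve f P & smooth f].
  case: fP => fP; [exists (quartic k) | exists (bitangent_conic u)]; split=> //; try by [left | right].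
    by apply: diagonal_smooth => // _; apply: oner_neq0.
  exact: bitangent_conic_smooth.
have [l lE] := contact_line_gradient cl fE cP fP'.2.
have [l' l'E] := contact_line_gradient cl' fE c'P fP'.2.
have ll' : l = l' by have := lE 2; rewrite l'E c2 c'2 !mulr1.
have [i fi] := sf P fP'.
have l0 : l != 0 by apply: contraNneq fi => l0; rewrite lE l0 mul0r.
by move=> j; apply: (mulfI l0); rewrite -lE l'E ll'.
Qed.

Lemma quartic_configuration :
  exists (r b : tpoly k) (G : 'I_7 -> tpoly k),
     (plane_curve 4 r /\ smooth r) /\
     plane_curve 2 b /\
     (forall i : 'I_7, plane_curve 1 (G i)) /\
     (forall i j : 'I_7, i <> j -> ~ same_curve (G i) (G j)) /\
     (forall (i : 'I_7) (P : ppoint k),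
        ~ (on_curve (G i) P /\ on_curve r P /\ on_curve b P)) /\
     (forall i : 'I_7, even_intersections (G i) r) /\
     (forall i : 'I_7, even_intersections (G i) b) /\
     (forall (i j : 'I_7) (P : ppoint k), i <> j ->
        on_curve (G i) P -> on_curve (G j) P ->
        ~ (on_curve r P \/ on_curve b P)) /\
     (forall i : 'I_7, cuts_odd_theta (G i) r).
Proof.
have [u u8] : exists u : k, 8.-primitive_root u by exact: prim_root_exists.
have [w w4] : exists w : k, 4.-primitive_root w by exact: prim_root_exists.
have u4 : u ^+ 4 = -1.
  have /eqP := prim_expr_order u8; rewrite (exprM u 4 2) sqrf_eq1 => /orP[|/eqP //].
  by rewrite -(prim_order_dvd u8).
(* exponents of u: the fourth roots of unity, then the two square roots of u^2 *)
pose e (i : 'I_7) := nth 0%N [:: 0; 2; 4; 6; 1; 5]%N i.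
pose x (i : 'I_7) := if i == 6 :> nat then 0 else u ^+ e i.
pose y (i : 'I_7) := if (i < 4)%N then x i ^+ 3 else if i == 6 :> nat then u ^+ 3 else 0.
pose c (i : 'I_7) := line_coefs (x i) (y i).
have x_inj i j : x i = x j -> i = j.
  have u0 : u != 0.
    by apply/eqP => u0; move/eqP: u4; rewrite u0 expr0n eq_sym oppr_eq0 oner_eq0.
  move=> xij; apply: val_inj; move: xij.
  rewrite /x /e; case: i => [[|[|[|[|[|[|[|//]]]]]]] lti]; case: j => [[|[|[|[|[|[|[|//]]]]]]] ltj] //= /eqP;
  rewrite ?(eq_sym 0) ?expf_eq0 ?(negbTE u0) ?andbF ?(eq_prim_root_expr u8) //.
have cl i : exists N m ar sr ab sb, contact_line u (c i) N m ar sr ab sb.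
  have [i4|i4] := ltnP i 4.
    rewrite /c /y i4; apply: bitangent_line => //.
    rewrite /x ltn_eqF ?(leq_trans i4) // -exprM; apply/eqP.
    rewrite -(prim_order_dvd u8) /e.
    by case: (val i) i4 => [|[|[|[|[]]]]].
  have [i6|i6] := eqVneq (i : nat) 6.
    by rewrite /c /y /x i6 /=; apply: hyperflex_line_YZ.
  rewrite /c /y ltnNge i4 (negbTE i6) /=; apply: hyperflex_line_XZ => //.
  rewrite /x (negbTE i6) /e -exprM; apply/eqP; rewrite (eq_prim_root_expr u8).
  by case: i i4 i6 => [[|[|[|[|[|[|[|//]]]]]]]].
have apart i j P : on_curve (linear_form (c i)) P -> on_curve (linear_form (c j)) P ->
    on_curve (quartic k) P \/ on_curve (bitangent_conic u) P -> i = j.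
  move=> iP jP fP; have [N [m [ar [sr [ab [sb cli]]]]]] := cl i.
  have [N' [m' [ar' [sr' [ab' [sb' clj]]]]]] := cl j.
  exact/x_inj/(contact_lines_apart u4 cli clj (erefl _) (erefl _) iP jP fP 0).
exists (quartic k), (bitangent_conic u), (fun i => linear_form (c i)).
split; first split.
- by apply: diagonal_plane_curve => // _; apply: oner_neq0.
- by apply: diagonal_smooth => // _; apply: oner_neq0.
split; first exact: bitangent_conic_plane_curve.
split; first by move=> i; have [N [m [ar [sr [ab [sb cli]]]]]] := cl i; apply: contact_line_curve cli.
split.
  move=> i j ij [l _ E]; apply: ij; apply: x_inj.
  have lE s : c i s = l * c j s.
    have := congr1 (fun f => (f^`M(s)).@[fun=> 0]) E.
    by rewrite mderivZ !linear_form_deriv mevalZ !mevalC.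
  by have := lE 0; have /= := lE 2; rewrite mulr1 /c /line_coefs /triple /= => <-; rewrite mul1r.
split; first by move=> i; have [N [m [ar [sr [ab [sb cli]]]]]] := cl i; apply: contact_line_disjoint cli.
split; first by move=> i; have [N [m [ar [sr [ab [sb cli]]]]]] := cl i; apply: contact_line_even_r cli.
split; first by move=> i; have [N [m [ar [sr [ab [sb cli]]]]]] := cl i; apply: contact_line_even_b cli.
split; first by move=> i j P ij iP jP fP; apply: ij; apply: apart iP jP fP.
move=> i; have [N [m [ar [sr [ab [sb cli]]]]]] := cl i.
exact: (contact_line_theta cli w4).
Qed.
End QuarticFamily.

(** * The quintic and its conics *)

Section Quintic.
Variable k : numClosedFieldType.
Implicit Types (f g h : {mpoly k[3]}) (P : ppoint k).

Definition quintic : {mpoly k[3]} := diagonal (triple 8 1 1) 5.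
Let q := quintic.

Variables e w w' : k.
Hypotheses (e2 : e ^+ 2 = 5) (ww' : w * w' = 1) (w5 : w ^+ 5 = 1).

Let w'5 : w' ^+ 5 = 1.
Proof. by rewrite -[LHS]mul1r -w5 -exprMn ww' expr1n. Qed.

Lemma e_neq0 : e != 0.
Proof. by apply/eqP => e0; move/eqP: e2; rewrite e0 expr0n eq_sym pnatr_eq0. Qed.

(** For [e^2 = 5] and [w^5 = w * w' = 1], the coefficients of 1, [t] and [t^2] in
the parametrization [(20 : w (be + e ga) : w' (be - e ga))] of a conic, where
[be = 5 (t^2 - 5)] and [ga = t^2 - 4 t - 1]. *)
Definition conic_pts := triple (vec3 20 (w * (-25 - e)) (w' * (-25 + e)))
  (vec3 0 (- 4 * e * w) (4 * e * w')) (vec3 0 ((5 + e) * w) ((5 - e) * w')).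

(** The basis dual to [conic_pts]. *)
Definition conic_forms : 'I_3 -> 'I_3 -> k :=
  triple (triple (20^-1) 0 0)
      (triple (20^-1) (w' * (1 - e) / 40) (w * (1 + e) / 40))
      (triple (4^-1) (w' / 10) (w / 10)).

Lemma conic_frame : frame conic_pts (fun j => linear_form (conic_forms j)).
Proof.
have e0 := e_neq0.
apply: dual_frame; elim/I3_ind; elim/I3_ind; rewrite sum_I3 /conic_pts /conic_forms /triple /vec3 !ffunE /=; field: e2 ww';
by rewrite ?pnatr_eq0.
Qed.

Definition sigma5 : {poly k} := 'X^5 - 3%:P * 'X^4 - 6%:P * 'X^3 + 18%:P * 'X^2 + 21%:P * 'X - 15%:P.

(** By [w^5 = w'^5 = 1] and [e^2 = 5] the two last terms add up to
[(be + e ga)^5 + (be - e ga)^5 = 2 be^5 + 100 be^3 ga^2 + 250 be ga^4], so the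
result is the same for all ten conics. *)
Lemma quintic_pull : pull (quad_arc (conic_pts 0) (conic_pts 1) (conic_pts 2)) q =
  (20 * 10 ^+ 3) *: sigma5 ^+ 2.
Proof.
have e2' : e%:P ^+ 2 = 5%:P by rewrite -!rmorphXn /= e2.
have w5' : w%:P ^+ 5 = 1 by rewrite -!rmorphXn /= w5.
have w'5' : w'%:P ^+ 5 = 1 by rewrite -!rmorphXn /= w'5.
rewrite diagonal_pull sum_I3 /quad_arc /conic_pts /triple /vec3 !ffunE /= -mul_polyC /sigma5.
ring: e2' w5' w'5'.
Qed.
Let fr := conic_frame.
Let F := frame_conic (fun j => linear_form (conic_forms j)).
Let phi := quad_arc (conic_pts 0) (conic_pts 1) (conic_pts 2).
Let rcF : rational_curve F 2 phi (conic_pts 2) := conic_rational fr.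
Let hF : F \is 2.-homog := rc_homog rcF.
Let hq : q \is 5.-homog. Proof. exact: diagonal_homog. Qed.

Lemma quintic_coef_neq0 i : triple 8 1 1 i != 0 :> k.
Proof. by elim/I3_ind: i; rewrite /triple /= ?pnatr_eq0 ?oner_neq0. Qed.

Lemma contact_conic_curve : plane_curve 2 F.
Proof. exact: frame_conic_plane_curve fr. Qed.

Lemma quintic_vertex : q.@[conic_pts 2] != 0.
Proof.
rewrite diagonal_eval sum_I3 /conic_pts /triple /vec3 !ffunE /= (_ : _ + _ = 20 * 10 ^+ 3).
  by rewrite mulf_neq0 ?expf_neq0 ?pnatr_eq0.
by ring: e2 w5 w'5.
Qed.

Lemma size_sigma5 : size sigma5 = 6.
Proof.
rewrite (_ : sigma5 = Poly [:: -15; 21; 18; -6; -3; 1]); last first.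
  by rewrite /= !cons_poly_def /sigma5; ring.
by rewrite (@PolyK _ 0) //= oner_neq0.
Qed.

Let sigma0 : sigma5 != 0. Proof. by rewrite -size_poly_eq0 size_sigma5. Qed.
Let c0 : 20 * 10 ^+ 3 != 0 :> k. Proof. by rewrite mulf_neq0 ?expf_neq0 ?pnatr_eq0. Qed.

Lemma contact_conic_even_q : even_intersections F q.
Proof.
apply: even_intersectionsC.
exact: rc_even rcF hq quintic_vertex c0 sigma0 quintic_pull.
Qed.

Lemma size_quad_arc A B C i : (size (@quad_arc k A B C i) <= 3)%N.
Proof.
rewrite /quad_arc; apply: (leq_trans (size_polyD _ _)); rewrite geq_max; apply/andP; split.
  apply: (leq_trans (size_polyD _ _)); rewrite geq_max (leq_trans (size_polyC_leq1 _)) //=.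
  by rewrite (leq_trans (size_polyMleq _ _)) // size_polyX addn2 /= ltnS (leq_trans (size_polyC_leq1 _)).
by rewrite (leq_trans (size_polyMleq _ _)) // size_polyXn addn3 /= !ltnS size_polyC_leq1.
Qed.

Lemma contact_conic_theta (z : k) : 5.-primitive_root z -> cuts_odd_theta F q.
Proof.
move=> z5; apply: (tangent_cuts_odd_theta _ _ z5 rcF _ quintic_vertex c0 sigma0 quintic_pull) => //.
- exact: quintic_coef_neq0.
- by case: contact_conic_curve.
- by move=> h hh; rewrite size_sigma5 ltnS; apply: (size_pull (e := 2) hh) => i; apply: size_quad_arc.
- by move=> h hh h0; apply: conic_unique fr _ hh h0.
Qed.

Definition axis_pts : 'I_3 -> ppoint k := triple (vec3 0 0 1) (vec3 0 1 0) (vec3 1 0 0).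

Definition axis_forms : 'I_3 -> 'I_3 -> k := triple (triple 0 0 1) (triple 0 1 0) (triple 1 0 0).

Lemma axis_frame : frame axis_pts (fun j => linear_form (axis_forms j)).
Proof.
by apply: dual_frame; elim/I3_ind; elim/I3_ind; rewrite sum_I3 /axis_pts /axis_forms /triple /vec3 !ffunE /=; ring.
Qed.

Let L := linear_form (triple (1 : k) 0 0).

Lemma contact_conic_eval P : F.@[P] =
  ((P 0 / 20 + w' * (1 - e) / 40 * P 1 + w * (1 + e) / 40 * P 2) ^+ 2
   - P 0 / 20 * (P 0 / 4 + w' / 10 * P 1 + w / 10 * P 2)).
Proof.
rewrite mevalB rmorphXn mevalM /= !linear_form_eval !sum_I3 /conic_forms /triple /=.
by ring.
Qed.

Lemma one_pm_e_neq0 : 1 - e != 0 /\ 1 + e != 0.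
Proof.
have E : - (1 - e) * (1 + e) = 4 by ring: e2.
by split; apply/eqP => e1; move/eqP: E; rewrite e1 ?oppr0 ?mul0r ?mulr0 eq_sym pnatr_eq0.
Qed.

Let ww'0 : w != 0 /\ w' != 0.
Proof.
by apply/andP; rewrite -negb_or -mulf_eq0 ww' oner_eq0.
Qed.

(** The form [M 0] of the frame is a multiple of the equation of the line, so the
conic [M 1 ^+ 2 = M 0 * M 2] restricts to a square. *)
Lemma contact_conic_even_L : even_intersections F L.
Proof.
have [en1 ep1] := one_pm_e_neq0; have [w0 w'0] := ww'0.
pose s := (w * (1 + e) / 40)%:P + (w' * (1 - e) / 40)%:P * 'X.
have n40 : 40%:R != 0 :> k by rewrite pnatr_eq0.
have s0 : s != 0.
  apply/eqP => /(congr1 (fun p : {poly k} => p`_1)) /eqP; rewrite !coefE /= add0r mulr1.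
  by rewrite !mulf_eq0 invr_eq0 (negbTE n40) (negbTE en1) (negbTE w'0).
apply: (rc_even (line_rational axis_frame) hF _ (oner_neq0 _) s0).
  rewrite contact_conic_eval /axis_pts /triple /vec3 !ffunE /= !(mul0r, mulr0, add0r, addr0, subr0).
  by rewrite mulr1 expf_neq0 // !mulf_neq0 ?invr_eq0.
rewrite scale1r /F /frame_conic rmorphB rmorphXn rmorphM /= !pull_quad_arc ?linear_form_homog //.
rewrite !linear_form_eval !sum_I3 /conic_forms /axis_pts /triple /vec3 !ffunE /= /s.
rewrite !(mul0r, mulr0, add0r, addr0, polyC0, mulr1, subr0).
by [].
Qed.

Lemma contact_conic_meets_L P : F.@[P] = 0 -> L.@[P] = 0 ->
  P 0 = 0 /\ w' * (e - 1) * P 1 = w * (1 + e) * P 2.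
Proof.
rewrite contact_conic_eval linear_form_eval sum_I3 /triple /= mul1r !mul0r !addr0 => FP P0.
split=> //; move: FP; rewrite P0 !mul0r add0r subr0 => /eqP; rewrite expf_eq0 /= => /eqP FP.
have n40 : 40%:R != 0 :> k by rewrite pnatr_eq0.
apply/eqP; rewrite -subr_eq0 -[X in _ == X](mulr0 (- 40)) -FP; apply/eqP; field.
by rewrite ?pnatr_eq0.
Qed.

(** On the line [X = 0], fifth powers in the equation of the contact point with the
conic and the equation [Y^5 + Z^5 = 0] of the quintic have only the zero
solution. *)
Lemma contact_conic_disjoint P : ~ (on_curve F P /\ on_curve q P /\ on_curve L P).
Proof.
move=> [[P0 FP] [[_ qP] [_ LP]]]; have [Px Pyz] := contact_conic_meets_L FP LP.
have [en1 ep1] := one_pm_e_neq0; have [w0 w'0] := ww'0.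
move: qP; rewrite diagonal_eval sum_I3 /triple /= Px => qP.
have E5 : (e - 1) ^+ 5 * P 1 ^+ 5 = (1 + e) ^+ 5 * P 2 ^+ 5.
  have := congr1 (fun x => x ^+ 5) Pyz; rewrite !exprMn w5 w'5 !mul1r; exact.
have P5 : P 1 ^+ 5 = - P 2 ^+ 5.
  by apply/eqP; rewrite -addr_eq0 -[X in _ == X]qP; apply/eqP; ring.
have P2 : P 2 = 0.
  have /eqP : 160 * e * P 2 ^+ 5 = 0.
    transitivity ((1 + e) ^+ 5 * P 2 ^+ 5 - (e - 1) ^+ 5 * - P 2 ^+ 5); first by ring: e2.
    by rewrite -P5 E5 subrr.
  have c : 160 * e != 0 by rewrite mulf_neq0 ?pnatr_eq0 ?e_neq0.
  by rewrite mulf_eq0 (negbTE c) expf_eq0 => /eqP.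
have P1 : P 1 = 0.
  have : P 1 ^+ 5 = 0 by rewrite P5 P2 expr0n oppr0.
  by move/eqP; rewrite expf_eq0 => /eqP.
by case/eqP: P0; apply/ffunP; elim/I3_ind; rewrite ffunE.
Qed.

Lemma contact_conic_param P : on_curve F P -> q.@[P] = 0 -> exists t a,
  [/\ a != 0, sigma5.[t] = 0,
   P 0 = a * 20,
   P 1 = a * (w * (5 * (t ^+ 2 - 5) + e * (t ^+ 2 - 4 * t - 1)))
 & P 2 = a * (w' * (5 * (t ^+ 2 - 5) - e * (t ^+ 2 - 4 * t - 1)))].
Proof.
move=> FP qP; have [t [a [a0 Pa h]]] := rc_param rcF hq quintic_vertex FP qP.
exists t, a; split=> //.
- have := h _ _ hq qP; rewrite quintic_pull hornerZ horner_exp => /eqP.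
  by rewrite mulf_eq0 (negbTE c0) expf_eq0 => /eqP.
- rewrite Pa ffunE /phi /quad_arc /conic_pts /triple /vec3 !ffunE /= !(hornerD, hornerM, hornerX, hornerXn, hornerC); ring.
- rewrite Pa ffunE /phi /quad_arc /conic_pts /triple /vec3 !ffunE /= !(hornerD, hornerM, hornerX, hornerXn, hornerC); ring.
- rewrite Pa ffunE /phi /quad_arc /conic_pts /triple /vec3 !ffunE /= !(hornerD, hornerM, hornerX, hornerXn, hornerC); ring.
Qed.

End Quintic.

Section ContactParameters.
Variable k : numClosedFieldType.
Implicit Types t : k.

Definition contact_quintic t := t ^+ 5 - 3 * t ^+ 4 - 6 * t ^+ 3 + 18 * t ^+ 2 + 21 * t - 15.

(** Up to the factor 20 this is [be^2 - 5 ga^2], the product of the last two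
coordinates of [(20 : w (be + e ga) : w' (be - e ga))]. *)
Definition product_quartic t := t ^+ 4 + 2 * t ^+ 3 - 16 * t ^+ 2 - 2 * t + 31.

(** The five contact points of a conic with the quintic have different products of
coordinates: modulo [contact_quintic] the parameter is a polynomial in
[product_quartic]. *)
Lemma product_recovers_parameter t : contact_quintic t = 0 ->
  (76 * 2 ^+ 7 * 1000) * t = - (240 ^+ 3) + (640 ^+ 2) * product_quartic t + (7 * 1000 + 40) * product_quartic t ^+ 2 + 288 * product_quartic t ^+ 3 - 3 * product_quartic t ^+ 4.
Proof.
move=> st.
(* the quotient by contact_quintic of the difference of the two sides *)
pose W := - (763 * 1000 + 219) - (244 * 1000 + 121) * t + (144 * 1000 + 779) * t ^+ 2 - (31 * 1000 + 375) * t ^+ 3 + (17 * 1000 + 874) * t ^+ 4 - (6 * 1000 + 42) * t ^+ 5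
  - (8 * 1000 + 346) * t ^+ 6 + 1218 * t ^+ 7 + 945 * t ^+ 8 + 3 * t ^+ 9 - 33 * t ^+ 10 - 3 * t ^+ 11.
apply/esym/eqP; rewrite -subr_eq0 -[X in _ == X](mul0r (W)) -st; apply/eqP.
by rewrite /W /contact_quintic /product_quartic; ring.
Qed.

(** A Bezout relation shows that [contact_quintic] and [product_quartic] are
coprime. *)
Lemma product_quartic_neq0 t : contact_quintic t = 0 -> product_quartic t != 0.
Proof.
move=> st; apply/eqP => pt; have /eqP : (320 : k) = 0; last by rewrite pnatr_eq0.
transitivity ((- 11 + 17 * t - t ^+ 2 - t ^+ 3) * contact_quintic t + (5 + 16 * t - 2 * t ^+ 2 - 4 * t ^+ 3 + t ^+ 4) * product_quartic t).
  by rewrite /contact_quintic /product_quartic; ring.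
by rewrite st pt !mulr0 addr0.
Qed.

Lemma gamma_factor_neq0 t : contact_quintic t = 0 -> t ^+ 2 - 4 * t - 1 != 0.
Proof.
move=> st; apply/eqP => pt; have /eqP : (80 : k) = 0; last by rewrite pnatr_eq0.
transitivity ((- 4 + t) * contact_quintic t + (- 20 - 19 * t + 5 * t ^+ 2 + 3 * t ^+ 3 - t ^+ 4) * (t ^+ 2 - 4 * t - 1)).
  by rewrite /contact_quintic; ring.
by rewrite st pt !mulr0 addr0.
Qed.

(** This is the factor of [(be + e ga)^5 - (be - e ga)^5] next to
[10 * e * ga]. *)
Lemma quintic_odd_part_neq0 t (be := 5 * (t ^+ 2 - 5)) (ga := t ^+ 2 - 4 * t - 1) : contact_quintic t = 0 ->
  be ^+ 4 + 10 * be ^+ 2 * ga ^+ 2 + 5 * ga ^+ 4 != 0.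
Proof.
move=> st; apply/eqP => pt.
(* the whole expression is 80 times T *)
pose T := 4961 + 626 * t - 2838 * t ^+ 2 - 862 * t ^+ 3 + 820 * t ^+ 4 + 262 * t ^+ 5 - 138 * t ^+ 6 - 26 * t ^+ 7 + 11 * t ^+ 8.
have T0 : T = 0.
  have /eqP : 80 * T = 0 by rewrite -pt /T /be /ga; ring.
  by rewrite mulf_eq0 pnatr_eq0 => /eqP.
have /eqP : (2758 * 1000 + 400 : k) = 0; last by rewrite -natrM -natrD pnatr_eq0.
transitivity (((42 * 1000 + 659) + (47 * 1000 + 299) * t - 3146 * t ^+ 2 - (9 * 1000 + 246) * t ^+ 3 - 2313 * t ^+ 4 + 1599 * t ^+ 5 + 816 * t ^+ 6 - 308 * t ^+ 7) * contact_quintic t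
   + (685 - 124 * t + 43 * t ^+ 2 - 92 * t ^+ 3 + 28 * t ^+ 4) * T).
  by rewrite /contact_quintic /T; ring.
by rewrite st T0 !mulr0 addr0.
Qed.

Lemma sigma5_eval t : (sigma5 k).[t] = contact_quintic t.
Proof. by rewrite /sigma5 /contact_quintic !(hornerD, hornerN, hornerM, hornerX, hornerXn, hornerC). Qed.

(** The two hypotheses say that two conics meet the quintic at the same point.
The product of the coordinates identifies the parameters.  If [e1 = e], the
coordinates also identify [w] and [w1]; if [e1 = - e], the fifth powers of
[be + e ga] and [be - e ga] coincide, which is impossible. *)
Lemma contact_points_apart (e w w' e1 w1 w1' t t1 : k) :
  let x e t := 5 * (t ^+ 2 - 5) + e * (t ^+ 2 - 4 * t - 1) in
  e ^+ 2 = 5 -> w * w' = 1 -> w1 * w1' = 1 -> w ^+ 5 = 1 -> w1 ^+ 5 = 1 ->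
  e1 = e \/ e1 = - e -> contact_quintic t = 0 -> contact_quintic t1 = 0 ->
  w * x e t = w1 * x e1 t1 -> w' * x (- e) t = w1' * x (- e1) t1 -> e = e1 /\ w = w1.
Proof.
move=> x e2 ww' ww1' w5 w15 ee1 st st1 E E'.
have e12 : e1 ^+ 2 = 5 by case: ee1 => ->; rewrite ?sqrrN.
have xx (f s : k) : f ^+ 2 = 5 -> x f s * x (- f) s = 20 * product_quartic s.
  by move=> f2; rewrite /x /product_quartic; ring: f2.
have pp : product_quartic t = product_quartic t1.
  have n20 : (20 : k) != 0 by rewrite pnatr_eq0.
  apply: (mulfI n20); rewrite -(xx e) // -(xx e1) //.
  transitivity (w * w' * (x e t * x (- e) t)); first by rewrite ww' mul1r.
  transitivity (w1 * w1' * (x e1 t1 * x (- e1) t1)); last by rewrite ww1' mul1r.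
  transitivity ((w * x e t) * (w' * x (- e) t)); first by ring.
  by rewrite E E'; ring.
have tt : t = t1.
  have n : (76 * 2 ^+ 7 * 1000 : k) != 0 by rewrite !mulf_neq0 ?expf_neq0 ?pnatr_eq0.
  by apply: (mulfI n); rewrite product_recovers_parameter // pp -product_recovers_parameter.
rewrite -{}tt in E E'.
have x0 : x e t != 0.
  apply: contraNneq (product_quartic_neq0 st) => x0; have := xx e t e2; rewrite x0 mul0r => /esym/eqP.
  by rewrite mulf_eq0 pnatr_eq0.
case: ee1 => ee1; rewrite {}ee1 in E E' e12 *; first by split=> //; apply: (mulIf x0).
have : e * (t ^+ 2 - 4 * t - 1) *+ 10 * ((5 * (t ^+ 2 - 5)) ^+ 4 + 10 * (5 * (t ^+ 2 - 5)) ^+ 2 * (t ^+ 2 - 4 * t - 1) ^+ 2 + 5 * (t ^+ 2 - 4 * t - 1) ^+ 4) = 0.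
  transitivity (x e t ^+ 5 - x (- e) t ^+ 5); first by rewrite /x; ring: e2.
  have := congr1 (fun y => y ^+ 5) E; rewrite !exprMn w5 w15 !mul1r => ->.
  by rewrite subrr.
move/eqP; rewrite mulf_eq0 (negbTE (quintic_odd_part_neq0 st)) orbF mulrn_eq0 /= mulf_eq0.
by rewrite (negbTE (gamma_factor_neq0 st)) (negbTE (e_neq0 e2)).
Qed.

(** The point [(0 : y : z)] is the contact point of a conic with the line
[X = 0].  For [e1 = e] comparison of the equations gives [w^2 = w1^2], whence
[w = w^6 = w1^6 = w1].  For [e1 = - e] it gives [(1 + e)^10 = (e - 1)^10], which
is false. *)
Lemma axis_points_apart (e w w' e1 w1 w1' y z : k) :
  e ^+ 2 = 5 -> w * w' = 1 -> w1 * w1' = 1 -> w ^+ 5 = 1 -> w1 ^+ 5 = 1 ->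
  e1 = e \/ e1 = - e -> y != 0 ->
  w' * (e - 1) * y = w * (1 + e) * z -> w1' * (e1 - 1) * y = w1 * (1 + e1) * z ->
  e = e1 /\ w = w1.
Proof.
move=> e2 ww' ww1' w5 w15 ee1 y0 E E1.
have w'5 : w' ^+ 5 = 1 by rewrite -[LHS]mul1r -{1}w5 -exprMn ww' expr1n.
have w1'5 : w1' ^+ 5 = 1 by rewrite -[LHS]mul1r -{1}w15 -exprMn ww1' expr1n.
have [en1 ep1] := one_pm_e_neq0 e2.
case: ee1 => ee1; rewrite {}ee1 in E1 *.
  split=> //; have ww : w ^+ 2 = w1 ^+ 2.
    have sq (a a' : k) : a * a' = 1 -> a' * (e - 1) * y = a * (1 + e) * z ->
        (e - 1) * y = a ^+ 2 * ((1 + e) * z).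
      move=> aa' aE; transitivity (a * (a' * (e - 1) * y)); last by rewrite aE; ring.
      by rewrite !mulrA aa' mul1r.
    have n : (1 + e) * z != 0.
      apply: contraTneq (mulf_neq0 en1 y0) => n; rewrite negbK.
      have -> : (1 - e) * y = - ((e - 1) * y) by ring.
      by rewrite (sq _ _ ww' E) n mulr0 oppr0.
    by apply: (mulIf n); rewrite -(sq _ _ ww' E) -(sq _ _ ww1' E1).
  by rewrite -[w]mul1r -{1}w5 -exprSr -[w1]mul1r -{1}w15 -exprSr (exprM w 2 3) ww -exprM.
have F5 := congr1 (fun x => x ^+ 5) E; have F15 := congr1 (fun x => x ^+ 5) E1.
rewrite !exprMn w5 w'5 !mul1r in F5; rewrite !exprMn w15 w1'5 !mul1r in F15.
have : 352 * (160 * e) * y ^+ 5 = 0.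
  have G : (1 + e) ^+ 5 * y ^+ 5 = (e - 1) ^+ 5 * z ^+ 5.
    transitivity (- ((- e - 1) ^+ 5 * y ^+ 5)); first by ring.
    by rewrite F15; ring.
  transitivity ((1 + e) ^+ 5 * ((1 + e) ^+ 5 * y ^+ 5) - (e - 1) ^+ 5 * ((e - 1) ^+ 5 * y ^+ 5)).
    by ring: e2.
  by rewrite G F5; ring.
move/eqP; rewrite mulf_eq0 expf_eq0 (negbTE y0) orbF mulf_eq0 pnatr_eq0 /= mulf_eq0 pnatr_eq0.
by rewrite (negbTE (e_neq0 e2)).
Qed.
End ContactParameters.

Lemma modn5_inj (i j : nat) : (i < 5)%N -> (j < 5)%N -> i == j %[mod 5] -> i = j.
Proof. by move=> i5 j5; rewrite !modn_small // => /eqP. Qed.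

Lemma modn5_inj_shift (i j : nat) : (i < 9)%N -> (j < 9)%N -> (5 <= i)%N -> (5 <= j)%N ->
  i == j %[mod 5] -> i = j.
Proof. move=> *; lia. Qed.

Section QuinticFamily.
Variable k : numClosedFieldType.
Implicit Types (e w : k) (P : ppoint k).

Let conic e w := frame_conic (fun j => linear_form (conic_forms e w w^-1 j)).
Let q := quintic k.
Let L := linear_form (triple (1 : k) 0 0).

Let rootV w : w ^+ 5 = 1 -> w * w^-1 = 1.
Proof.
move=> w5; apply: mulfV; apply/eqP => w0; move/eqP: w5.
by rewrite w0 expr0n eq_sym oner_eq0.
Qed.

Lemma contact_conics_apart_L e w e1 w1 P : e ^+ 2 = 5 -> w ^+ 5 = 1 -> w1 ^+ 5 = 1 ->
  e1 = e \/ e1 = - e -> on_curve (conic e w) P -> on_curve (conic e1 w1) P -> on_curve L P ->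
  e = e1 /\ w = w1.
Proof.
move=> e2 w5 w15 ee1 [P0 FP] [_ F1P] [_ LP].
have ww' := rootV w5; have ww1' := rootV w15.
have e12 : e1 ^+ 2 = 5 by case: ee1 => ->; rewrite ?sqrrN.
have [Px E] := contact_conic_meets_L FP LP; have [_ E1] := contact_conic_meets_L F1P LP.
apply: (axis_points_apart e2 ww' ww1' w5 w15 ee1 _ E E1).
apply: contraNneq P0 => Py; have [_ ep1] := one_pm_e_neq0 e2.
have Pz : P 2 = 0.
  move/esym/eqP: E; rewrite Py mulr0 mulf_eq0 mulf_eq0 (negbTE ep1) orbF => /orP[/eqP w0|/eqP //].
  by move/eqP: ww'; rewrite w0 mul0r eq_sym oner_eq0.
by apply/eqP/ffunP; elim/I3_ind; rewrite ffunE.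
Qed.

Lemma contact_conics_apart_q e w e1 w1 P : e ^+ 2 = 5 -> w ^+ 5 = 1 -> w1 ^+ 5 = 1 ->
  e1 = e \/ e1 = - e -> on_curve (conic e w) P -> on_curve (conic e1 w1) P -> on_curve q P ->
  e = e1 /\ w = w1.
Proof.
move=> e2 w5 w15 ee1 FP F1P [P0 qP].
have ww' := rootV w5; have ww1' := rootV w15.
have e12 : e1 ^+ 2 = 5 by case: ee1 => ->; rewrite ?sqrrN.
have [t [a [a0 st Px Py Pz]]] := contact_conic_param e2 ww' w5 FP qP.
have [t1 [a1 [a10 st1 Px1 Py1 Pz1]]] := contact_conic_param e12 ww1' w15 F1P qP.
have n20 : (20 : k) != 0 by rewrite pnatr_eq0.
have aa : a = a1 by apply: (mulIf n20); rewrite -Px -Px1.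
rewrite sigma5_eval in st; rewrite sigma5_eval in st1.
apply: (contact_points_apart e2 ww' ww1' w5 w15 ee1 st st1); apply: (mulfI a0).
  by rewrite -Py Py1 aa.
by rewrite !mulNr -Pz Pz1 aa.
Qed.

(** Conics that coincide would share this contact point. *)
Lemma contact_conic_meets e w : e ^+ 2 = 5 -> w ^+ 5 = 1 ->
  exists P, on_curve (conic e w) P /\ on_curve L P.
Proof.
move=> e2 w5; have ww' := rootV w5; have [en1 ep1] := one_pm_e_neq0 e2.
exists (vec3 0 (w * (1 + e)) (w^-1 * (e - 1))).
have P0 : vec3 0 (w * (1 + e)) (w^-1 * (e - 1)) != 0.
  apply/eqP => /ffunP /(_ 1); rewrite !ffunE /= => /eqP; rewrite mulf_eq0 (negbTE ep1) orbF => /eqP w0.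
  by move/eqP: ww'; rewrite w0 mul0r eq_sym oner_eq0.
split; split=> //.
  rewrite contact_conic_eval !ffunE /=; ring: ww'.
by rewrite linear_form_eval sum_I3 /triple !ffunE /=; ring.
Qed.

(** The square root [s] of 5 is combined with the first five powers of [z], and
its opposite with four of the five. *)
Lemma quintic_configuration :
  exists (q l : tpoly k) (F : 'I_9 -> tpoly k),
     (plane_curve 5 q /\ smooth q) /\
     plane_curve 1 l /\
     (forall i : 'I_9, plane_curve 2 (F i)) /\
     (forall i j : 'I_9, i <> j -> ~ same_curve (F i) (F j)) /\
     (forall (i : 'I_9) (P : ppoint k),
        ~ (on_curve (F i) P /\ on_curve q P /\ on_curve l P)) /\
     (forall i : 'I_9, even_intersections (F i) q) /\
     (forall i : 'I_9, even_intersections (F i) l) /\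
     (forall (i j : 'I_9) (P : ppoint k), i <> j ->
        on_curve (F i) P -> on_curve (F j) P ->
        ~ (on_curve q P \/ on_curve l P)) /\
     (forall i : 'I_9, cuts_odd_theta (F i) q).
Proof.
have [z z5] : exists z : k, 5.-primitive_root z by exact: prim_root_exists.
pose s : k := sqrtC 5; have s2 : s ^+ 2 = 5 by exact: sqrtCK.
pose e (i : 'I_9) := if (i < 5)%N then s else - s.
pose w (i : 'I_9) := z ^+ i.
have e2 i : e i ^+ 2 = 5 by rewrite /e; case: ifP; rewrite ?sqrrN.
have w5 i : w i ^+ 5 = 1 by rewrite /w -exprM mulnC exprM (prim_expr_order z5) expr1n.
have ww' i := rootV (w5 i).
have ee i j : e j = e i \/ e j = - e i.
  by rewrite /e; do 2!case: ifP => _; rewrite ?opprK; [left|right|right|left].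
have ew_inj i j : e i = e j /\ w i = w j -> i = j.
  have ss : (s == - s) = false by rewrite -addr_eq0 -mulr2n mulrn_eq0 (negbTE (e_neq0 s2)).
  move=> [/eqP + /eqP]; rewrite /w (eq_prim_root_expr z5) /e => eij wij.
  apply: val_inj; move: eij wij.
  case: ltnP => i5; case: ltnP => j5; rewrite ?(eq_sym _ s) ?ss // => _ ij.
    exact: modn5_inj ij.
  exact: modn5_inj_shift (ltn_ord i) (ltn_ord j) i5 j5 ij.
have apart i j P : on_curve (conic (e i) (w i)) P -> on_curve (conic (e j) (w j)) P ->
    on_curve q P \/ on_curve L P -> i = j.
  move=> iP jP [qP|LP]; apply: ew_inj.
    exact: contact_conics_apart_q (ee i j) iP jP qP.
  exact: contact_conics_apart_L (ee i j) iP jP LP.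
exists q, L, (fun i => conic (e i) (w i)).
split; first split.
- by apply: diagonal_plane_curve => //; apply: quintic_coef_neq0.
- by apply: diagonal_smooth => //; apply: quintic_coef_neq0.
split; first exact: line_plane_curve (axis_frame k).
split; first by move=> i; apply: contact_conic_curve.
split.
  move=> i j ij [c c0 E]; apply: ij.
  have [P [iP LP]] := contact_conic_meets (e2 i) (w5 i).
  apply: (apart i j P iP _ (or_intror LP)); split; first by case: iP.
  have [_ /eqP] := iP; rewrite E mevalZ mulf_eq0 (negbTE c0) => /eqP; exact.
split; first by move=> i P; apply: contact_conic_disjoint.
split; first by move=> i; apply: contact_conic_even_q.
split; first by move=> i; apply: contact_conic_even_L.
split; first by move=> i j P ij iP jP fP; apply: ij; apply: apart iP jP fP.
by move=> i; apply: (contact_conic_theta (e2 i) (ww' i) (w5 i) z5).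
Qed.
End QuinticFamily.

Theorem corollary5p18 (R : realType) :
  (exists (q l : tpoly R[i]) (F : 'I_9 -> tpoly R[i]),
     (plane_curve 5 q /\ smooth q) /\
     plane_curve 1 l /\
     (forall i : 'I_9, plane_curve 2 (F i)) /\
     (forall i j : 'I_9, i <> j -> ~ same_curve (F i) (F j)) /\
     (forall (i : 'I_9) (P : ppoint R[i]),
        ~ (on_curve (F i) P /\ on_curve q P /\ on_curve l P)) /\
     (forall i : 'I_9, even_intersections (F i) q) /\
     (forall i : 'I_9, even_intersections (F i) l) /\
     (forall (i j : 'I_9) (P : ppoint R[i]), i <> j ->
        on_curve (F i) P -> on_curve (F j) P ->
        ~ (on_curve q P \/ on_curve l P)) /\
     (forall i : 'I_9, cuts_odd_theta (F i) q)) /\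
  (exists (r b : tpoly R[i]) (G : 'I_7 -> tpoly R[i]),
     (plane_curve 4 r /\ smooth r) /\
     plane_curve 2 b /\
     (forall i : 'I_7, plane_curve 1 (G i)) /\
     (forall i j : 'I_7, i <> j -> ~ same_curve (G i) (G j)) /\
     (forall (i : 'I_7) (P : ppoint R[i]),
        ~ (on_curve (G i) P /\ on_curve r P /\ on_curve b P)) /\
     (forall i : 'I_7, even_intersections (G i) r) /\
     (forall i : 'I_7, even_intersections (G i) b) /\
     (forall (i j : 'I_7) (P : ppoint R[i]), i <> j ->
        on_curve (G i) P -> on_curve (G j) P ->
        ~ (on_curve r P \/ on_curve b P)) /\
     (forall i : 'I_7, cuts_odd_theta (G i) r)).
Proof. by split; [exact: quintic_configuration | exact: quartic_configuration]. Qed.
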